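(* Let $\mathcal L=\mathbb C^d$ and let the data set $(B_1,B_2,C_1,C_2,K)$ satisfy: (A1) $K(B_2h,B_1g)-K(B_1h,B_2g)=(C_1h,C_2g)_{\mathbb C^d}-(C_2h,C_1g)_{\mathbb C^d}$ for all $h,g\in\mathcal X$; (A3) $B_2=I_{\mathcal X}$ and the operators $B_1:\mathcal X\subset\mathcal H\to\mathcal H$, $C_1,C_2:\mathcal X\subset\mathcal H\to\mathcal L$ are bounded; and let $\ker K=\{0\}$ and $\operatorname{ran} C_2=\mathcal L=\mathbb C^d$. Let $$\Theta(\lambda)=\begin{bmatrix}\theta_{11}(\lambda)&\theta_{12}(\lambda)\\ \theta_{21}(\lambda)&\theta_{22}(\lambda)\end{bmatrix}=I_{\mathcal L\oplus\mathcal L}-\lambda\begin{bmatrix}\widetilde C_1\\ \widetilde C_2\end{bmatrix}(I_{\mathcal H}-\lambda\widetilde B_1)^{-1}\begin{bmatrix}\widetilde C_2^+&-\widetilde C_1^+\end{bmatrix}.$$ Then the formula $$m(\lambda)=(\theta_{11}(\lambda)q(\lambda)+\theta_{12}(\lambda)p(\lambda))(\theta_{21}(\lambda)q(\lambda)+\theta_{22}(\lambda)p(\lambda))^{-1}$$ establishes a 1-1 correspondence between the set of all solutions $m$ of Problem $AIP(B_1,B_2,C_1,C_2,K)$ in the class $N^{d\times d}$ and the set of all equivalence classes of Nevanlinna pairs $\{p,q\}\in\widetilde N(\mathcal L)$.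
   Context: Data set: $\mathcal X$ is a complex linear space, $B_1,B_2$ are linear operators in $\mathcal X$, $C_1,C_2:\mathcal X\to\mathbb C^d$ are linear, $K$ is a nonnegative sesquilinear form on $\mathcal X$ (linear in the first argument). Since $\ker K=\{h:K(h,h)=0\}=\{0\}$, $\mathcal H$ is the completion of $\mathcal X$ with respect to the inner product $K(\cdot,\cdot)$, and $\mathcal X\subset\mathcal H$. $\widetilde B_1$ (bounded on $\mathcal H$) and $\widetilde C_1,\widetilde C_2:\mathcal H\to\mathcal L$ denote the continuous extensions of $B_1,C_1,C_2$; $\widetilde C_j^+:\mathcal L\to\mathcal H$ is the Hilbert space adjoint, $(\widetilde C_j^+u,h)_{\mathcal H}=(u,\widetilde C_jh)_{\mathcal L}$. The formulas are understood for $\lambda\in\mathbb C\setminus\mathbb R$ such that $I_{\mathcal H}-\lambda\widetilde B_1$ is boundedly invertible. $N^{d\times d}$ is the class of holomorphic $d\times d$ matrix functions $m$ on $\mathbb C\setminus\mathbb R$ with $m(\bar\lambda)=m(\lambda)^*$ for which the kernel $\mathsf N^m_\omega(\lambda)=\frac{m(\lambda)-m(\omega)^*}{\lambda-\bar\omega}$ is nonnegative on $\mathbb C_+$. $\mathcal H(m)$ is the reproducing kernel Hilbert space of $\mathbb C^d$-valued functions on $\mathbb C\setminus\mathbb R$ with kernel $\mathsf N^m_\omega(\lambda)$. Problem $AIP(B_1,B_2,C_1,C_2,K)$ in $N^{d\times d}$: find $m\in N^{d\times d}$ such that for some linear $F:\mathcal X\to\mathcal H(m)$ and all $h\in\mathcal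 X$: (C1) $(FB_2h)(\lambda)-\lambda(FB_1h)(\lambda)=C_1h-m(\lambda)C_2h$; (C2) $\|Fh\|^2_{\mathcal H(m)}\le K(h,h)$. A Nevanlinna pair $\{p,q\}$ in $\mathcal L$ is a pair of functions holomorphic on $\mathbb C\setminus\mathbb R$ with values in the bounded operators on $\mathcal L$ such that (i) the kernel $\frac{q(\bar\lambda)^*p(\bar\omega)-p(\bar\lambda)^*q(\bar\omega)}{\lambda-\bar\omega}$ is nonnegative on $\mathbb C_+$; (ii) $q(\bar\lambda)^*p(\lambda)-p(\bar\lambda)^*q(\lambda)=0$ for $\lambda\in\mathbb C\setminus\mathbb R$; (iii) $p(\lambda)-\lambda q(\lambda)$ is boundedly invertible for $\lambda\in\mathbb C\setminus\mathbb R$. Two pairs $\{p,q\}$, $\{p_1,q_1\}$ are equivalent if $p_1=p\chi$, $q_1=q\chi$ for some operator function $\chi$ holomorphic and invertible on $\mathbb C\setminus\mathbb R$. $\widetilde N(\mathcal L)$ is the set of equivalence classes of Nevanlinna pairs. *)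

(* Defs.v *)
From HB Require Import structures.
From mathcomp Require Import all_boot all_order all_algebra.
From mathcomp Require Import all_classical all_reals all_analysis.
From mathcomp Require Import complex.
Set Implicit Arguments.
Unset Strict Implicit.
Unset Printing Implicit Defensive.
Import Order.TTheory GRing.Theory Num.Theory Num.Def.
Import numFieldNormedType.Exports.
Local Open Scope classical_set_scope.
Local Open Scope sesquilinear_scope.
Local Open Scope ring_scope.

(* A function on C \ R is represented by a total function on R[i] whose values
   at real points are never used; hence [eq_nonreal] below. *)

(* Linear in the first argument, antilinear in the second. *)
Notation sesquilinear X := {bilinear X -> X -> _ | *%R & conjC \; *%R}.

Section Defs.
Variable R : realType.
Local Notation C := R[i].

Definition nonreal : set C := [set z | z \isn't Num.real].
Definition upper : set C := [set z | 0 < 'Im z].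

Section Operators.
Variables (U V : lmodType C) (kU : U -> U -> C) (kV : V -> V -> C).

(* Boundedness for the norms x |-> sqrt (kU x x) and y |-> sqrt (kV y y), with
   the inequality squared. *)
Definition bounded_op (T : U -> V) : Prop :=
  exists M : C, forall x, kV (T x) (T x) <= M * kU x x.

Definition is_adjoint (T : U -> V) (T' : V -> U) : Prop :=
  forall v u, kU (T' v) u = kV v (T u).

End Operators.

(* The norm of H is the one given by the inner product; with the completeness
   of H this makes (H, ip) a Hilbert space. *)
Definition norm_of_dot (H : completeNormedModType C) (ip : {dot H for conjC})
    : Prop :=
  forall x : H, `|x| ^+ 2 = ip x x.

(* (H, ip) together with the inclusion iota is the completion of (X, K). *)
Definition is_completion (X : lmodType C) (K : X -> X -> C)
    (H : completeNormedModType C) (ip : {dot H for conjC}) (iota : X -> H)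
    : Prop :=
  [/\ norm_of_dot ip,
      (forall x y, ip (iota x) (iota y) = K x y)
    & dense (range iota)].

Section Cd.
Variable d : nat.

Definition cdot (u v : 'cV[C]_d) : C := \sum_i u i 0 * (v i 0)^*.

Definition mx_of_fun n (T : 'cV[C]_n -> 'cV[C]_n) : 'M[C]_n :=
  \matrix_(i, j) T (delta_mx j 0) i 0.

(* Complex differentiability of all entries at every point of C \ R. *)
Definition holomorphic_mx (f : C -> 'M[C]_d) : Prop :=
  forall i j z, nonreal z ->
    derivable ((fun w => f w i j) : C^o -> C^o) z 1.

Definition eq_nonreal (f g : C -> 'M[C]_d) : Prop :=
  forall z, nonreal z -> f z = g z.

(* k w z is the kernel k_w(z). *)
Definition nonneg_kernel (Om : set C) (k : C -> C -> 'M[C]_d) : Prop :=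
  forall n (z : 'I_n -> C) (u : 'I_n -> 'cV[C]_d), (forall i, Om (z i)) ->
    0 <= \sum_i \sum_j cdot (k (z j) (z i) *m u j) (u i).

(* The difference quotient is completed by the derivative of m at the points
   z = conj w, which do occur when z and w range over C \ R. *)
Definition nev_kernel (m : C -> 'M[C]_d) (w z : C) : 'M[C]_d :=
  if z == w^* then
    \matrix_(i, j) (derive1 ((fun x => m x i j) : C^o -> C^o) z : C)
  else (z - w^*)^-1 *: (m z - (m w) ^t*).

Definition nevanlinna (m : C -> 'M[C]_d) : Prop :=
  [/\ holomorphic_mx m,
      (forall z, nonreal z -> m z^* = (m z) ^t*)
    & nonneg_kernel upper (nev_kernel m)].

(* The Hilbert space (E, ip) is the reproducing kernel space on Om with kernel
   k: ev z f is the value at z of the function on Om represented by f : E. *)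
Definition is_rkhs (Om : set C) (k : C -> C -> 'M[C]_d)
    (E : completeNormedModType C) (ip : {dot E for conjC})
    (ev : C -> {linear E -> 'cV[C]_d}) : Prop :=
  [/\ norm_of_dot ip,
      (forall f g, (forall z, Om z -> ev z f = ev z g) -> f = g)
    & forall w u, Om w -> exists kwu : E,
        (forall z, Om z -> ev z kwu = k w z *m u) /\
        (forall f, ip f kwu = cdot (ev w f) u)].

Definition AIP_solution (X : lmodType C) (B1 B2 : X -> X)
    (C1 C2 : X -> 'cV[C]_d) (K : X -> X -> C) (m : C -> 'M[C]_d) : Prop :=
  nevanlinna m /\
  exists (Hm : completeNormedModType C) (ip : {dot Hm for conjC})
         (ev : C -> {linear Hm -> 'cV[C]_d}),
    is_rkhs nonreal (nev_kernel m) ip ev /\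
    exists F : {linear X -> Hm},
      (forall h z, nonreal z ->
         ev z (F (B2 h)) - z *: ev z (F (B1 h)) = C1 h - m z *m C2 h) /\
      (forall h, ip (F h) (F h) <= K h h).

Definition mxpair := ((C -> 'M[C]_d) * (C -> 'M[C]_d))%type.

Definition pair_kernel (pq : mxpair) (w z : C) : 'M[C]_d :=
  let: (p, q) := pq in
  (z - w^*)^-1 *: ((q z^*) ^t* *m p w^* - (p z^*) ^t* *m q w^*).

Definition nevanlinna_pair (pq : mxpair) : Prop :=
  let: (p, q) := pq in
  [/\ holomorphic_mx p /\ holomorphic_mx q,
      nonneg_kernel upper (pair_kernel pq),
      (forall z, nonreal z -> (q z^*) ^t* *m p z - (p z^*) ^t* *m q z = 0)
    & (forall z, nonreal z -> p z - z *: q z \in unitmx)].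

Definition equiv_pair (pq pq1 : mxpair) : Prop :=
  exists chi : C -> 'M[C]_d,
    [/\ holomorphic_mx chi,
        (forall z, nonreal z -> chi z \in unitmx),
        eq_nonreal pq1.1 (fun z => pq.1 z *m chi z)
      & eq_nonreal pq1.2 (fun z => pq.2 z *m chi z)].

Section ResolventMatrix.
Variables (H : completeNormedModType C) (ip : {dot H for conjC}).

Definition is_resolvent (B : H -> H) (z : C) (S : H -> H) : Prop :=
  [/\ bounded_op ip ip S,
      (forall x, S (x - z *: B x) = x)
    & (forall y, S y - z *: B (S y) = y)].

Definition regular_point (B : H -> H) (z : C) : Prop :=
  exists S, is_resolvent B z S.

(* (I - z B)^-1, a junk value when z is not a regular point. *)
Definition resolvent (B : H -> H) (z : C) : H -> H :=
  xget (fun=> 0) [set S | is_resolvent B z S].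

(* Elements of L (+) L are written col_mx u1 u2. *)
Definition Theta (B : H -> H) (C1 C2 : H -> 'cV[C]_d)
    (C1' C2' : 'cV[C]_d -> H) (z : C) : 'M[C]_(d + d) :=
  1%:M - z *: mx_of_fun (fun u : 'cV[C]_(d + d) =>
    let r := resolvent B z (C2' (usubmx u) - C1' (dsubmx u)) in
    col_mx (C1 r) (C2 r)).

End ResolventMatrix.

Section LinearFractional.
Variables (Th : 'M[C]_(d + d)) (p q : 'M[C]_d).

Definition lft_num : 'M[C]_d := ulsubmx Th *m q + ursubmx Th *m p.
Definition lft_den : 'M[C]_d := dlsubmx Th *m q + drsubmx Th *m p.

End LinearFractional.
End Cd.
End Defs.

(* r is (the lift of) the graph of a bijection from the quotient A / eqA to the
   quotient B / eqB. *)
Definition one_to_one_mod (T U : Type) (A : set T) (eqA : T -> T -> Prop)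
    (B : set U) (eqB : U -> U -> Prop) (r : T -> U -> Prop) : Prop :=
  [/\ forall a, A a -> exists b, B b /\ r a b,
      forall b, B b -> exists a, A a /\ r a b
    & forall a a' b b', A a -> A a' -> B b -> B b' -> r a b -> r a' b' ->
        (eqA a a' <-> eqB b b')].

(* Main.v *)
(* Let A = B1 - C1^+ C2 on the completion H. By (A1) it is selfadjoint, so
   S0(z) = (1 - z A)^-1 exists for every nonreal z. Put M_jk(z) = C_j S0(z) C_k^+.
   For a Nevanlinna pair {p, q} let Q = q (p - z q)^-1, which determines the pair
   up to equivalence, and S = q (p - z M22 q)^-1 = (1 + z Q - z Q M22)^-1 Q. Then
   the transform of {p, q} by Theta is m = z M11 + (1 - z M12) S (1 - z M21),
   which makes sense for all nonreal z, and N^m is the sum of the Gram kernel of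
   the vectors x_{z,u} = S0(z)^+ (C1^+ u - C2^+ S(z)^+ (1 - z M12(z))^+ u) and of a
   kernel congruent to that of Q. So h |-> ((h, x_{z,u})) maps H contractively
   into H(m); this is the operator F.

   Conversely, for a solution m define S by the same formula near 0, where
   1 - z B1 is invertible. By (C1) the adjoint of F takes the reproducing kernel
   at (z, u) to x_{z,u}, so (C2) says that N^m dominates the Gram kernel. Hence
   Q = (1 - z S + z S M22)^-1 S is defined near 0 in the upper half-plane and has
   a nonnegative resolvent kernel. A Naimark dilation writes Q as the compression
   of the resolvent of a selfadjoint relation, which extends Q to C \ R and yields
   the pair. All identifications are made near 0 and propagated by the identity
   theorem, which for such compressions follows from Taylor expansion. *)

Require Import Defs.
From HB Require Import structures.
From mathcomp Require Import all_boot all_order all_algebra.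
From mathcomp Require Import all_classical all_reals all_analysis.
From mathcomp Require Import complex ring lra.
Set Implicit Arguments.
Unset Strict Implicit.
Unset Printing Implicit Defensive.
Import Order.TTheory GRing.Theory Num.Theory Num.Def.
Import numFieldNormedType.Exports.
Local Open Scope classical_set_scope.
Local Open Scope ring_scope.

(** * Hilbert spaces over R[i] *)

(** The operator [B1t] is not selfadjoint, so 1 - z [B1t] may be singular at nonreal z, and Theta
    constrains m only elsewhere. One disc in the upper half-plane, regular together with its
    conjugate, carries the comparisons, and what is proved there is propagated without Cauchy
    integrals: the resolvent identity supplies Taylor expansions of compressed resolvents, and an
    arbitrary Nevanlinna m is reduced to these through -(m + z)^-1, the fraction of the pair {m,
    -1}. Surjectivity of C2 enters as injectivity of C2^+, which makes 1 + z Q - z Q M22 invertible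
    at every nonreal z. Holomorphy of the transform is read off from an explicit divided difference
    T(z, w), continuous in z: it gives the derivative, the value of N^m at z = conj w and, by its
    Gram form, the nonnegativity. In the given Hilbert space operator equations are solved by
    coercivity; Riesz representation is proved in reproducing kernel spaces, where the dilation is
    built. *)

Section RealNorm.
Variable R : realType.
Local Notation C := R[i].
Local Notation "x %:C" := (real_complex R x).

(** The norm of a module over [R[i]] is itself [R[i]]-valued; its real part puts estimates into the
    ordered field R, where [lra] and [nra] apply. *)
Definition rnorm (V : normedZmodType C) (x : V) : R := complex.Re `|x|.

Lemma rnormE (V : normedZmodType C) (x : V) : (rnorm x)%:C = `|x|.
Proof. by rewrite /rnorm RRe_real ?normr_real. Qed.

Lemma rnorm_ge0 (V : normedZmodType C) (x : V) : 0 <= rnorm x.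
Proof. by rewrite -ler0c rnormE. Qed.

Lemma rnorm0 (V : normedZmodType C) : rnorm (0 : V) = 0.
Proof. by rewrite /rnorm normr0. Qed.

Lemma rnormN (V : normedZmodType C) (x : V) : rnorm (- x) = rnorm x.
Proof. by rewrite /rnorm normrN. Qed.

Lemma rdistC (V : normedZmodType C) (x y : V) : rnorm (x - y) = rnorm (y - x).
Proof. by rewrite /rnorm distrC. Qed.

Lemma rnormD (V : normedZmodType C) (x y : V) :
  rnorm (x + y) <= rnorm x + rnorm y.
Proof. by rewrite -lecR rmorphD/= !rnormE ler_normD. Qed.

Lemma rnormB (V : normedZmodType C) (x y : V) :
  rnorm (x - y) <= rnorm x + rnorm y.
Proof. by rewrite -(rnormN y) rnormD. Qed.

Lemma rdistD (V : normedZmodType C) (z x y : V) :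
  rnorm (x - y) <= rnorm (x - z) + rnorm (z - y).
Proof. by rewrite (_ : x - y = (x - z) + (z - y)) ?rnormD ?addrA ?subrK. Qed.

Lemma rnorm0_eq0 (V : normedZmodType C) (x : V) : rnorm x = 0 -> x = 0.
Proof. by move=> x0; apply/normr0_eq0; rewrite -rnormE x0. Qed.

Lemma rnorm_gt0 (V : normedZmodType C) (x : V) : x != 0 -> 0 < rnorm x.
Proof.
move=> x0; rewrite lt_neqAle rnorm_ge0 andbT eq_sym.
by apply: contra_neq x0; apply: rnorm0_eq0.
Qed.

Lemma rnormM (x y : C) : rnorm (x * y) = rnorm x * rnorm y.
Proof. by apply: complexI; rewrite rmorphM/= !rnormE normrM. Qed.

Lemma rnormV (x : C) : rnorm x^-1 = (rnorm x)^-1.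
Proof. by apply: complexI; rewrite fmorphV/= !rnormE normfV. Qed.

Lemma rnormX (x : C) n : rnorm (x ^+ n) = rnorm x ^+ n.
Proof. by apply: complexI; rewrite rmorphXn/= !rnormE normrX. Qed.

Lemma rnorm1 : rnorm (1 : C) = 1.
Proof. by apply: complexI; rewrite rnormE normr1. Qed.

Lemma rnormZ (V : normedModType C) (a : C) (x : V) :
  rnorm (a *: x) = rnorm a * rnorm x.
Proof. by apply: complexI; rewrite rmorphM/= !rnormE normrZ. Qed.

Lemma rnormJ (x : C) : rnorm x^* = rnorm x.
Proof. by rewrite /rnorm norm_conjC. Qed.

Lemma rnorm_real (x : R) : rnorm (x%:C : C) = `|x|.
Proof. by rewrite /rnorm normc_def/= expr0n/= addr0 sqrtr_sqr. Qed.

Lemma rnormRe (x : C) : `|complex.Re x| <= rnorm x.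
Proof. by rewrite -lecR rnormE normc_ge_Re. Qed.

Lemma rnormIm (x : C) : `|complex.Im x| <= rnorm x.
Proof.
have := rnormRe (x * 'i%C); rewrite ReiNIm normrN rnormM.
by rewrite (_ : rnorm 'i%C = 1) ?mulr1// /rnorm normc_def/= expr0n expr1n add0r sqrtr1.
Qed.

Lemma rnorm_sqr (x : C) :
  rnorm x ^+ 2 = complex.Re x ^+ 2 + complex.Im x ^+ 2.
Proof. by apply: complexI; rewrite rmorphXn/= rnormE -add_Re2_Im2. Qed.

Lemma rnorm_leReIm (x : C) : rnorm x <= `|complex.Re x| + `|complex.Im x|.
Proof.
rewrite -(@ler_pXn2r _ 2)// ?nnegrE ?rnorm_ge0 ?addr_ge0// rnorm_sqr.
by rewrite sqrrD !real_normK ?num_real// lerD2r lerDl mulrn_wge0// mulr_ge0.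
Qed.

Lemma Re_conjM (x : C) : complex.Re (x * x^*) = rnorm x ^+ 2.
Proof. by rewrite -normCK -rnormE -rmorphXn. Qed.

Lemma rcD (x y : R) : (x + y)%:C = x%:C + y%:C :> C.
Proof. exact: rmorphD. Qed.
Lemma rcN (x : R) : (- x)%:C = - x%:C :> C.
Proof. exact: rmorphN. Qed.
Lemma rcM (x y : R) : (x * y)%:C = x%:C * y%:C :> C.
Proof. exact: rmorphM. Qed.
Lemma rcX (x : R) n : (x ^+ n)%:C = x%:C ^+ n :> C.
Proof. exact: rmorphXn. Qed.
Lemma rcV (x : R) : (x^-1)%:C = (x%:C)^-1 :> C.
Proof. exact: fmorphV. Qed.
Definition rcE := (rcD, rcN, rcM, rcX, rcV).

Lemma rcJ (x : R) : (x%:C : C)^* = x%:C.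
Proof. exact: conjc_real. Qed.

Lemma ReD (x y : C) : complex.Re (x + y) = complex.Re x + complex.Re y.
Proof. by case: x; case: y. Qed.
Lemma ReN (x : C) : complex.Re (- x) = - complex.Re x.
Proof. by case: x. Qed.

Lemma ReMr (x : R) (z : C) : complex.Re (x%:C * z) = x * complex.Re z.
Proof. by case: z => a b /=; rewrite mul0r subr0. Qed.

Lemma nonrealE (z : C) : nonreal z <-> complex.Im z != 0.
Proof.
rewrite /nonreal/=; case: z => a b /=.
by rewrite complex_real.
Qed.

Lemma upperE (z : C) : upper z <-> 0 < complex.Im z.
Proof. by rewrite /upper/= -complexIm ltcR. Qed.

Lemma ImJ (z : C) : complex.Im z^* = - complex.Im z.
Proof. by case: z. Qed.

Lemma ReJ (z : C) : complex.Re z^* = complex.Re z.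
Proof. by case: z. Qed.

Lemma nonrealJ (z : C) : nonreal z -> nonreal z^*.
Proof. by move=> /nonrealE h; apply/nonrealE; rewrite ImJ oppr_eq0. Qed.

Lemma upper_nonreal (z : C) : upper z -> nonreal z.
Proof. by move=> /upperE h; apply/nonrealE; rewrite gt_eqF. Qed.

Lemma nonreal_neq0 (z : C) : nonreal z -> z != 0.
Proof. by move=> /nonrealE; apply: contra_neq => ->. Qed.

Lemma nonreal_upper (z : C) : nonreal z -> upper z \/ upper z^*.
Proof.
move=> /nonrealE; rewrite neq_lt => /orP[h|h]; last by left; apply/upperE.
by right; apply/upperE; rewrite ImJ oppr_gt0.
Qed.

Lemma upper_subJ (z w : C) : upper z -> upper w -> z - w^* != 0.
Proof.
move=> /upperE z0 /upperE w0; apply/eqP => /(congr1 (@complex.Im R)).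
by case: z z0 => a b; case: w w0 => a' b' /= ? ?; lra.
Qed.

Lemma nonreal_subJ (z : C) : nonreal z -> z - z^* != 0.
Proof.
move=> /nonrealE z0; apply/eqP => /(congr1 (@complex.Im R)).
by case: z z0 => a b /= /eqP b0 h; apply: b0; lra.
Qed.

Lemma rnorm_i : rnorm ('i%C : C) = 1.
Proof. by rewrite /rnorm normc_def/= expr0n expr1n add0r sqrtr1. Qed.

Lemma conj_i : ('i%C : C)^* = - 'i%C.
Proof. by apply/eqP; rewrite eq_complex/= oppr0 !eqxx. Qed.

Lemma cauchy_seq_cvg (E : completeNormedModType C) (u : nat -> E) :
  (forall e : R, 0 < e -> exists N, forall m n, (N <= m)%N -> (N <= n)%N ->
     rnorm (u m - u n) < e) ->
  exists l, forall e : R, 0 < e -> exists N, forall n, (N <= n)%N ->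
     rnorm (u n - l) < e.
Proof.
move=> uC.
have /cvg_ex[/= l ul] : cvgn u.
  apply/cauchy_cvgP/cauchy_ballP => e e0; rewrite near_simpl.
  have e0' : 0 < complex.Re e by move: e0; rewrite ltcE => /andP[].
  have [N HN] := uC _ e0'.
  exists ([set n | (N <= n)%N], [set n | (N <= n)%N]); first by split; exists N.
  move=> [m n] [/= Nm Nn]; rewrite -ball_normE/= -rnormE.
  rewrite -[e]RRe_real ?gtr0_real// ltcR; exact: HN.
exists l => e e0.
have ee : 0 < e%:C by rewrite ltcR.
move/cvgrPdist_lt: ul => /(_ _ ee)[N _ HN].
by exists N => n Nn; have := HN n Nn; rewrite -rnormE ltcR rdistC.
Qed.

Lemma denseP (X : Type) (E : normedModType C) (f : X -> E) :
  dense (range f) -> forall x (e : R), 0 < e -> exists y, rnorm (x - f y) < e.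
Proof.
move=> df x e e0.
have ee : 0 < e%:C by rewrite ltcR.
have xb : ball x e%:C !=set0 by exists x; apply: ballxx.
have [z [xz [y _ yz]]] := df _ xb (ball_open x _).
by exists y; move: xz; rewrite -yz /= -ball_normE /ball_/= -rnormE ltcR.
Qed.

End RealNorm.

(** * Algebra of inner products *)

Section InnerProduct.
Variable R : realType.
Local Notation C := R[i].
Variables (H : lmodType C) (ip : {dot H for conjC}).

Lemma ipDl x y z : ip (x + y) z = ip x z + ip y z.
Proof. exact: linearDl. Qed.
Lemma ipDr x y z : ip z (x + y) = ip z x + ip z y.
Proof. exact: linearDr. Qed.
Lemma ipZl a x y : ip (a *: x) y = a * ip x y.
Proof. exact: linearZl_LR. Qed.
Lemma ipZr a x y : ip y (a *: x) = a^* * ip y x.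
Proof. exact: linearZr_LR. Qed.
Lemma ipNl x y : ip (- x) y = - ip x y.
Proof. by rewrite -scaleN1r ipZl mulN1r. Qed.
Lemma ipNr x y : ip y (- x) = - ip y x.
Proof. by rewrite -scaleN1r ipZr rmorphN1 mulN1r. Qed.
Lemma ipBl x y z : ip (x - y) z = ip x z - ip y z.
Proof. by rewrite ipDl ipNl. Qed.
Lemma ipBr x y z : ip z (x - y) = ip z x - ip z y.
Proof. by rewrite ipDr ipNr. Qed.
Lemma ip0l x : ip 0 x = 0.
Proof. by rewrite -(scale0r 0) ipZl mul0r. Qed.
Lemma ip0r x : ip x 0 = 0.
Proof. by rewrite -(scale0r 0) ipZr rmorph0 mul0r. Qed.
Lemma ipC x y : ip x y = (ip y x)^*.
Proof. by rewrite (hermC ip) expr0 mul1r. Qed.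
Lemma ip_suml I (r : seq I) P (F : I -> H) x :
  ip (\sum_(i <- r | P i) F i) x = \sum_(i <- r | P i) ip (F i) x.
Proof. by apply: (big_morph (ip^~ x)) => [a b|]; rewrite ?ipDl ?ip0l. Qed.
Lemma ip_sumr I (r : seq I) P (F : I -> H) x :
  ip x (\sum_(i <- r | P i) F i) = \sum_(i <- r | P i) ip x (F i).
Proof. by apply: (big_morph (ip x)) => [a b|]; rewrite ?ipDr ?ip0r. Qed.

Lemma ip_ge0 x : 0 <= ip x x.
Proof.
have [->|x0] := eqVneq x 0; first by rewrite ip0l.
exact/ltW/neq0_dnorm_gt0.
Qed.

Lemma ip_eq0 x : ip x x = 0 -> x = 0.
Proof.
move=> h; apply/eqP/negP => /negP x0.
have : 0 < ip x x by exact: neq0_dnorm_gt0.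
by rewrite h ltxx.
Qed.

Lemma ip_extl x y : (forall z, ip x z = ip y z) -> x = y.
Proof.
by move=> h; apply/subr0_eq/ip_eq0; rewrite ipBl h subrr.
Qed.

Lemma ip_extr x y : (forall z, ip z x = ip z y) -> x = y.
Proof. by move=> h; apply: ip_extl => z; rewrite ipC h -ipC. Qed.

End InnerProduct.

Section Hilbert.
Variable R : realType.
Local Notation C := R[i].
Local Notation "x %:C" := (real_complex R x).

Section PreHilbert.
Variables (H : normedModType C) (ip : {dot H for conjC}).
Hypothesis ipn : forall x : H, `|x| ^+ 2 = ip x x.

Lemma ipxx x : ip x x = (rnorm x ^+ 2)%:C.
Proof. by rewrite -ipn -rnormE -rmorphXn. Qed.

Lemma Re_ipxx x : complex.Re (ip x x) = rnorm x ^+ 2.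
Proof. by rewrite ipxx. Qed.

Lemma cauchy_schwarz x y : rnorm (ip x y) <= rnorm x * rnorm y.
Proof.
have [->|y0] := eqVneq y 0; first by rewrite ip0r !rnorm0 mulr0.
pose b := (rnorm y ^+ 2)%:C.
have bJ : b^* = b by exact: conjc_real.
(* The component of x orthogonal to y, multiplied by |y|^2 so that no division occurs. *)
pose w := b *: x - ip x y *: y.
have : 0 <= complex.Re (ip w w) by rewrite Re_ipxx exprn_ge0 ?rnorm_ge0.
have -> : ip w w = b * (b * ip x x - ip x y * (ip x y)^*).
  rewrite /w ipBl !ipBr !ipZl !ipZr bJ (ipC ip y x) (ipxx y) -/b.
  by rewrite mulrBr; ring.
rewrite ipxx -normCK -rnormE.
rewrite (_ : b * _ = (rnorm y ^+ 2 *
    (rnorm y ^+ 2 * rnorm x ^+ 2 - rnorm (ip x y) ^+ 2))%:C)/=; last first.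
   by rewrite /b !rcE.
rewrite pmulr_rge0 ?exprn_gt0 ?rnorm_gt0// subr_ge0 mulrC -exprMn.
by rewrite ler_pXn2r// nnegrE ?mulr_ge0 ?rnorm_ge0.
Qed.

Lemma rnorm_sqrD x y :
  rnorm (x + y) ^+ 2 = rnorm x ^+ 2 + rnorm y ^+ 2 + complex.Re (ip x y) *+ 2.
Proof.
rewrite -!Re_ipxx ipDl !ipDr (ipC ip y x) !ReD ReJ mulr2n.
ring.
Qed.

Lemma rnorm_sqrB x y :
  rnorm (x - y) ^+ 2 = rnorm x ^+ 2 + rnorm y ^+ 2 - complex.Re (ip x y) *+ 2.
Proof.
by rewrite rnorm_sqrD rnormN ipNr ReN mulNrn.
Qed.

End PreHilbert.

Lemma geometric_small (q K e : R) : 0 <= q -> q < 1 -> 0 < e ->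
  exists N, forall n, (N <= n)%N -> K * q ^+ n < e.
Proof.
move=> q0 q1 e0.
have /cvgrPdist_lt/(_ _ e0)[N _ HN] : geometric K q n @[n --> \oo] --> (0 : R).
  by apply: cvg_geometric; rewrite ger0_norm.
exists N => n /HN; rewrite sub0r normrN /geometric/=.
exact: le_lt_trans (ler_norm _).
Qed.

(** * Equations with a bounded coercive operator *)

Section Coercive.
Variables (H : completeNormedModType C) (ip : {dot H for conjC}).
Hypothesis ipn : forall x : H, `|x| ^+ 2 = ip x x.

(* The map x |-> x - eps (T x - y) is a strict contraction for small eps. *)
Lemma coercive_surj (T : {linear H -> H}) (M c : R) :
  0 < c -> (forall x, rnorm (T x) <= M * rnorm x) ->
  (forall x, c * rnorm x ^+ 2 <= complex.Re (ip (T x) x)) ->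
  forall y, exists x, T x = y.
Proof.
move=> c0 TM Tc y.
(* Enlarging M keeps c / M at most 1, so that k below is nonnegative and has a square root. *)
wlog cM : M TM / c <= M.
  move=> W; apply: (W (Num.max M c)); last by rewrite le_max lexx orbT.
  move=> x; apply: le_trans (TM x) _.
  by rewrite ler_wpM2r ?rnorm_ge0// le_max lexx.
have M0 : 0 < M by apply: lt_le_trans cM.
(* The squared norm of 1 - eps T is at most 1 - 2 eps c + eps^2 M^2; its minimum over eps is k,
   attained at c / M^2. *)
pose eps := c / M ^+ 2; pose k := 1 - (c / M) ^+ 2; pose q := Num.sqrt k.
have cM1 : 0 < c / M <= 1 by rewrite divr_gt0//= ler_pdivrMr// mul1r.
have k0 : 0 <= k.
  by case/andP: cM1 => t0 t1; rewrite subr_ge0 exprn_ile1// ltW.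
have eps0 : 0 < eps by rewrite divr_gt0// exprn_gt0.
have q0 : 0 <= q by rewrite sqrtr_ge0.
have q1 : q < 1.
  rewrite -[X in _ < X]sqrtr1 ltr_sqrt// /k gtrBl exprn_gt0//.
  by case/andP: cM1.
have contr x : rnorm (x - eps%:C *: T x) <= q * rnorm x.
  rewrite -(@ler_pXn2r _ 2)// ?nnegrE ?mulr_ge0 ?rnorm_ge0// exprMn sqr_sqrtr//.
  rewrite (rnorm_sqrB ipn) rnormZ rnorm_real gtr0_norm// ipZr.
  rewrite rcJ ReMr.
  rewrite (ipC ip x) ReJ exprMn.
  have h1 : rnorm (T x) ^+ 2 <= M ^+ 2 * rnorm x ^+ 2.
    by rewrite -exprMn ler_pXn2r// ?nnegrE ?mulr_ge0 ?rnorm_ge0 ?ltW.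
  have -> : k = 1 - 2 * (eps * c) + eps ^+ 2 * M ^+ 2.
    by rewrite /k /eps; field; rewrite gt_eqF.
  have h2 := ler_wpM2l (ltW eps0) (Tc x).
  have h3 := ler_wpM2l (sqr_ge0 eps) h1.
  nra.
pose u := fix u n := if n is n'.+1 then u n' - eps%:C *: (T (u n') - y) else 0.
pose d n := u n.+1 - u n.
have dE n : d n = eps%:C *: (y - T (u n)).
  by rewrite /d /= addrAC subrr add0r -scalerN opprB.
have dS n : d n.+1 = d n - eps%:C *: T (d n).
  have -> : T (d n) = T (u n.+1) - T (u n) by exact: linearB.
  by rewrite !dE -scalerBr opprB addrA subrK.
have dle n : rnorm (d n) <= q ^+ n * rnorm (d 0%N).
  elim: n => [|n IH]; first by rewrite expr0 mul1r.
  rewrite dS exprS -mulrA; apply: le_trans (contr _) _.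
  exact: ler_wpM2l.
pose K := rnorm (d 0%N) / (1 - q).
have K0 : 0 <= K by rewrite divr_ge0 ?rnorm_ge0// subr_ge0 ltW.
have uB n j : rnorm (u (n + j)%N - u n) <= K * q ^+ n.
  have : rnorm (u (n + j)%N - u n) <= K * q ^+ n - K * q ^+ (n + j).
    elim: j => [|j IH]; first by rewrite addn0 !subrr rnorm0.
    rewrite addnS; apply: le_trans (rdistD (u (n + j)%N) _ _) _.
    apply: le_trans (lerD (dle _) IH) _.
    rewrite (_ : rnorm (d 0%N) = K * (1 - q)); last first.
      by rewrite /K divfK// gt_eqF// subr_gt0.
    by rewrite exprS le_eqVlt; apply/orP; left; apply/eqP; ring.
  by move=> h; apply: le_trans h _; rewrite gerBl mulr_ge0 ?exprn_ge0.
have [l ul] : exists l, forall e : R, 0 < e -> exists N, forall n, (N <= n)%N ->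
     rnorm (u n - l) < e.
  apply: cauchy_seq_cvg => e e0.
  have [N HN] := geometric_small K q0 q1 e0.
  exists N => m n Nm Nn; wlog mn : m n Nm Nn / (n <= m)%N.
    by move=> W; case/orP: (leq_total n m) => h; [exact: W|rewrite rdistC; exact: W].
  by rewrite -(subnKC mn); apply: le_lt_trans (uB _ _) (HN _ Nn).
exists l; apply/subr0_eq/rnorm0_eq0/eqP; rewrite eq_le rnorm_ge0 andbT.
apply/ler_addgt0Pl => e e0; rewrite addr0.
have M1 : 0 < M + 1 + eps^-1 by rewrite !addr_gt0 ?invr_gt0.
have [N HN] := ul _ (divr_gt0 (divr_gt0 e0 (ltr0n _ 2)) M1).
have h1 := HN _ (leqnn N); have h2 := HN _ (leqnSn N).
(* The defect of the limit is controlled by l - u N and by the single increment d N, which measures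
   the defect at u N. *)
have -> : T l - y = T (l - u N) - eps^-1%:C *: d N.
  rewrite dE scalerA -rcM mulVf ?gt_eqF// scale1r linearB opprB.
  by rewrite addrA subrK.
apply: le_trans (rnormB _ _) _; rewrite rnormZ rnorm_real ger0_norm ?invr_ge0 ?ltW//.
have h3 : rnorm (d N) <= e / 2 / (M + 1 + eps^-1) *+ 2.
  rewrite mulr2n; apply: le_trans (rdistD l _ _) _.
  by rewrite (rdistC l) lerD// ltW.
have h4 := TM (l - u N); rewrite rdistC in h1.
have h5 : M * rnorm (l - u N) <= M * (e / 2 / (M + 1 + eps^-1)).
  by rewrite ler_wpM2l// ltW.
have h6 : eps^-1 * rnorm (d N) <= eps^-1 * (e / 2 / (M + 1 + eps^-1) *+ 2).
  by rewrite ler_wpM2l// invr_ge0 ltW.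
have h7 := lerD (le_trans h4 h5) h6.
apply: le_lt_trans h7 _.
set s := e / 2 / _.
have s0 : 0 < s by rewrite !divr_gt0.
have -> : e = s * (M + 1 + eps^-1) * 2 by rewrite /s divfK ?gt_eqF// divfK.
have : 0 < eps^-1 by rewrite invr_gt0.
move: (eps^-1) => ei ei0; rewrite mulr2n; nra.
Qed.
End Coercive.
End Hilbert.

(** * Reproducing kernel spaces *)

Section PdKernel.
Variable R : realType.
Local Notation C := R[i].
Local Notation "x %:C" := (real_complex R x).

(* [k s t] plays the role of the inner product of k_s and k_t, that is of the
   value k_s(t). *)
Record pdkernel (T : Type) := PdKernel {
  kfun :> T -> T -> C;
  kfunC : forall s t, kfun s t = (kfun t s)^*;
  kfun_ge0 : forall v : seq (C * T),
    0 <= \sum_(x <- v) \sum_(y <- v) x.1 * y.1^* * kfun x.2 y.2 }.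

Variables (T : Type) (k : pdkernel T).
Implicit Types (f g : T -> C) (v w : seq (C * T)).

(** The inner product of f with [kcomb v], as the reproducing property prescribes it; it makes sense
    for every function f, in the space or not. *)
Definition fpair f v : C := \sum_(x <- v) x.1^* * f x.2.
Definition kcomb v : T -> C := fun t => \sum_(x <- v) x.1 * k x.2 t.
Definition fscale (a : C) v := [seq (a * x.1, x.2) | x <- v].
Definition knorm2 v : R := complex.Re (fpair (kcomb v) v).

Lemma fpairD f g v : fpair (f + g) v = fpair f v + fpair g v.
Proof. by rewrite /fpair -big_split; apply: eq_bigr => x _; rewrite /= -mulrDr. Qed.

Lemma fpairZ a f v : fpair (a *: f) v = a * fpair f v.
Proof. by rewrite /fpair mulr_sumr; apply: eq_bigr => x _; rewrite mulrCA. Qed.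

Lemma fpairN f v : fpair (- f) v = - fpair f v.
Proof. by rewrite -scaleN1r fpairZ mulN1r. Qed.

Lemma fpair_cat f v w : fpair f (v ++ w) = fpair f v + fpair f w.
Proof. exact: big_cat. Qed.

Lemma fpair_scale f a v : fpair f (fscale a v) = a^* * fpair f v.
Proof.
rewrite /fpair /fscale big_map mulr_sumr; apply: eq_bigr => x _ /=.
by rewrite rmorphM/= mulrA.
Qed.

Lemma kcomb_cat v w : kcomb (v ++ w) = kcomb v + kcomb w.
Proof. by apply/funext => t; rewrite /kcomb big_cat. Qed.

Lemma kcomb_scale a v : kcomb (fscale a v) = a *: kcomb v.
Proof.
apply/funext => t; rewrite /kcomb big_map/= [RHS]mulr_sumr.
by apply: eq_bigr => x _; rewrite mulrA.
Qed.

Lemma fpair_kcombC v w : fpair (kcomb v) w = (fpair (kcomb w) v)^*.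
Proof.
rewrite /fpair /kcomb rmorph_sum/=.
under eq_bigr do rewrite mulr_sumr.
rewrite exchange_big; apply: eq_bigr => x _; rewrite rmorphM/= conjCK.
rewrite rmorph_sum mulr_sumr/=; apply: eq_bigr => y _.
by rewrite rmorphM/= -kfunC mulrCA.
Qed.

Lemma fpair_kcomb_ge0 v : 0 <= fpair (kcomb v) v.
Proof.
have := kfun_ge0 k v; rewrite /fpair /kcomb exchange_big.
congr (_ <= _); apply: eq_bigr => y _; rewrite mulr_sumr.
by apply: eq_bigr => x _; rewrite mulrA (mulrC y.1^*).
Qed.

Lemma knorm2_ge0 v : 0 <= knorm2 v.
Proof. by have := fpair_kcomb_ge0 v; rewrite lecE => /andP[]. Qed.

Lemma knorm2_scale a v : knorm2 (fscale a v) = rnorm a ^+ 2 * knorm2 v.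
Proof.
rewrite /knorm2 kcomb_scale fpairZ fpair_scale mulrA -normCK -rnormE -rmorphXn/=.
exact: ReMr.
Qed.

Lemma knorm2_cat v w :
  knorm2 (v ++ w) = knorm2 v + knorm2 w + 2 * complex.Re (fpair (kcomb v) w).
Proof.
rewrite /knorm2 kcomb_cat fpairD !fpair_cat (fpair_kcombC w v) !(ReD, ReN) ReJ.
ring.
Qed.

(* [energy f v] is |f|^2 - |f - v|^2 in the space of [k], where [v] stands for the
   combination [kcomb v]; hence [enorm2 f] is the squared norm of f. *)
Definition energy f v : R := 2 * complex.Re (fpair f v) - knorm2 v.
(** Membership in the space. Characterising it by bounded energy makes the elements functions on T
    from the start, so no abstract completion is formed. *)
Definition fbounded f := exists c : R, forall v, energy f v <= c.
Definition enorm2 f : R := sup (range (energy f)).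

Lemma energy_nil f : energy f [::] = 0.
Proof. by rewrite /energy /knorm2 /fpair !big_nil mulr0 subr0. Qed.

Lemma energyZ a f v : a != 0 ->
  energy (a *: f) v = rnorm a ^+ 2 * energy f (fscale a^-1 v).
Proof.
move=> a0; rewrite /energy fpairZ fpair_scale knorm2_scale mulrBr.
have a0' : rnorm a != 0 by rewrite gt_eqF ?rnorm_gt0.
congr (_ - _); last by rewrite rnormV mulrA -exprMn divff// expr1n mul1r.
rewrite mulrCA; congr (_ * _); rewrite -ReMr; congr complex.Re.
by rewrite rcX rnormE normCK fmorphV/=; field; rewrite conjC_eq0.
Qed.

Lemma fbounded0 : fbounded 0.
Proof.
exists 0 => v; rewrite /energy /fpair big1 => [|x _]; last by rewrite mulr0.
by rewrite mulr0 sub0r oppr_le0 knorm2_ge0.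
Qed.

Lemma fboundedZ a f : fbounded f -> fbounded (a *: f).
Proof.
have [->|a0] := eqVneq a 0; first by rewrite scale0r => _; exact: fbounded0.
move=> [c fc]; exists (rnorm a ^+ 2 * c) => v.
by rewrite energyZ// ler_wpM2l// exprn_ge0// rnorm_ge0.
Qed.

Lemma energyD f g v :
  energy (f + g) v = (energy (2 *: f) v + energy (2 *: g) v) / 2.
Proof.
rewrite /energy fpairD !fpairZ ReD -[2 : C](rmorph_nat (real_complex R)).
by rewrite !ReMr; field.
Qed.

Lemma fboundedD f g : fbounded f -> fbounded g -> fbounded (f + g).
Proof.
move=> /(fboundedZ 2)[c fc] /(fboundedZ 2)[e ge]; exists ((c + e) / 2) => v.
by rewrite energyD ler_wpM2r ?invr_ge0// lerD.
Qed.

Lemma energy_le f v : fbounded f -> energy f v <= enorm2 f.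
Proof.
move=> [c fc]; apply: ub_le_sup; last by exists v.
by exists c => _ [w _ <-].
Qed.

Lemma enorm2_le f c : (forall v, energy f v <= c) -> enorm2 f <= c.
Proof.
move=> fc; apply: ge_sup; first by exists (energy f [::]); exists [::].
by move=> _ [w _ <-].
Qed.

Lemma enorm2_ge0 f : fbounded f -> 0 <= enorm2 f.
Proof. by move=> bf; rewrite -(energy_nil f) energy_le. Qed.

Lemma enorm2_0 : enorm2 0 = 0.
Proof.
apply/eqP; rewrite eq_le (enorm2_ge0 fbounded0) andbT enorm2_le// => v.
rewrite /energy /fpair big1 => [|x _]; last by rewrite mulr0.
by rewrite mulr0 sub0r oppr_le0 knorm2_ge0.
Qed.

Lemma enorm2Z a f : fbounded f -> enorm2 (a *: f) = rnorm a ^+ 2 * enorm2 f.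
Proof.
move=> bf; have [->|a0] := eqVneq a 0.
  by rewrite scale0r enorm2_0 rnorm0 expr0n mul0r.
have le b h : b != 0 -> fbounded h -> enorm2 (b *: h) <= rnorm b ^+ 2 * enorm2 h.
  move=> b0 bh; apply: enorm2_le => v.
  by rewrite energyZ// ler_wpM2l ?energy_le// exprn_ge0// rnorm_ge0.
apply/eqP; rewrite eq_le le//=.
have /le/(_ (fboundedZ a bf)) : a^-1 != 0 by rewrite invr_eq0.
by rewrite scalerA mulVf// scale1r rnormV exprVn ler_pdivlMl// exprn_gt0 ?rnorm_gt0.
Qed.

(** Testing f + g on v + w and f - g on v - w gives twice the energies of f at v and of g at w,
    which yields one inequality; the other is the same one applied to f + g and f - g. *)
Lemma enorm2_parallelogram f g : fbounded f -> fbounded g ->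
  enorm2 (f + g) + enorm2 (f - g) = 2 * enorm2 f + 2 * enorm2 g.
Proof.
have bB f1 g1 : fbounded f1 -> fbounded g1 -> fbounded (f1 - g1).
  by move=> bf bg; rewrite -scaleN1r; apply/fboundedD/fboundedZ.
have half f1 g1 : fbounded f1 -> fbounded g1 ->
    2 * enorm2 f1 + 2 * enorm2 g1 <= enorm2 (f1 + g1) + enorm2 (f1 - g1).
  move=> bf bg; rewrite -mulrDr -ler_pdivlMl// addrC -lerBrDr.
  apply: enorm2_le => w; rewrite lerBrDr addrC -lerBrDr.
  apply: enorm2_le => v; rewrite lerBrDr ler_pdivlMl//.
  have h1 := energy_le (v ++ w) (fboundedD bf bg).
  have h2 := energy_le (v ++ fscale (-1) w) (bB _ _ bf bg).
  apply: le_trans (lerD h1 h2).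
  rewrite /energy !fpairD !fpairN !fpair_cat !fpair_scale !knorm2_cat.
  rewrite knorm2_scale rnormN rnorm1 expr1n fpair_scale rmorphN1 !mulN1r.
  by rewrite !(ReD, ReN) le_eqVlt; apply/orP; left; apply/eqP; ring.
move=> bf bg; apply/eqP; rewrite eq_le half// andbT.
have := half _ _ (fboundedD bf bg) (bB _ _ bf bg).
have E1 : f + g + (f - g) = 2 *: f by apply/funext => t; rewrite !fctE /GRing.scale/=; ring.
have E2 : f + g - (f - g) = 2 *: g by apply/funext => t; rewrite !fctE /GRing.scale/=; ring.
rewrite E1 E2 !enorm2Z//.
rewrite (_ : rnorm (2 : C) = 2); last first.
  by rewrite -[2 : C](rmorph_nat (real_complex R)) rnorm_real ger0_norm.
by move=> h; lra.
Qed.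

Lemma Re_fpair_le f v : fbounded f ->
  complex.Re (fpair f v) <= Num.sqrt (enorm2 f) * Num.sqrt (knorm2 v).
Proof.
move=> bf; set r := complex.Re _.
have [r0|r0] := leP r 0; first exact: le_trans r0 (mulr_ge0 (sqrtr_ge0 _) (sqrtr_ge0 _)).
have h (t : R) : 2 * (t * r) - t ^+ 2 * knorm2 v <= enorm2 f.
  have := energy_le (fscale t%:C v) bf; rewrite /energy fpair_scale knorm2_scale.
  by rewrite rcJ ReMr rnorm_real real_normK ?num_real.
have := knorm2_ge0 v; rewrite le_eqVlt => /orP[/eqP v0|v0].
  (* If v has norm zero, the bound is linear in t, and this t violates it. *)
  have := h ((enorm2 f + 1) / r).
  rewrite -v0 mulr0 subr0 divfK ?gt_eqF// => h'.
  by exfalso; have := enorm2_ge0 bf; lra.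
rewrite -sqrtrM ?enorm2_ge0//.
have {1}-> : r = Num.sqrt (r ^+ 2) by rewrite sqrtr_sqr ger0_norm// ltW.
rewrite ler_sqrt; last first.
  by rewrite mulr_ge0// ?enorm2_ge0// ltW.
(* The maximiser of the quadratic function of t. *)
have := h (r / knorm2 v); rewrite -ler_pdivrMr//; congr (_ <= _).
by field; rewrite gt_eqF.
Qed.

Lemma rnorm_fpair_le f v : fbounded f ->
  rnorm (fpair f v) <= Num.sqrt (enorm2 f) * Num.sqrt (knorm2 v).
Proof.
move=> bf; have [z0|z0] := eqVneq (fpair f v) 0.
  by rewrite z0 rnorm0 mulr_ge0// sqrtr_ge0.
set z := fpair f v; have nz : 0 < rnorm z by rewrite rnorm_gt0.
(* Scaling v by its pairing z makes the new pairing |z|^2, hence real. *)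
have := Re_fpair_le (fscale z v) bf; rewrite fpair_scale -/z.
rewrite mulrC Re_conjM knorm2_scale sqrtrM ?exprn_ge0 ?rnorm_ge0//.
rewrite sqrtr_sqr ger0_norm ?rnorm_ge0// mulrCA expr2.
by rewrite ler_pM2l.
Qed.

(** From 2 c s - s^2 <= c^2. Functions given by a formula enter the space through this criterion:
    limits, Riesz representatives, the analysis operator, the flip and the map into H(m). *)
Lemma fbounded_crit f (c : R) : 0 <= c ->
  (forall v, rnorm (fpair f v) <= c * Num.sqrt (knorm2 v)) ->
  fbounded f /\ enorm2 f <= c ^+ 2.
Proof.
move=> c0 h; suff b v : energy f v <= c ^+ 2.
  by split; [exists (c ^+ 2)|exact: enorm2_le].
rewrite /energy; have h1 := le_trans (ler_norm _) (le_trans (rnormRe _) (h v)).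
rewrite -[knorm2 v]sqr_sqrtr ?knorm2_ge0//.
move: (Num.sqrt _) h1 (sqr_ge0 (c - Num.sqrt (knorm2 v))) => s; rewrite sqrrB; nra.
Qed.

Lemma energy_shift f c t w :
  energy (f + c *: k t) (w ++ [:: (c, t)]) =
  energy f w + 2 * complex.Re (c^* * f t) + rnorm c ^+ 2 * complex.Re (k t t).
Proof.
have kt : kcomb [:: (1, t)] = k t.
  by apply/funext => s; rewrite /kcomb big_seq1 mul1r.
have -> : [:: (c, t)] = fscale c [:: (1, t)] by rewrite /fscale/= mulr1.
have fp f1 : fpair f1 [:: (1, t)] = f1 t by rewrite /fpair big_seq1 rmorph1 mul1r.
rewrite /energy knorm2_cat knorm2_scale /knorm2 kt !fpair_cat !fpair_scale.
rewrite (fpair_kcombC w [:: (1, t)]) kt !fpairD !fpairZ !fp -rmorphM/= mulrDr mulrA.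
rewrite (mulrC c^* c) -normCK -rnormE -rcX !(ReD, ReJ, ReMr).
ring.
Qed.

Lemma fbounded_k t : fbounded (k t).
Proof.
suff -> : k t = kcomb [:: (1, t)] :> (T -> C).
  exists (knorm2 [:: (1, t)]) => v; rewrite /energy -subr_ge0.
  have := knorm2_ge0 ([:: (1, t)] ++ fscale (-1) v).
  rewrite knorm2_cat knorm2_scale fpair_scale rmorphN1 mulN1r ReN.
  by rewrite rnormN rnorm1 expr1n; move=> h; lra.
by apply/funext => s; rewrite /kcomb big_seq1 mul1r.
Qed.

(** Adding k_t to f and to the test combination changes the energy by an amount independent of the
    combination, so the supremum grows at least by it; subtracting k_t from f + k_t gives the other
    inequality. After polarization this is the reproducing property. *)
Lemma enorm2D_k f t : fbounded f ->
  enorm2 (f + k t) = enorm2 f + 2 * complex.Re (f t) + complex.Re (k t t).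
Proof.
have le g c : fbounded g -> enorm2 g + 2 * complex.Re (c^* * g t) +
    rnorm c ^+ 2 * complex.Re (k t t) <= enorm2 (g + c *: k t).
  move=> bg; rewrite -addrA -lerBrDr; apply: enorm2_le => w.
  rewrite lerBrDr addrA -energy_shift energy_le//.
  exact/fboundedD/fboundedZ/fbounded_k.
move=> bf; apply/eqP; rewrite eq_le; apply/andP; split; last first.
  by have := le _ 1 bf; rewrite rmorph1 mul1r scale1r rnorm1 expr1n mul1r.
have := le _ (-1) (fboundedD bf (fbounded_k t)).
rewrite scaleN1r addrK rnormN rnorm1 expr1n rmorphN1 !mulN1r mul1r ReN.
by rewrite [(f + _) t]/= ReD => h; lra.
Qed.

End PdKernel.

(** * The functions of bounded energy as a complete normed space *)

Section RkhsType.
Variable R : realType.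
Local Notation C := R[i].
Local Notation "x %:C" := (real_complex R x).
Variables (T : Type) (k : pdkernel R T).

Definition fbounded_pred : {pred T -> C} := [pred f | `[< fbounded k f >]].

Fact fbounded_submod : GRing.submod_closed fbounded_pred.
Proof.
split; first exact/asboolP/fbounded0.
move=> a f g /asboolP bf /asboolP bg; apply/asboolP.
exact/fboundedD/bg/fboundedZ.
Qed.
HB.instance Definition _ :=
  GRing.isSubmodClosed.Build C (T -> C) fbounded_pred fbounded_submod.

Record rkhs := Rkhs { rfun :> T -> C; _ : rfun \in fbounded_pred }.
HB.instance Definition _ := [isSub for rfun].
HB.instance Definition _ := [Choice of rkhs by <:].
HB.instance Definition _ := [SubChoice_isSubLmodule of rkhs by <:].

Lemma rkhsP (f : rkhs) : fbounded k f.
Proof. by case: f => f /= /asboolP. Qed.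

Definition to_rkhs (f : T -> C) (bf : fbounded k f) : rkhs :=
  Rkhs (introT (@asboolP (fbounded k f)) bf).

Lemma rkhs_ext (f g : rkhs) : (forall t, f t = g t) -> f = g.
Proof. by move=> h; apply/val_inj/funext. Qed.

Definition rkhs_norm (f : rkhs) : C := (Num.sqrt (enorm2 k f))%:C.

Fact rkhs_normD (f g : rkhs) : rkhs_norm (f + g) <= rkhs_norm f + rkhs_norm g.
Proof.
rewrite /rkhs_norm -rmorphD/= lecR -[leRHS]ger0_norm ?addr_ge0 ?sqrtr_ge0//.
rewrite -sqrtr_sqr ler_sqrt ?exprn_ge0 ?addr_ge0 ?sqrtr_ge0//.
apply: enorm2_le => v; rewrite /energy fpairD ReD.
have h1 := Re_fpair_le v (rkhsP f); have h2 := Re_fpair_le v (rkhsP g).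
rewrite -[knorm2 k v]sqr_sqrtr ?knorm2_ge0//.
move: (Num.sqrt (enorm2 k f)) (Num.sqrt (enorm2 k g)) h1 h2 => a b h1 h2.
have := sqr_ge0 (a + b - Num.sqrt (knorm2 k v)); move: (Num.sqrt _) h1 h2 => s.
by rewrite sqrrB; nra.
Qed.

Fact rkhs_normZ (a : C) (f : rkhs) : rkhs_norm (a *: f) = `|a| * rkhs_norm f.
Proof.
rewrite /rkhs_norm /= enorm2Z; last exact: rkhsP.
rewrite sqrtrM ?exprn_ge0 ?rnorm_ge0// sqrtr_sqr ger0_norm ?rnorm_ge0//.
by rewrite rcM rnormE.
Qed.

Lemma enorm2_eq0 (f : rkhs) : enorm2 k f = 0 -> f = 0.
Proof.
move=> f0; apply: rkhs_ext => t; apply: rnorm0_eq0; apply/eqP.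
rewrite eq_le rnorm_ge0 andbT.
have := rnorm_fpair_le [:: (1, t)] (rkhsP f).
by rewrite f0 sqrtr0 mul0r /fpair big_seq1 rmorph1 mul1r.
Qed.

Fact rkhs_norm0_eq0 (f : rkhs) : rkhs_norm f = 0 -> f = 0.
Proof.
move=> /complexI/eqP; rewrite sqrtr_eq0 => h; apply: enorm2_eq0.
by apply/eqP; rewrite eq_le h enorm2_ge0//; exact: rkhsP.
Qed.

HB.instance Definition _ := Lmodule_isNormed.Build C rkhs
  rkhs_normD rkhs_normZ rkhs_norm0_eq0.

Lemma rkhs_rnormE (f : rkhs) : rnorm f = Num.sqrt (enorm2 k f).
Proof. by []. Qed.

Lemma rkhs_rnorm2 (f : rkhs) : rnorm f ^+ 2 = enorm2 k f.
Proof. by rewrite rkhs_rnormE sqr_sqrtr// enorm2_ge0//; exact: rkhsP. Qed.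

Lemma rkhs_fpair_le (f : rkhs) v :
  rnorm (fpair f v) <= rnorm f * Num.sqrt (knorm2 k v).
Proof. exact/rnorm_fpair_le/rkhsP. Qed.

Lemma rkhs_eval_le (f : rkhs) t :
  rnorm (f t) <= rnorm f * Num.sqrt (knorm2 k [:: (1, t)]).
Proof.
by have := rkhs_fpair_le f [:: (1, t)]; rewrite /fpair big_seq1 rmorph1 mul1r.
Qed.

Section Completeness.
Variable F : set_system rkhs.
Hypotheses (FF : ProperFilter F) (Fc : cauchy F).

Lemma rkhs_cauchyP (e : R) : 0 < e ->
  exists A, F A /\ forall f g, A f -> A g -> rnorm (f - g) < e.
Proof.
move=> e0; have e0' : 0 < e%:C :> C by rewrite ltcR.
have /cauchy_ballP/(_ _ e0') := Fc.
rewrite near_simpl => -[[A B] /= [FA FB] AB].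
exists (A `&` B); split; first exact: filterI.
move=> f g [Af _] [_ Bg]; have := AB (f, g) (conj Af Bg).
by rewrite /= -ball_normE/= -rnormE ltcR.
Qed.

Lemma real_filter_lim (phi : rkhs -> R) (c : R) :
  (forall f g, `|phi f - phi g| <= rnorm (f - g) * c) ->
  exists l : R, forall e, 0 < e -> F [set f | `|phi f - l| < e].
Proof.
move=> h.
have : cvg (phi @ F).
  apply/cauchy_cvgP/cauchy_ballP => e e0; rewrite near_simpl.
  have c1 : 0 < `|c| + 1 by apply: ltr_wpDl.
  have [A [FA hA]] := rkhs_cauchyP (divr_gt0 e0 c1).
  exists (A, A) => // -[f g] /= [Af Ag]; rewrite -ball_normE/=.
  apply: le_lt_trans (h _ _) _.
  have h1 := hA _ _ Af Ag.
  have : rnorm (f - g) * (`|c| + 1) < e by rewrite -ltr_pdivlMr.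
  have := ler_norm c; have := rnorm_ge0 (f - g); nra.
move=> /cvg_ex[l /cvgrPdist_lt hl]; exists l => e e0.
by apply: filterS (hl e e0) => f /=; rewrite distrC.
Qed.

Lemma rkhs_eval_lim t : exists l : C, forall e, 0 < e ->
  F [set f : rkhs | rnorm (f t - l) < e].
Proof.
have fgt (f g : rkhs) : f t - g t = (f - g) t by [].
have [f g|a ha] := @real_filter_lim (fun f => complex.Re (f t))
    (Num.sqrt (knorm2 k [:: (1, t)])).
  rewrite -ReN -ReD fgt.
  by apply: le_trans (rnormRe _) (rkhs_eval_le _ _).
have [f g|b hb] := @real_filter_lim (fun f => complex.Im (f t))
    (Num.sqrt (knorm2 k [:: (1, t)])).
  rewrite (_ : complex.Im (f t) - complex.Im (g t) = complex.Im (f t - g t)).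
    by rewrite fgt; exact: le_trans (rnormIm _) (rkhs_eval_le _ _).
  by case: (f t); case: (g t).
exists (Complex a b) => e e0.
have e2 : 0 < e / 2 by rewrite divr_gt0.
apply: filterS (filterI (ha _ e2) (hb _ e2)) => f [/= h1 h2].
apply: le_lt_trans (rnorm_leReIm _) _.
by move: h1 h2; case: (f t) => x y /= h1 h2; rewrite [ltRHS]splitr ltrD.
Qed.

(** A Cauchy filter converges pointwise, hence against every finite combination, and [fbounded_crit]
    turns bounds on these pairings into a norm bound on the difference with the limit. *)
Lemma rkhs_complete : cvg F.
Proof.
pose f0 t := sval (cid (rkhs_eval_lim t)).
have f0P t e : 0 < e -> F [set f : rkhs | rnorm (f t - f0 t) < e].
  exact: (svalP (cid (rkhs_eval_lim t))).
have f0v v e : 0 < e -> F [set f : rkhs | rnorm (fpair f v - fpair f0 v) < e].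
  elim: v e => [|x v IH] e e0.
    by apply: filterS filterT => f _ /=; rewrite /fpair !big_nil subrr rnorm0.
  have e2 : 0 < e / 2 by rewrite divr_gt0.
  have x0 : 0 < rnorm x.1 + 1 by rewrite ltr_wpDl ?rnorm_ge0.
  apply: filterS (filterI (f0P x.2 _ (divr_gt0 e2 x0)) (IH _ e2)) => f [/= h1 h2].
  rewrite /fpair !big_cons -!/(fpair _ _).
  rewrite opprD addrACA -mulrBr; apply: le_lt_trans (rnormD _ _) _.
  rewrite [ltRHS]splitr ltr_leD// ?(ltW h2)// rnormM rnormJ.
  have : rnorm (f x.2 - f0 x.2) * (rnorm x.1 + 1) < e / 2 by rewrite -ltr_pdivlMr.
  have := rnorm_ge0 (f x.2 - f0 x.2); have := rnorm_ge0 x.1; nra.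
have key e : 0 < e -> exists A, F A /\ forall f : rkhs, A f ->
    fbounded k ((f : T -> C) - f0) /\ enorm2 k ((f : T -> C) - f0) <= e ^+ 2.
  move=> e0; have [A [FA hA]] := rkhs_cauchyP e0.
  exists A; split=> // f Af; apply: fbounded_crit; first exact: ltW.
  move=> v; apply/ler_addgt0Pl => d d0.
  (* The comparison function g may depend on v, because the bound on f - g over A does not. *)
  have /filter_ex[g [Ag hg]] :
      F (A `&` [set f : rkhs | rnorm (fpair f v - fpair f0 v) < d]).
    by apply: filterI => //; exact: f0v.
  rewrite fpairD fpairN; apply: le_trans (rdistD (fpair g v) _ _) _.
  rewrite addrC lerD//; first exact: ltW.
  rewrite -fpairN -fpairD; apply: le_trans (rkhs_fpair_le (f - g) v) _.
  by rewrite ler_wpM2r ?sqrtr_ge0// ltW// hA.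
have bf0 : fbounded k f0.
  have [A [FA hA]] := key _ ltr01; have /filter_ex[f Af] := FA.
  rewrite (_ : f0 = (f : T -> C) + (-1) *: ((f : T -> C) - f0)).
    apply: fboundedD (rkhsP f) _; apply: fboundedZ; exact: (hA _ Af).1.
  by apply/funext => t; rewrite scaleN1r opprB addrC subrK.
apply/cvg_ex; exists (to_rkhs bf0); apply/cvg_ballP => e e0.
have e0' : 0 < complex.Re e by move: e0; rewrite ltcE => /andP[].
have e2 : 0 < complex.Re e / 2 by rewrite divr_gt0.
have [A [FA hA]] := key _ e2; rewrite near_simpl.
apply: filterS FA => f Af; rewrite -ball_normE/= -rnormE.
rewrite -[e]RRe_real ?gtr0_real// ltcR rdistC rkhs_rnormE.
have [bh h] := hA _ Af.
suff h2 : Num.sqrt (enorm2 k ((f : T -> C) - f0)) <= complex.Re e / 2.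
  by apply: le_lt_trans h2 _; rewrite ltr_pdivrMr//; lra.
rewrite -(@ler_pXn2r _ 2)// ?nnegrE ?sqrtr_ge0 ?(ltW e2)// sqr_sqrtr//.
exact: enorm2_ge0 bh.
Qed.

End Completeness.

HB.instance Definition _ := Uniform_isComplete.Build rkhs rkhs_complete.

End RkhsType.

(** For every n, n |f t| equals |f| at the fractional part of n t, hence is at most c; so f t = 0.
    This is how additivity together with a bound forces real homogeneity of the polarization
    below. *)
Lemma additive_Lipschitz0 (R : realType) (f : R -> R) (c : R) :
  (forall s t, f (s + t) = f s + f t) -> f 1 = 0 ->
  (forall t, `|f t| <= c * `|t|) -> forall t, f t = 0.
Proof.
move=> fD f1 fc t.
have f0 : f 0 = 0 by apply: (addrI (f 0)); rewrite -fD !addr0.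
have fN s : f (- s) = - f s by apply: (addrI (f s)); rewrite -fD !subrr.
have fn n s : f (n%:R * s) = n%:R * f s.
  elim: n => [|n IH]; first by rewrite !mul0r.
  by rewrite -natr1 !mulrDl fD IH !mul1r.
have fz (m : int) : f m%:~R = 0.
  case: m => n; first by rewrite -pmulrn -[n%:R]mulr1 fn f1 mulr0.
  by rewrite NegzE mulrNz fN -pmulrn -[n.+1%:R]mulr1 fn f1 mulr0 oppr0.
have c0 : 0 <= c by have := le_trans (normr_ge0 _) (fc 1); rewrite normr1 mulr1.
have key n : n%:R * `|f t| <= c.
  have -> : n%:R * `|f t| = `|f (n%:R * t - (Num.floor (n%:R * t))%:~R)|.
    by rewrite fD fN fz subr0 fn normrM ger0_norm.
  apply: le_trans (fc _) _; rewrite ler_piMr// ger0_norm ?subr_ge0 ?floor_le_tmp//.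
  by rewrite lerBlDr addrC -intrD1 ltW// floorD1_gt.
apply/normr0_eq0/eqP; rewrite eq_le normr_ge0 andbT leNgt; apply/negP => p.
have := key (Num.truncn (c / `|f t|)).+1; apply/negP; rewrite -ltNge -ltr_pdivrMr//.
exact: truncnS_gt.
Qed.

(** * The inner product of a norm satisfying the parallelogram law *)

Section JordanVonNeumann.
Variable R : realType.
Local Notation C := R[i].
Local Notation "x %:C" := (real_complex R x).
Variable V : normedModType C.
Local Notation N x := (rnorm x ^+ 2).
Hypothesis par : forall x y : V, N (x + y) + N (x - y) = 2 * N x + 2 * N y.

Definition polar (x y : V) : R := (N (x + y) - N x - N y) / 2.

Lemma polarC x y : polar x y = polar y x.
Proof. by rewrite /polar (addrC x); lra. Qed.

Lemma polarxx x : polar x x = N x.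
Proof.
rewrite /polar; have := par x x; rewrite subrr rnorm0; lra.
Qed.

Lemma polarD x y z : polar (x + y) z = polar x z + polar y z.
Proof.
have h1 := par (x + z) y; have h2 := par x (z - y).
have h3 := par (x + y) z; have h4 := par z y.
rewrite addrA in h2.
have E1 : x + z + y = x + y + z by rewrite addrAC.
have E2 : x - (z - y) = x + y - z by rewrite opprB addrA.
rewrite E1 in h1; rewrite E2 in h2; rewrite [z + y]addrC in h4.
rewrite /polar; lra.
Qed.

Lemma polar0 z : polar 0 z = 0.
Proof. by rewrite /polar add0r rnorm0; lra. Qed.

Lemma polarN x z : polar (- x) z = - polar x z.
Proof. by apply: (addrI (polar x z)); rewrite -polarD !subrr polar0. Qed.

Lemma polar_le x y : `|polar x y| <= rnorm x * rnorm y.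
Proof.
have le a b : polar a b <= rnorm a * rnorm b.
  rewrite /polar; have := rnormD a b; have := rnorm_ge0 (a + b).
  by have := rnorm_ge0 a; have := rnorm_ge0 b; nra.
by rewrite ler_norml le andbT lerNl -polarN (le_trans (le _ _))// rnormN.
Qed.

Lemma polarZ (t : R) x y : polar (t%:C *: x) y = t * polar x y.
Proof.
apply/subr0_eq.
pose f s := polar (s%:C *: x) y - s * polar x y.
apply: (@additive_Lipschitz0 _ f (rnorm x * rnorm y *+ 2)) => [a b||s].
- by rewrite /f rcD scalerDl polarD; lra.
- by rewrite /f scale1r mul1r subrr.
- apply: le_trans (ler_normB _ _) _; rewrite mulr2n mulrDl; apply: lerD.
    apply: le_trans (polar_le _ _) _.
    by rewrite rnormZ rnorm_real -mulrA mulrC.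
  by rewrite normrM mulrC ler_wpM2r// polar_le.
Qed.

Lemma polar_iso x y : polar ('i%C *: x) ('i%C *: y) = polar x y.
Proof. by rewrite /polar -scalerDr !rnormZ rnorm_i !mul1r. Qed.

Lemma polar_i x y : polar x ('i%C *: y) = - polar ('i%C *: x) y.
Proof.
rewrite -[LHS]polar_iso scalerA (_ : 'i%C * 'i%C = -1); last exact: sqr_i.
by rewrite scaleN1r polarC polarN polarC.
Qed.

(** The imaginary part uses Im (x, y) = Re (x, i y), valid for a form antilinear in y. *)
Definition jvn (x y : V) : C := Complex (polar x y) (polar x ('i%C *: y)).

Lemma jvnC x y : jvn x y = (jvn y x)^*.
Proof.
rewrite /jvn (_ : (Complex _ _)^* =
  Complex (polar y x) (- polar y ('i%C *: x)))//.
by rewrite [polar y (_ *: _)]polar_i opprK (polarC y) (polarC (_ *: y)).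
Qed.

Lemma jvnD x y z : jvn (x + y) z = jvn x z + jvn y z.
Proof. by rewrite /jvn !polarD. Qed.

Lemma jvnZ a x z : jvn (a *: x) z = a * jvn x z.
Proof.
case: a => a b; have -> : Complex a b = a%:C + b%:C * 'i%C.
  by apply/eqP; rewrite eq_complex/= !(mul0r, mulr0, mulr1, subr0, addr0, add0r) !eqxx.
rewrite scalerDl jvnD -scalerA /jvn !polarZ [in RHS]polar_i.
have -> : polar ('i%C *: x) ('i%C *: z) = polar x z by exact: polar_iso.
rewrite polar_i.
by apply/eqP; rewrite eq_complex/= !(mul0r, mulr0, mulr1, subr0, addr0, add0r);
  apply/andP; split; apply/eqP; ring.
Qed.

Lemma jvn_xx x : jvn x x = (N x)%:C.
Proof.
rewrite /jvn polarxx; congr Complex.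
by have := polar_i x x; rewrite [in RHS]polarC; lra.
Qed.

Fact jvn_bilinear : bilinear_for *%R (conjC \; *%R) jvn.
Proof.
split=> u a x y /=; first by rewrite jvnD jvnZ.
rewrite !(jvnC u) jvnD jvnZ; set p := jvn x u; set q := jvn y u.
by rewrite rmorphD rmorphM.
Qed.

HB.instance Definition _ := bilinear_isBilinear.Build C V V C *%R (conjC \; *%R)
  jvn jvn_bilinear.

Fact jvn_herm x y : jvn x y = (-1) ^+ false * (jvn y x)^*.
Proof. by rewrite expr0 mul1r jvnC. Qed.

HB.instance Definition _ := isHermitianSesquilinear.Build C V false conjC
  jvn jvn_herm.

Fact jvn_dot x : x != 0 -> 0 < jvn x x.
Proof. by move=> x0; rewrite jvn_xx ltcR exprn_gt0// rnorm_gt0. Qed.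

HB.instance Definition _ := isDotProduct.Build C V jvn jvn_dot.

Definition jvn_ip : {dot V for conjC} := jvn.

End JordanVonNeumann.

Definition to_linear (K : pzRingType) (U V : lmodType K) (f : U -> V)
    (lf : linear f) : {linear U -> V} :=
  HB.pack f (GRing.isLinear.Build K U V *:%R f lf).

(** * Reproducing property, density of kernel combinations, Riesz representation *)

Section RkhsHilbert.
Variable R : realType.
Local Notation C := R[i].
Variables (T : Type) (k : pdkernel R T).

Fact rkhs_parallelogram (f g : rkhs k) :
  rnorm (f + g) ^+ 2 + rnorm (f - g) ^+ 2 = 2 * rnorm f ^+ 2 + 2 * rnorm g ^+ 2.
Proof. by rewrite !rkhs_rnorm2 enorm2_parallelogram//; exact: rkhsP. Qed.

Definition rkhs_ip : {dot rkhs k for conjC} := jvn_ip rkhs_parallelogram.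

Lemma rkhs_ipn (f : rkhs k) : `|f| ^+ 2 = rkhs_ip f f.
Proof. by rewrite [RHS]jvn_xx ?rcX ?rnormE//; exact: rkhs_parallelogram. Qed.

Definition kvec t : rkhs k := to_rkhs (fbounded_k k t).

Lemma kvecE s t : kvec s t = k s t.
Proof. by []. Qed.

Lemma Re_rkhs_ip_kvec f t : complex.Re (rkhs_ip f (kvec t)) = complex.Re (f t).
Proof.
have h1 := rnorm_sqrD rkhs_ipn f (kvec t).
have h2 := enorm2D_k t (rkhsP f).
have h3 : enorm2 k (k t) = complex.Re (k t t).
  have := enorm2D_k t (fbounded0 k); rewrite add0r enorm2_0 add0r.
  by rewrite mulr0 add0r.
have h4 : rnorm (f + kvec t) ^+ 2 = enorm2 k ((f : T -> C) + k t).
  exact: rkhs_rnorm2.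
have h5 : rnorm (kvec t) ^+ 2 = enorm2 k (k t) by exact: rkhs_rnorm2.
have h6 : rnorm f ^+ 2 = enorm2 k f by exact: rkhs_rnorm2.
by rewrite mulr2n in h1; lra.
Qed.

Lemma rkhs_ip_kvec f t : rkhs_ip f (kvec t) = f t.
Proof.
have h1 := Re_rkhs_ip_kvec f t; have h2 := Re_rkhs_ip_kvec ('i%C *: f) t.
rewrite ipZl mulrC ReiNIm (_ : ('i%C *: f) t = f t * 'i%C) in h2; last first.
  by rewrite mulrC.
apply/eqP; rewrite eq_complex h1 eqxx/=; apply/eqP.
by rewrite ReiNIm in h2; exact: oppr_inj.
Qed.

Lemma knorm2_kvec v : knorm2 k v = rnorm (\sum_(x <- v) x.1 *: kvec x.2) ^+ 2.
Proof.
rewrite -(Re_ipxx rkhs_ipn) ip_sumr /knorm2 /fpair; congr complex.Re.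
apply: eq_bigr => x _; rewrite ipZr rkhs_ip_kvec; congr (_ * _).
rewrite -rkhs_ip_kvec ip_suml; apply: eq_bigr => y _.
by rewrite ipZl rkhs_ip_kvec.
Qed.

Lemma fpair_kvec (f : rkhs k) v :
  fpair f v = rkhs_ip f (\sum_(x <- v) x.1 *: kvec x.2).
Proof.
by rewrite ip_sumr; apply: eq_bigr => x _; rewrite ipZr rkhs_ip_kvec.
Qed.

(** The squared distance from f to the combination v is [enorm2] of f minus the energy of f at v, so
    near-maximisers of the energy are near f. *)
Lemma kvec_dense (f : rkhs k) (e : R) : 0 < e ->
  exists v, rnorm (f - \sum_(x <- v) x.1 *: kvec x.2) < e.
Proof.
move=> e0; have e2 : 0 < e ^+ 2 by rewrite exprn_gt0.
have := @sup_adherent R (range (energy k f)) _ e2.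
case.
  split; first by exists (energy k f [::]); exists [::].
  by exists (enorm2 k f) => _ [v _ <-]; apply: energy_le; exact: rkhsP.
move=> _ [v _ <-]; rewrite -/(enorm2 k f) => h; exists v.
rewrite -(@ltr_pXn2r _ 2)// ?nnegrE ?rnorm_ge0 ?(ltW e0)//.
rewrite (rnorm_sqrB rkhs_ipn) -fpair_kvec -knorm2_kvec rkhs_rnorm2 mulr2n.
by move: h; rewrite /energy; lra.
Qed.

Lemma rkhs_functional_ext (phi psi : rkhs k -> C) (M : R) :
  (forall f g, phi (f - g) = phi f - phi g) ->
  (forall f g, psi (f - g) = psi f - psi g) ->
  (forall f, rnorm (phi f) <= M * rnorm f) ->
  (forall f, rnorm (psi f) <= M * rnorm f) ->
  (forall v, phi (\sum_(x <- v) x.1 *: kvec x.2) =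
             psi (\sum_(x <- v) x.1 *: kvec x.2)) ->
  forall f, phi f = psi f.
Proof.
move=> phiB psiB phiM psiM h f; apply/subr0_eq/rnorm0_eq0/eqP.
rewrite eq_le rnorm_ge0 andbT; apply/ler_addgt0Pl => e e0; rewrite addr0.
have M1 : 0 < 2 * (`|M| + 1) by rewrite mulr_gt0// ltr_wpDl.
have [v hv] := kvec_dense f (divr_gt0 e0 M1).
set g := \sum_(x <- v) _ in hv.
have -> : phi f - psi f = phi (f - g) - psi (f - g).
  by rewrite phiB psiB [phi g]h opprB addrA subrK.
apply: le_trans (rnormB _ _) _; apply: le_trans (lerD (phiM _) (psiM _)) _.
have : rnorm (f - g) * (2 * (`|M| + 1)) < e by rewrite -ltr_pdivlMr.
have := ler_norm M; have := rnorm_ge0 (f - g); nra.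
Qed.

(** The representative is the function t |-> conj (phi k_t): boundedness of phi is what
    [fbounded_crit] asks for, and the two functionals agree on the dense kernel combinations. *)
Lemma rkhs_riesz (phi : rkhs k -> C) (M : R) : 0 <= M ->
  (forall a f g, phi (a *: f + g) = a * phi f + phi g) ->
  (forall f, rnorm (phi f) <= M * rnorm f) ->
  exists g, forall f, phi f = rkhs_ip f g.
Proof.
move=> M0 phil phiM.
have phi0 : phi 0 = 0.
  have := phil (-1) 0 0; rewrite scaleN1r oppr0 addr0 mulN1r addNr.
  by [].
have phis v : phi (\sum_(x <- v) x.1 *: kvec x.2) =
    \sum_(x <- v) x.1 * phi (kvec x.2).
  by elim: v => [|x v IH]; rewrite ?big_nil// !big_cons phil IH.
have [|bg _] := @fbounded_crit R T k (fun t => (phi (kvec t))^*) M M0.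
  move=> v; rewrite knorm2_kvec sqrtr_sqr ger0_norm ?rnorm_ge0//.
  rewrite -rnormJ (_ : (fpair _ _)^* = phi (\sum_(x <- v) x.1 *: kvec x.2))//.
  rewrite phis /fpair rmorph_sum/=; apply: eq_bigr => x _.
  by rewrite rmorphM/= !conjCK.
exists (to_rkhs bg).
apply: (@rkhs_functional_ext _ _ (M + rnorm (to_rkhs bg))).
- by move=> f g; rewrite -scaleN1r addrC phil mulN1r addrC.
- by move=> f g; rewrite ipBl.
- move=> f; apply: le_trans (phiM f) _; rewrite ler_wpM2r ?rnorm_ge0//.
  by rewrite lerDl rnorm_ge0.
- move=> f; apply: le_trans (cauchy_schwarz rkhs_ipn _ _) _.
  by rewrite mulrC ler_wpM2r ?rnorm_ge0// lerDr.
- move=> v; rewrite phis ipC -fpair_kvec rmorph_sum/=; apply: eq_bigr => x _.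
  by rewrite rmorphM/= !conjCK.
Qed.

End RkhsHilbert.
Arguments rkhs_ip {R T k}.
Arguments rkhs_ipn {R T k}.

(** * Orthogonal projection onto the closed span of a family *)

Section Projection.
Variable R : realType.
Local Notation C := R[i].
Variables (H : normedModType C) (ip : {dot H for conjC}).
Hypothesis ipn : forall x : H, `|x| ^+ 2 = ip x x.

(** Stands in for completeness: it is what the construction of the projection asks of the space, and
    reproducing kernel spaces have it. *)
Definition riesz_property := forall (phi : H -> C) (M : R), 0 <= M ->
  (forall a f g, phi (a *: f + g) = a * phi f + phi g) ->
  (forall f, rnorm (phi f) <= M * rnorm f) ->
  exists g, forall f, phi f = ip f g.

Section Family.
Variables (T : Type) (xi : T -> H).

Fact gramC s t : ip (xi s) (xi t) = (ip (xi t) (xi s))^*.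
Proof. exact: ipC. Qed.

Fact gram_ge0 (v : seq (C * T)) :
  0 <= \sum_(x <- v) \sum_(y <- v) x.1 * y.1^* * ip (xi x.2) (xi y.2).
Proof.
suff -> : \sum_(x <- v) \sum_(y <- v) x.1 * y.1^* * ip (xi x.2) (xi y.2) =
    ip (\sum_(x <- v) x.1 *: xi x.2) (\sum_(x <- v) x.1 *: xi x.2).
  exact: ip_ge0.
rewrite ip_suml; apply: eq_bigr => x _; rewrite ip_sumr; apply: eq_bigr => y _.
by rewrite ipZl ipZr mulrA.
Qed.

Definition gram : pdkernel R T := PdKernel gramC gram_ge0.

Lemma knorm2_gram v : knorm2 gram v = rnorm (\sum_(x <- v) x.1 *: xi x.2) ^+ 2.
Proof.
rewrite -(Re_ipxx ipn) ip_sumr /knorm2 /fpair; congr complex.Re.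
apply: eq_bigr => x _; rewrite ipZr; congr (_ * _).
by rewrite ip_suml; apply: eq_bigr => y _; rewrite ipZl.
Qed.

Fact analysis_crit f v : rnorm (fpair (fun t => ip f (xi t)) v) <=
  rnorm f * Num.sqrt (knorm2 gram v).
Proof.
rewrite knorm2_gram sqrtr_sqr ger0_norm ?rnorm_ge0//.
rewrite (_ : fpair _ _ = ip f (\sum_(x <- v) x.1 *: xi x.2)).
  exact: cauchy_schwarz.
by rewrite ip_sumr; apply: eq_bigr => x _; rewrite ipZr.
Qed.

Definition analysis f : rkhs gram :=
  to_rkhs (fbounded_crit (rnorm_ge0 f) (analysis_crit f)).1.

Lemma analysisE f t : analysis f t = ip f (xi t). Proof. by []. Qed.

Lemma analysis_le f : rnorm (analysis f) <= rnorm f.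
Proof.
rewrite -(@ler_pXn2r _ 2)// ?nnegrE ?rnorm_ge0// rkhs_rnorm2.
exact: (fbounded_crit (rnorm_ge0 f) (analysis_crit f)).2.
Qed.

Lemma analysis_xi t : analysis (xi t) = kvec gram t.
Proof. exact: rkhs_ext. Qed.

Lemma analysisP a f g : analysis (a *: f + g) = a *: analysis f + analysis g.
Proof. by apply: rkhs_ext => t; rewrite analysisE ipDl ipZl. Qed.

(** P is the analysis operator followed by its adjoint; it fixes each xi t by the reproducing
    property in the space of the Gram kernel. *)
Lemma family_projection : riesz_property -> exists P : {linear H -> H},
  [/\ forall t, P (xi t) = xi t, forall f g, ip (P f) g = ip f (P g),
      forall f, P (P f) = P f & forall f, (forall t, ip f (xi t) = 0) -> P f = 0].
Proof.
move=> riesz.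
have /choice[P hP] f : exists Pf, forall g,
    rkhs_ip (analysis g) (analysis f) = ip g Pf.
  apply: (riesz _ (rnorm (analysis f))); first exact: rnorm_ge0.
    by move=> a g h; rewrite analysisP ipDl ipZl.
  move=> g; apply: le_trans (cauchy_schwarz rkhs_ipn _ _) _.
  by rewrite mulrC ler_wpM2l ?rnorm_ge0// analysis_le.
have Pl : linear P.
  move=> a f g; apply: (ip_extr (ip := ip)) => h.
  by rewrite -hP analysisP ipDr ipZr !hP -ipZr -ipDr.
have Psa f g : ip (P f) g = ip f (P g) by rewrite ipC -(hP f) -(ipC rkhs_ip) (hP g).
have Pxi t : P (xi t) = xi t.
  apply: (ip_extr (ip := ip)) => h.
  by rewrite -hP analysis_xi rkhs_ip_kvec analysisE.
exists (to_linear Pl); split=> //=.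
- move=> f; apply: (ip_extr (ip := ip)) => h; rewrite -!hP; congr (rkhs_ip _ _).
  by apply: rkhs_ext => t; rewrite !analysisE Psa Pxi.
- move=> f f0; apply: (ip_extr (ip := ip)) => h; rewrite -hP ip0r.
  by rewrite (_ : analysis f = 0) ?ip0r//; apply: rkhs_ext => t; rewrite analysisE.
Qed.

End Family.
End Projection.

(** * The inner product of C^d and adjoint matrices *)

Section Cdot.
Variable R : realType.
Local Notation C := R[i].
Local Open Scope sesquilinear_scope.

Lemma cdotDl d (u v w : 'cV[C]_d) : cdot (u + v) w = cdot u w + cdot v w.
Proof. by rewrite -big_split; apply: eq_bigr => i _; rewrite mxE mulrDl. Qed.
Lemma cdotDr d (u v w : 'cV[C]_d) : cdot u (v + w) = cdot u v + cdot u w.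
Proof. by rewrite -big_split; apply: eq_bigr => i _; rewrite mxE rmorphD mulrDr. Qed.
Lemma cdotZl d a (u v : 'cV[C]_d) : cdot (a *: u) v = a * cdot u v.
Proof. by rewrite mulr_sumr; apply: eq_bigr => i _; rewrite mxE mulrA. Qed.
Lemma cdotZr d a (u v : 'cV[C]_d) : cdot u (a *: v) = a^* * cdot u v.
Proof. by rewrite mulr_sumr; apply: eq_bigr => i _; rewrite mxE rmorphM mulrCA. Qed.
Lemma cdotNl d (u v : 'cV[C]_d) : cdot (- u) v = - cdot u v.
Proof. by rewrite -scaleN1r cdotZl mulN1r. Qed.
Lemma cdotNr d (u v : 'cV[C]_d) : cdot u (- v) = - cdot u v.
Proof. by rewrite -scaleN1r cdotZr rmorphN1 mulN1r. Qed.
Lemma cdotBl d (u v w : 'cV[C]_d) : cdot (u - v) w = cdot u w - cdot v w.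
Proof. by rewrite cdotDl cdotNl. Qed.
Lemma cdotBr d (u v w : 'cV[C]_d) : cdot u (v - w) = cdot u v - cdot u w.
Proof. by rewrite cdotDr cdotNr. Qed.
Lemma cdot0l d (u : 'cV[C]_d) : cdot 0 u = 0.
Proof. by rewrite -(scale0r 0) cdotZl mul0r. Qed.
Lemma cdot0r d (u : 'cV[C]_d) : cdot u 0 = 0.
Proof. by rewrite -(scale0r 0) cdotZr rmorph0 mul0r. Qed.
Lemma cdotC d (u v : 'cV[C]_d) : cdot u v = (cdot v u)^*.
Proof.
by rewrite rmorph_sum; apply: eq_bigr => i _; rewrite rmorphM/= conjCK mulrC.
Qed.
Lemma cdot_suml d I (r : seq I) (F : I -> 'cV[C]_d) u :
  cdot (\sum_(i <- r) F i) u = \sum_(i <- r) cdot (F i) u.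
Proof. by apply: (big_morph (fun x => cdot x u)) => [a b|]; rewrite ?cdotDl ?cdot0l. Qed.
Lemma cdot_sumr d I (r : seq I) (F : I -> 'cV[C]_d) u :
  cdot u (\sum_(i <- r) F i) = \sum_(i <- r) cdot u (F i).
Proof. by apply: (big_morph (cdot u)) => [a b|]; rewrite ?cdotDr ?cdot0r. Qed.

Lemma cdot_ge0 d (u : 'cV[C]_d) : 0 <= cdot u u.
Proof. by apply: sumr_ge0 => i _; exact: mul_conjC_ge0. Qed.

Lemma cdot_eq0 d (u : 'cV[C]_d) : cdot u u = 0 -> u = 0.
Proof.
move=> /eqP; rewrite psumr_eq0 => [/allP h|i _]; last exact: mul_conjC_ge0.
apply/colP => i; rewrite mxE; apply/eqP; rewrite -mul_conjC_eq0.
by apply: h; rewrite mem_index_enum.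
Qed.

Lemma cdot_le0 d (u : 'cV[C]_d) : cdot u u <= 0 -> u = 0.
Proof. by move=> h; apply/cdot_eq0/eqP; rewrite eq_le h cdot_ge0. Qed.

Lemma cdot_extl d (u v : 'cV[C]_d) : (forall w, cdot u w = cdot v w) -> u = v.
Proof. by move=> h; apply/subr0_eq/cdot_eq0; rewrite cdotBl h subrr. Qed.

Lemma cdot_adjmx d e (A : 'M[C]_(e, d)) (u : 'cV[C]_d) (v : 'cV[C]_e) :
  cdot (A *m u) v = cdot u (A ^t* *m v).
Proof.
rewrite /cdot; under eq_bigr do rewrite mxE mulr_suml.
rewrite exchange_big; apply: eq_bigr => j _; rewrite mxE rmorph_sum mulr_sumr.
apply: eq_bigr => i _; rewrite !mxE rmorphM/= conjCK.
by rewrite mulrAC mulrC (mulrC (A i j)).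
Qed.

Lemma adjmxK m n (A : 'M[C]_(m, n)) : (A ^t*) ^t* = A.
Proof. by apply/matrixP => i j; rewrite !mxE conjCK. Qed.

Lemma adjmxM m n p (A : 'M[C]_(m, n)) (B : 'M[C]_(n, p)) :
  (A *m B) ^t* = B ^t* *m A ^t*.
Proof. by rewrite trmx_mul map_mxM. Qed.

Lemma adjmxD m n (A B : 'M[C]_(m, n)) : (A + B) ^t* = A ^t* + B ^t*.
Proof. by apply/matrixP => i j; rewrite !mxE rmorphD. Qed.

Lemma adjmxN m n (A : 'M[C]_(m, n)) : (- A) ^t* = - A ^t*.
Proof. by apply/matrixP => i j; rewrite !mxE rmorphN. Qed.

Lemma adjmxZ m n a (A : 'M[C]_(m, n)) : (a *: A) ^t* = a^* *: A ^t*.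
Proof. by apply/matrixP => i j; rewrite !mxE rmorphM. Qed.

Lemma adjmx1 n : (1%:M : 'M[C]_n) ^t* = 1%:M.
Proof. by rewrite trmx1 map_mx1. Qed.

Lemma adjmx_inv n (A : 'M[C]_n) : (invmx A) ^t* = invmx (A ^t*).
Proof. by rewrite trmx_inv map_invmx. Qed.

Lemma adjmx_unit n (A : 'M[C]_n) : (A ^t* \in unitmx) = (A \in unitmx).
Proof. by rewrite map_unitmx unitmx_tr. Qed.

Lemma mx_cdot_ext m n (A B : 'M[C]_(m, n)) :
  (forall u v, cdot (A *m u) v = cdot (B *m u) v) -> A = B.
Proof.
move=> h; apply/matrixP => i j.
have /cdot_extl/colP/(_ i) : forall v, cdot (A *m delta_mx j 0) v = cdot (B *m delta_mx j 0) v.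
  by move=> v; exact: h.
by rewrite -!colE !mxE.
Qed.

Lemma unitmx_ker n (A : 'M[C]_n) : (forall u : 'cV_n, A *m u = 0 -> u = 0) ->
  A \in unitmx.
Proof.
move=> h; rewrite -unitmx_tr -row_free_unit; apply/inj_row_free => v vA.
by apply: (can_inj (@trmxK _ _ _)); rewrite trmx0; apply: h;
   apply: (can_inj (@trmxK _ _ _)); rewrite trmx_mul trmxK vA trmx0.
Qed.

Lemma unitmx_adj_ker n (A : 'M[C]_n) : (forall u : 'cV_n, A ^t* *m u = 0 -> u = 0) ->
  A \in unitmx.
Proof. by move=> h; rewrite -adjmx_unit; exact: unitmx_ker. Qed.

Lemma unitmxMr n (A B : 'M[C]_n) : A *m B \in unitmx -> B \in unitmx.
Proof. by rewrite unitmx_mul => /andP[]. Qed.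

Lemma mx_of_funE d (f : 'cV[C]_d -> 'cV[C]_d) u : linear f ->
  mx_of_fun f *m u = f u.
Proof.
move=> lf; pose g := to_linear lf; rewrite -[f]/(g : _ -> _).
have {2}-> : u = \sum_j u j 0 *: delta_mx j 0.
  by rewrite [LHS]matrix_sum_delta; apply: eq_bigr => j _; rewrite big_ord1.
rewrite linear_sum; apply/colP => i; rewrite mxE summxE; apply: eq_bigr => j _.
by rewrite linearZ !mxE mulrC.
Qed.

Lemma nonneg_kernel_seq d (Om : set C) (k : C -> C -> 'M[C]_d) (I : Type)
  (s : seq I) (z : I -> C) (u : I -> 'cV[C]_d) : nonneg_kernel Om k ->
  (forall i, Om (z i)) ->
  0 <= \sum_(i <- s) \sum_(j <- s) cdot (k (z j) (z i) *m u j) (u i).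
Proof.
move=> kge0 Omz; rewrite big_tnth; under eq_bigr do rewrite big_tnth.
exact: kge0.
Qed.

End Cdot.

(** * Resolvents of selfadjoint relations and their compressions *)

Section ResolventFamily.
Variable R : realType.
Local Notation C := R[i].
Local Notation "x %:C" := (real_complex R x).
Variables (H : completeNormedModType C) (ip : {dot H for conjC}).
Hypothesis ipn : forall x : H, `|x| ^+ 2 = ip x x.

(* The resolvents (A - z)^-1 of a selfadjoint linear relation A. *)
Definition resolvent_family (G : C -> {linear H -> H}) : Prop :=
  (forall z w x, nonreal z -> nonreal w ->
     G z x - G w x = (z - w) *: G z (G w x)) /\
  (forall z x y, nonreal z -> ip (G z x) y = ip x (G z^* y)).

Lemma subrJ (z : C) : z - z^* = 2 * (complex.Im z)%:C * 'i%C.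
Proof. exact: subcJ. Qed.

(** By the resolvent identity at z and conj z, 2 i Im z |G z x|^2 = (G z x, x) - (x, G z x), and the
    right side is bounded by Cauchy-Schwarz. *)
Lemma resolvent_family_le G z x : resolvent_family G -> nonreal z ->
  `|complex.Im z| * rnorm (G z x) <= rnorm x.
Proof.
move=> [Gr Ga] nz; have nzJ := nonrealJ nz.
have h : (z - z^*) * ip (G z x) (G z x) = ip (G z x) x - ip x (G z x).
  have e1 : ip x (G z x) = ip (G z^* x) x by rewrite (Ga _ x x nzJ) conjCK.
  rewrite e1 -ipBl -[G z x - _]opprB (Gr _ _ _ nzJ nz) ipNl ipZl (Ga _ _ _ nzJ) conjCK.
  by rewrite -mulNr opprB.
have : rnorm ((z - z^*) * ip (G z x) (G z x)) <= 2 * (rnorm (G z x) * rnorm x).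
  rewrite h; apply: le_trans (rnormB _ _) _; rewrite mulr_natl mulr2n.
  by apply: lerD; rewrite ?(mulrC (rnorm (G z x)) _) (le_trans (cauchy_schwarz ipn _ _))// mulrC.
rewrite subrJ !rnormM rnorm_i rnorm_real mulr1 (ipxx ipn) rnorm_real.
rewrite -[2 : C](rmorph_nat (real_complex R)) rnorm_real [`|2%:R|]ger0_norm//.
rewrite [`|rnorm _ ^+ 2|]ger0_norm ?exprn_ge0 ?rnorm_ge0//.
have := rnorm_ge0 (G z x); rewrite le_eqVlt => /orP[/eqP <-|p].
  by rewrite mulr0 rnorm_ge0.
rewrite -mulrA ler_pM2l// expr2 mulrA mulrC.
by rewrite ler_pM2l.
Qed.

Lemma coercive_inj (T : {linear H -> H}) (c : R) : 0 < c ->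
  (forall x, c * rnorm x ^+ 2 <= complex.Re (ip (T x) x)) ->
  forall x, T x = 0 -> x = 0.
Proof.
move=> c0 Tc x Tx; apply: rnorm0_eq0; have := Tc x; rewrite Tx ip0l/=.
by rewrite pmulr_rle0// => h; apply/eqP; rewrite -sqrf_eq0 eq_le h exprn_ge0// rnorm_ge0.
Qed.

Lemma linear_inverse (T : {linear H -> H}) :
  (forall y, exists x, T x = y) -> (forall x, T x = 0 -> x = 0) ->
  exists S : {linear H -> H}, cancel S T /\ cancel T S.
Proof.
move=> /choice[S TS] Tinj; have inj x y : T x = T y -> x = y.
  by move=> h; apply/subr0_eq/Tinj; rewrite linearB h subrr.
have Sl : linear S.
  by move=> a x y; apply: inj; rewrite linearP !TS.
by exists (to_linear Sl); split=> x //=; apply: inj; rewrite TS.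
Qed.

(** * Resolvents obtained from a unitary operator by the Cayley transform *)

Section Unitary.
Variables U V : {linear H -> H}.
Hypotheses (UV : cancel V U) (VU : cancel U V).
Hypothesis Uadj : forall x y, ip (U x) y = ip x (V y).

Let Uiso x y : ip (U x) (U y) = ip x y.
Proof. by rewrite Uadj VU. Qed.

Let Unorm x : rnorm (U x) = rnorm x.
Proof.
apply/eqP; rewrite -(@eqrXn2 _ 2)// ?rnorm_ge0//.
by rewrite -!(Re_ipxx ipn) Uiso.
Qed.

Let Vnorm x : rnorm (V x) = rnorm x.
Proof. by rewrite -[in RHS](UV x) Unorm. Qed.

(** After division by a, the operator 1 + (b / a) W is coercive with constant 1 - |b / a|, since W
    is isometric. *)
Let pencil_coercive (W : {linear H -> H}) (a b : C) : rnorm b < rnorm a ->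
  (forall x, rnorm (W x) = rnorm x) ->
  exists S : {linear H -> H}, (forall x, a *: S x + b *: W (S x) = x) /\
     (forall x, S (a *: x + b *: W x) = x).
Proof.
move=> ba Wn; have a0 : 0 < rnorm a by apply: le_lt_trans ba; exact: rnorm_ge0.
have an0 : a != 0 by apply: contraTneq a0 => ->; rewrite rnorm0 ltxx.
have Tl : linear (fun x => x + (b / a) *: W x).
  move=> c x y; rewrite linearP !scalerDr addrACA !scalerA (mulrC c); congr (_ + _).
pose T : {linear H -> H} := to_linear Tl.
pose q := rnorm (b / a).
have q1 : q < 1 by rewrite /q rnormM rnormV ltr_pdivrMr// mul1r.
have c0 : 0 < 1 - q by rewrite subr_gt0.
have Tc x : (1 - q) * rnorm x ^+ 2 <= complex.Re (ip (T x) x).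
  rewrite ipDl ReD (Re_ipxx ipn) mulrBl mul1r lerD2l ipZl.
  have h := le_trans (ler_norm _) (rnormRe (- (b / a * ip (W x) x))).
  rewrite ReN in h; rewrite lerNl; apply: le_trans h _.
  rewrite rnormN rnormM -/q ler_wpM2l ?rnorm_ge0//.
  by apply: le_trans (cauchy_schwarz ipn _ _) _; rewrite Wn expr2.
have TM x : rnorm (T x) <= (1 + q) * rnorm x.
  by apply: le_trans (rnormD _ _) _; rewrite rnormZ Wn mulrDl mul1r.
have [S [TS ST]] := linear_inverse (coercive_surj ipn c0 TM Tc) (coercive_inj c0 Tc).
have S'l : linear (fun x => S (a^-1 *: x)).
  by move=> c x y; rewrite scalerDr scalerA mulrC -scalerA linearP.
exists (to_linear S'l); split=> x /=.
  have := TS (a^-1 *: x); rewrite /T/= => h.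
  by rewrite -[RHS](scalerKV an0) -[in RHS]h scalerDr scalerA mulrC divfK.
rewrite -[RHS]ST /T/=; congr (S _).
by rewrite scalerDr scalerK// scalerA mulrC.
Qed.

(* [cayley_pencil z x] is the image of x - U x under A - z, for the relation A
   with graph {(x - U x, i (x + U x))}. *)
Definition cayley_pencil (z : C) (x : H) : H :=
  ('i%C - z) *: x + (z + 'i%C) *: U x.

Let cayley_mod (z : C) : complex.Im z < 0 -> rnorm (z + 'i%C) < rnorm ('i%C - z).
Proof.
move=> z0; rewrite -(@ltr_pXn2r _ 2)// ?nnegrE ?rnorm_ge0// !rnorm_sqr.
by case: z z0 => a b /= b0; nra.
Qed.

Lemma cayley_pencil_inv z : nonreal z -> exists S : {linear H -> H},
  cancel S (cayley_pencil z) /\ cancel (cayley_pencil z) S.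
Proof.
move=> /nonrealE; rewrite neq_lt => /orP[z0|z0].
  have [S [S1 S2]] := pencil_coercive (cayley_mod z0) Unorm.
  by exists S; split=> x; [exact: S1|exact: S2].
(* In the upper half-plane the coefficient of U dominates; U is factored out and V = U^-1 takes its
   place in the coercivity argument. *)
have zm : rnorm ('i%C - z) < rnorm (z + 'i%C).
  rewrite -(@ltr_pXn2r _ 2)// ?nnegrE ?rnorm_ge0// !rnorm_sqr.
  by case: z z0 => a b /= b0; nra.
have [S [S1 S2]] := pencil_coercive zm Vnorm.
have cE x : cayley_pencil z x = U ((z + 'i%C) *: x + ('i%C - z) *: V x).
  by rewrite /cayley_pencil linearD !linearZ/= UV addrC.
have S'l : linear (fun x => S (V x)) by move=> c x y; rewrite !linearP.
exists (to_linear S'l); split=> x /=; first by rewrite cE S1 UV.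
by rewrite cE VU S2.
Qed.

(** Taking G z as 1 - U after the inverse pencil never inverts 1 - U, so U may have the eigenvalue
    1, in which case A is a relation and not an operator. *)
Lemma unitary_resolvent : exists G : C -> {linear H -> H},
  resolvent_family G /\ forall z x, nonreal z -> G z (cayley_pencil z x) = x - U x.
Proof.
have /choice[S hS] z : exists S : {linear H -> H}, nonreal z ->
    cancel S (cayley_pencil z) /\ cancel (cayley_pencil z) S.
  have [nz|nz] := pselect (nonreal z); last first.
    by exists (to_linear (fun a x y => erefl : idfun _ = _)).
  by have [S ?] := cayley_pencil_inv nz; exists S.
have Gl z : linear (fun x => S z x - U (S z x)).
  by move=> c x y /=; rewrite !linearP addrACA -scalerDr.
pose G z : {linear H -> H} := to_linear (Gl z).
have GE z x : nonreal z -> G z (cayley_pencil z x) = x - U x.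
  by move=> nz; rewrite /G/= (hS z nz).2.
exists G; split=> //; split.
- move=> z w x nz nw.
  (* Written through g, all terms of the resolvent identity become combinations of k = g - U g and U
     k, and only coefficients have to be compared. *)
  have -> : x = cayley_pencil z (cayley_pencil w (S w (S z x))).
    by rewrite (hS w nw).1 (hS z nz).1.
  set g := S w (S z x).
  have cU v y : U (cayley_pencil v y) = cayley_pencil v (U y).
    by rewrite /cayley_pencil linearP linearZ.
  have cB v y : cayley_pencil v y - U (cayley_pencil v y) =
            cayley_pencil v (y - U y).
    rewrite cU /cayley_pencil opprD addrACA -!scalerBr.
    by rewrite (linearB U).
  have com : cayley_pencil z (cayley_pencil w g) =
             cayley_pencil w (cayley_pencil z g).
    rewrite {1 3}/cayley_pencil !cU /cayley_pencil !scalerDr !scalerA.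
    rewrite -!addrA [X in _ + X = _]addrCA.
    by congr (_ *: _ + (_ *: _ + (_ *: _ + _ *: _))); rewrite mulrC.
  rewrite GE// com GE// !cB GE//; set k := g - U g.
  rewrite /cayley_pencil opprD addrACA -!scalerBl [RHS]scalerBr.
  rewrite (_ : 'i%C - w - ('i%C - z) = z - w); last by ring.
  by rewrite (_ : w + 'i%C - (z + 'i%C) = - (z - w)) ?scaleNr//; ring.
- move=> z x y nz; have nzJ := nonrealJ nz.
  rewrite -[x](hS z nz).1 -[y](hS _ nzJ).1; set g := S z x; set g' := S _ y.
  rewrite !GE// /cayley_pencil.
  rewrite !(ipBl, ipBr, ipDl, ipDr, ipZl, ipZr) Uiso.
  rewrite rmorphB rmorphD/= conjCK conj_i.
  ring.
Qed.

End Unitary.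
End ResolventFamily.

(** * Unitary extension of isometries and the Naimark dilation *)

Section Dilation.
Variable R : realType.
Local Notation C := R[i].

Section Extension.
Variables (H : completeNormedModType C) (ip : {dot H for conjC}).
Hypothesis ipn : forall x : H, `|x| ^+ 2 = ip x x.
Hypothesis riesz : riesz_property ip.
Variable tau : {linear H -> H}.
Hypotheses (tauK : involutive tau) (tau_iso : forall x y, ip (tau x) (tau y) = ip x y).
Variables (T : Type) (x y : T -> H).
Hypothesis xy_gram : forall s t, ip (x s) (x t) = ip (y s) (y t).
Hypothesis x_tauy : forall s t, ip (x s) (tau (y t)) = 0.

(* The reflection in the orthogonal complement of the span of the vectors
   [x t - tau (y t)] exchanges [x t] and [tau (y t)]. *)
Lemma unitary_extension : exists U V : {linear H -> H},
  [/\ cancel V U, cancel U V, forall a b, ip (U a) b = ip a (V b)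
    & forall t, U (x t) = y t].
Proof.
pose xi t := x t - tau (y t).
have [P [Pxi Psa PP P0]] := family_projection ipn xi riesz.
pose Z a := a - 2 *: P a.
have Zl : linear Z.
  move=> c a b; rewrite /Z (linearP P) !scalerDr opprD addrACA scalerN.
  by rewrite !scalerA mulrC.
have ZZ a : Z (Z a) = a.
  have PZ : P (Z a) = - P a.
    rewrite /Z linearB linearZ/= PP scaler_nat mulr2n opprD addrA subrr.
    by rewrite sub0r.
  by rewrite {1}/Z PZ scalerN opprK /Z subrK.
have Zsa a b : ip (Z a) b = ip a (Z b).
  rewrite /Z ipBl ipBr ipZl ipZr Psa; congr (_ - _ * _).
  by rewrite (rmorph_nat conjC).
(* 2 x = (x - tau y) + (x + tau y). Equality of the Gram matrices and orthogonality of the x's to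
   the tau y's make the second term orthogonal to every xi. *)
have Zx t : Z (x t) = tau (y t).
  have Ps : P (x t + tau (y t)) = 0.
    apply: P0 => s; rewrite /xi ipBr !ipDl tau_iso x_tauy xy_gram.
    rewrite (ipC ip (tau _) (x _)) x_tauy rmorph0 addr0 add0r.
    by rewrite subrr.
  rewrite /Z -linearZ/= (_ : 2 *: x t = xi t + (x t + tau (y t))).
    by rewrite linearD Pxi Ps addr0 /xi opprB addrC subrK.
  by rewrite /xi addrA addrAC subrK scaler_nat mulr2n.
pose Zm := to_linear Zl.
have Ul : linear (fun a => tau (Zm a)) by move=> c a b; rewrite /= Zl linearP.
have Vl : linear (fun a => Zm (tau a)) by move=> c a b; rewrite /= linearP Zl.
exists (to_linear Ul), (to_linear Vl); split=> [a|a|a b|t] /=.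
- by rewrite ZZ tauK.
- by rewrite tauK ZZ.
- by rewrite -[b in LHS]tauK tau_iso Zsa.
- by rewrite Zx tauK.
Qed.

End Extension.

Section Double.
Variables (T : Type) (k : pdkernel R T).

(* The second copy of the space leaves room for an isometry between subspaces of
   the first to extend to a unitary operator. *)
Definition kdouble (s t : bool * T) : C := (s.1 == t.1)%:R * k s.2 t.2.

Fact kdoubleC s t : kdouble s t = (kdouble t s)^*.
Proof. by rewrite /kdouble rmorphM/= rmorph_nat -kfunC eq_sym. Qed.

Fact kdouble_ge0 (v : seq (C * (bool * T))) :
  0 <= \sum_(x <- v) \sum_(y <- v) x.1 * y.1^* * kdouble x.2 y.2.
Proof.
have E : \sum_(x <- v) \sum_(y <- v) x.1 * y.1^* * kdouble x.2 y.2 =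
  \sum_(b : bool) \sum_(x <- [seq ((x.2.1 == b)%:R * x.1, x.2.2) | x <- v])
    \sum_(y <- [seq ((x.2.1 == b)%:R * x.1, x.2.2) | x <- v])
      x.1 * y.1^* * k x.2 y.2.
  rewrite big_bool !big_map -big_split; apply: eq_bigr => x _.
  rewrite !big_map -big_split; apply: eq_bigr => y _ /=.
  rewrite /kdouble; case: x => c [[] t]; case: y => e [[] s] /=;
    rewrite ?(mul1r, mul0r, mulr0, rmorph0, rmorph1, add0r, addr0)//.
by rewrite E; apply: sumr_ge0 => b _; exact: kfun_ge0.
Qed.

Definition double : pdkernel R (bool * T) := PdKernel kdoubleC kdouble_ge0.

Definition flip (s : bool * T) := (~~ s.1, s.2).

Lemma flipK : involutive flip. Proof. by case=> [[] t]. Qed.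

Lemma double_flip s t : double (flip s) (flip t) = double s t.
Proof. by rewrite /= /kdouble /=; case: s.1; case: t.1. Qed.

Definition lflip (v : seq (C * (bool * T))) := [seq (x.1, flip x.2) | x <- v].

Lemma fpair_flip (f : bool * T -> C) v :
  fpair (fun t => f (flip t)) v = fpair f (lflip v).
Proof. by rewrite /fpair big_map. Qed.

Lemma knorm2_flip v : knorm2 double (lflip v) = knorm2 double v.
Proof.
rewrite /knorm2 -fpair_flip; congr (complex.Re (fpair _ _)); apply/funext => t.
by rewrite /kcomb big_map; apply: eq_bigr => x _; rewrite double_flip.
Qed.

Fact flip_crit (f : rkhs double) v : rnorm (fpair (fun t => f (flip t)) v) <=
  rnorm f * Num.sqrt (knorm2 double v).
Proof. by rewrite fpair_flip -knorm2_flip rkhs_fpair_le. Qed.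

Definition kflip_fun (f : rkhs double) : rkhs double :=
  to_rkhs (fbounded_crit (rnorm_ge0 f) (flip_crit f)).1.

Fact kflip_linear : linear kflip_fun.
Proof. by move=> a f g; apply: rkhs_ext. Qed.

Definition kflip : {linear rkhs double -> rkhs double} := to_linear kflip_linear.

Lemma kflipE (f : rkhs double) t : kflip f t = f (flip t). Proof. by []. Qed.

Lemma kflipK : involutive kflip.
Proof. by move=> f; apply: rkhs_ext => t; rewrite !kflipE flipK. Qed.

Lemma kflip_kvec s : kflip (kvec double s) = kvec double (flip s).
Proof.
by apply: rkhs_ext => t; rewrite kflipE !kvecE -[t in RHS]flipK double_flip.
Qed.

Lemma kflip_norm f : rnorm (kflip f) = rnorm f.
Proof.
have le g : rnorm (kflip g) <= rnorm g.
  rewrite -(@ler_pXn2r _ 2)// ?nnegrE ?rnorm_ge0// rkhs_rnorm2.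
  exact: (fbounded_crit (rnorm_ge0 g) (flip_crit g)).2.
by apply/eqP; rewrite eq_le le -{1}[f]kflipK le.
Qed.

Lemma kflip_iso f g : rkhs_ip (kflip f) (kflip g) = rkhs_ip f g.
Proof.
have p a b : polar (kflip a) (kflip b) = polar a b.
  by rewrite /polar -(linearD kflip) !kflip_norm.
have iE : 'i%C *: kflip g = kflip ('i%C *: g) by rewrite linearZ.
by rewrite /rkhs_ip /jvn_ip /= /jvn iE !p.
Qed.

End Double.
Arguments kflip {T k}.

Section Model.
Local Open Scope sesquilinear_scope.
Variable d : nat.

(* On [Om], Q is the compression to C^d of the resolvent of a selfadjoint
   relation. *)
Definition has_model (Om : set C) (Q : C -> 'M[C]_d) : Prop :=
  exists (H : completeNormedModType C) (ip : {dot H for conjC})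
    (J : {linear 'cV[C]_d -> H}) (G : C -> {linear H -> H}),
  [/\ norm_of_dot ip, resolvent_family ip G,
      forall u v, ip (J u) (J v) = cdot u v
    & forall z, Om z -> forall u v,
        ip (G z (J u)) (J v) = cdot (Q z *m u) v].

(** For a compressed resolvent Q z = J^+ G z J this is the Gram kernel of the components of G(w)^+ J
    u orthogonal to the range of J. *)
Definition resolvent_kernel (Q : C -> 'M[C]_d) (w z : C) : 'M[C]_d :=
  (z - w^*)^-1 *: (Q z - (Q w) ^t*) - Q z *m (Q w) ^t*.

Variables (Om : set C) (Q : C -> 'M[C]_d).
Hypotheses (Om_upper : forall z, Om z -> upper z) (Om0 : Om !=set0).
Hypothesis Q_ge0 : nonneg_kernel Om (resolvent_kernel Q).

(** [inl (z, u)] labels the future vector G(z)^+ J u, and [inr u] the vector J u. *)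
Let I := ({z | Om z} * 'cV[C]_d + 'cV[C]_d)%type.

(** At [inr] any point of Om will do, since it meets only the zero [vec]. *)
Let pt (s : I) : C := match s with inl (exist z _, _) => z | inr _ => projT1 (cid Om0) end.
Let vec (s : I) : 'cV[C]_d := match s with inl (_, u) => u | inr _ => 0 end.
Let val (s : I) : 'cV[C]_d :=
  match s with inl (exist z _, u) => (Q z) ^t* *m u | inr u => u end.

Let Om_pt s : Om (pt s).
Proof. by case: s => [[[z Oz] u]|u] //=; case: cid. Qed.

(** The Gram matrix these vectors must have: [val] gives their component in the range of J, and the
    resolvent kernel is the Gram matrix of the orthogonal components. *)
Let k (s t : I) : C :=
  cdot (resolvent_kernel Q (pt s) (pt t) *m vec s) (vec t) + cdot (val s) (val t).

Lemma resolvent_kernelC z w : (resolvent_kernel Q w z) ^t* = resolvent_kernel Q z w.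
Proof.
rewrite /resolvent_kernel adjmxD adjmxN adjmxZ adjmxM adjmxK adjmxD adjmxN adjmxK.
congr (_ - _); rewrite fmorphV rmorphB/= conjCK.
by rewrite -[Q w - _]opprB scalerN -scaleNr -invrN opprB.
Qed.

Fact model_kernelC s t : k s t = (k t s)^*.
Proof.
rewrite /k rmorphD/= -!cdotC; congr (_ + _).
by rewrite cdot_adjmx resolvent_kernelC.
Qed.

Fact model_kernel_ge0 (v : seq (C * I)) :
  0 <= \sum_(x <- v) \sum_(y <- v) x.1 * y.1^* * k x.2 y.2.
Proof.
under eq_bigr do under eq_bigr do rewrite mulrDr.
under eq_bigr do rewrite big_split.
rewrite big_split/=; apply: addr_ge0.
  have := nonneg_kernel_seq v (fun x => x.1 *: vec x.2) Q_ge0 (fun x => Om_pt x.2).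
  rewrite exchange_big; congr (_ <= _); apply: eq_bigr => x _.
  apply: eq_bigr => y _; by rewrite -scalemxAr cdotZl cdotZr mulrA.
rewrite (_ : \sum_(x <- v) _ = cdot (\sum_(x <- v) x.1 *: val x.2)
                                    (\sum_(x <- v) x.1 *: val x.2)).
  exact: cdot_ge0.
rewrite cdot_suml; apply: eq_bigr => x _; rewrite cdot_sumr.
by apply: eq_bigr => y _; rewrite cdotZl cdotZr mulrA.
Qed.

Let K := PdKernel model_kernelC model_kernel_ge0.

(** The Gram matrix fixes the action of G on the vectors J u. The Cayley transform of this partial
    resolvent is isometric by the form of the resolvent kernel, and the second copy of the space
    lets it extend to a unitary operator. *)
Theorem resolvent_model : has_model Om Q.
Proof.
pose J0 u : rkhs (double K) := kvec (double K) (false, inr u).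
have JE u t : J0 u t = (~~ t.1)%:R * cdot u (val t.2).
  rewrite /J0 kvecE /= /kdouble /=.
  by case: t.1; rewrite /= ?mul0r// /k mulmx0 cdot0l add0r.
have Jl : linear J0.
  move=> a u v; apply: rkhs_ext => t; rewrite JE cdotDl cdotZl.
  rewrite (_ : (a *: J0 u + J0 v) t = a * J0 u t + J0 v t)// !JE; ring.
pose e (s : {z | Om z} * 'cV[C]_d) : rkhs (double K) :=
  kvec (double K) (false, inl s).
pose om (s : {z | Om z} * 'cV[C]_d) : C := (projT1 s.1)^*.
have ee s t : rkhs_ip (e s) (e t) = K (inl s) (inl t).
  by rewrite rkhs_ip_kvec kvecE /= /kdouble /= mul1r.
have eJ s u : rkhs_ip (e s) (J0 u) = cdot (val (inl s)) u.
  by rewrite ipC rkhs_ip_kvec JE /= mul1r -cdotC.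
have Je s u : rkhs_ip (J0 u) (e s) = cdot u (val (inl s)).
  by rewrite ipC eJ -cdotC.
have JJ u v : rkhs_ip (J0 u) (J0 v) = cdot u v.
  by rewrite rkhs_ip_kvec JE /= mul1r.
have ff s t : rkhs_ip (kvec (double K) (false, s)) (kflip (kvec (double K) (false, t))) = 0.
  by rewrite kflip_kvec rkhs_ip_kvec kvecE /= /kdouble /= mul0r.
have fee s t : rkhs_ip (e s) (kflip (e t)) = 0 by exact: ff.
have feJ s u : rkhs_ip (e s) (kflip (J0 u)) = 0 by exact: ff.
have fJe s u : rkhs_ip (J0 u) (kflip (e s)) = 0 by exact: ff.
have fJJ u v : rkhs_ip (J0 u) (kflip (J0 v)) = 0 by exact: ff.
clearbody e J0.
(* If G(om) J u = e, the relation A contains (e, om e + J u); then x and y are (A + i) e and (A - i)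
   e, which the Cayley transform has to connect. *)
pose x s := (om s + 'i%C) *: e s + J0 s.2.
pose y s := (om s - 'i%C) *: e s + J0 s.2.
have x_y s t : rkhs_ip (x s) (kflip (y t)) = 0.
  rewrite /x /y (linearP kflip) !(ipDl, ipDr, ipZl, ipZr).
  rewrite fee feJ fJe fJJ.
  by rewrite !mulr0 !addr0.
have x_gram s t : rkhs_ip (x s) (x t) = rkhs_ip (y s) (y t).
  rewrite /x /y !(ipDl, ipDr, ipZl, ipZr) ee !eJ !Je.
  rewrite [(om t + _)^*]rmorphD [(om t - _)^*]rmorphB /= /om conjCK conj_i.
  case: s => [[w Ow] u]; case: t => [[z Oz] v] /=; rewrite /k /=.
  have D0 : z - w^* != 0 by apply: upper_subJ; exact: Om_upper.
  rewrite /resolvent_kernel mulmxBl -scalemxAl mulmxBl cdotBl cdotZl cdotBl.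
  rewrite -mulmxA [cdot (Q z *m (_ *m _)) _]cdot_adjmx.
  rewrite -[cdot u (_ *m v)]cdot_adjmx.
  by field.
have [U [V [UV VU Uadj Ux]]] := unitary_extension rkhs_ipn (@rkhs_riesz _ _ _)
  (@kflipK _ K) (@kflip_iso _ K) x_gram x_y.
have [G [Gres GE]] := unitary_resolvent rkhs_ipn UV VU Uadj.
have GJ s : G (om s) (J0 s.2) = e s.
  have nz : nonreal (om s).
    by apply/nonrealJ/upper_nonreal/Om_upper; case: (s.1).
  have i2 : (2 * 'i%C : C) != 0.
    by rewrite mulf_eq0 pnatr_eq0/= eq_complex/= oner_eq0 andbF.
  apply: (scalerI i2); rewrite -linearZ.
  have <- : cayley_pencil U (om s) (x s) = (2 * 'i%C) *: J0 s.2.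
    rewrite /cayley_pencil Ux /x /y !scalerDr !scalerA addrACA -!scalerDl.
    rewrite (_ : _ + (om s + 'i%C) * _ = 0) ?scale0r ?add0r; last by ring.
    by congr (_ *: _); ring.
  rewrite GE// Ux /x /y opprD addrACA subrr addr0 -scalerBl; congr (_ *: _).
  by ring.
exists (rkhs (double K)), rkhs_ip, (to_linear Jl), G; split=> //.
  exact: rkhs_ipn.
move=> z Oz u v; rewrite (proj2 Gres); last exact/upper_nonreal/Om_upper.
have /= -> := GJ (exist _ z Oz, v).
by rewrite Je/= cdot_adjmx.
Qed.

End Model.
End Dilation.

(** * Holomorphy and the identity theorem *)

Section LocalAlgebra.
Variable C : numFieldType.

(* Both continuity and differentiability at z are of this kind. *)
Record local_algebra (z : C) (P : (C -> C) -> Prop) := LocalAlgebra {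
  la_cst : forall c, P (fun=> c);
  la_id : P id;
  laD : forall f g, P f -> P g -> P (fun w => f w + g w);
  laM : forall f g, P f -> P g -> P (fun w => f w * g w);
  laV : forall f, P f -> f z != 0 -> P (fun w => (f w)^-1);
  la_near : forall f g, P f -> (\forall w \near z, f w = g w) -> P g }.

Lemma cvg_distP (f : C -> C) (z l : C) :
  (forall e : C, 0 < e -> exists2 r : C, 0 < r & forall w, `|w - z| < r ->
     `|f w - l| < e) -> f w @[w --> z] --> l.
Proof.
move=> h; apply/(@cvgrPdist_lt _ C^o _ (nbhs z) (nbhs_filter z)) => e e0.
have [r r0 hr] := h e e0.
apply/nbhs_ballP; exists r => //= w; rewrite -ball_normE/= distrC => /hr.
by rewrite distrC.
Qed.

Lemma continuous_local_algebra (z : C) :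
  local_algebra z (fun f => f w @[w --> z] --> f z).
Proof.
split.
- by move=> c; exact: (@cvg_cst C c _ (nbhs z) _).
- by move=> A; apply.
- by move=> f g hf hg; exact: (cvgD hf hg).
- by move=> f g hf hg; exact: (cvgM hf hg).
- by move=> f fz f0; exact: (cvgV f0 fz).
- move=> f g fz fg; rewrite -(nbhs_singleton fg).
  exact: cvg_trans (near_eq_cvg fg) fz.
Qed.

Lemma derivable_local_algebra (z : C) :
  local_algebra z (fun f => derivable (f : C^o -> C^o) z 1).
Proof.
split.
- by move=> c; exact: derivable_cst.
- exact: derivable_id.
- by move=> f g; exact: derivableD.
- by move=> f g; exact: derivableM.
- by move=> f fz f0; exact: (derivableV f0 fz).
- move=> f g fz fg; apply: near_eq_derivable fz => //.
Qed.

(** Divided differences will be available as explicit continuous functions; this turns such a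
    formula into differentiability and the value of the derivative at the same time. *)
Lemma difference_quotient (f T : C -> C) (z : C) :
  (\forall w \near z, f w - f z = (w - z) * T w) ->
  T w @[w --> z] --> T z ->
  derivable (f : C^o -> C^o) z 1 /\ derive1 (f : C^o -> C^o) z = T z.
Proof.
move=> fT Tz.
have h : (h^-1 *: ((f : C^o -> C^o) (h + z) - f z)) @[h --> (0 : C^o)^'] --> (T z : C^o).
  apply/cvgrPdist_lt => e e0.
  move/cvgrPdist_lt: Tz => /(_ e e0) Te.
  have : \forall w \near z, f w - f z = (w - z) * T w /\ `|T z - T w| < e.
    by apply: filterS2 fT Te => w.
  move=> /nbhs_ballP[r /= r0 hr].
  rewrite /dnbhs near_withinE; apply/nbhs_ballP; exists r => //= x.
  rewrite -ball_normE/= sub0r normrN => xr x0.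
  have [|-> hx] := hr (x + z).
    by rewrite -ball_normE/= opprD addrCA subrr addr0 normrN.
  by rewrite addrK /GRing.scale/= mulKf.
have dE (h0 : C) : (f \o shift z) (h0 *: (1 : C^o)) - f z = f (h0 + z) - f z.
  by rewrite /= [h0 *: _]mulr1.
split; last by apply/cvg_lim; [exact: norm_hausdorff|exact: h].
apply/cvg_ex; exists (T z); apply: cvg_trans h.
by apply: near_eq_cvg; near=> h0; rewrite dE.
Unshelve. all: by end_near. Qed.

Section Matrices.
Variables (z : C) (P : (C -> C) -> Prop) (LA : local_algebra z P).

Lemma la_sum (I : Type) (r : seq I) (F : I -> C -> C) :
  (forall i, P (F i)) -> P (fun w => \sum_(i <- r) F i w).
Proof.
move=> PF; elim: r => [|i r IH].
  rewrite (_ : (fun w => _) = fun=> 0); first exact: la_cst LA _.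
  by apply/funext => w; rewrite big_nil.
rewrite (_ : (fun w => _) = fun w => F i w + \sum_(j <- r) F j w).
  exact: laD LA _ _ _ _.
by apply/funext => w; rewrite big_cons.
Qed.

Lemma la_prod (I : Type) (r : seq I) (F : I -> C -> C) :
  (forall i, P (F i)) -> P (fun w => \prod_(i <- r) F i w).
Proof.
move=> PF; elim: r => [|i r IH].
  rewrite (_ : (fun w => _) = fun=> 1); first exact: la_cst LA _.
  by apply/funext => w; rewrite big_nil.
rewrite (_ : (fun w => _) = fun w => F i w * \prod_(j <- r) F j w).
  exact: laM LA _ _ _ _.
by apply/funext => w; rewrite big_cons.
Qed.

Definition la_mx m n (A : C -> 'M[C]_(m, n)) := forall i j, P (fun w => A w i j).

Lemma la_mx_cst m n (A : 'M[C]_(m, n)) : la_mx (fun=> A).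
Proof. by move=> i j; exact: la_cst LA _. Qed.

Lemma la_mxD m n (A B : C -> 'M[C]_(m, n)) :
  la_mx A -> la_mx B -> la_mx (fun w => A w + B w).
Proof.
move=> hA hB i j; rewrite (_ : (fun w => _) = fun w => A w i j + B w i j).
  exact: laD LA _ _ (hA i j) (hB i j).
by apply/funext => w; rewrite mxE.
Qed.

Lemma la_mxZ m n (f : C -> C) (A : C -> 'M[C]_(m, n)) :
  P f -> la_mx A -> la_mx (fun w => f w *: A w).
Proof.
move=> hf hA i j; rewrite (_ : (fun w => _) = fun w => f w * A w i j).
  exact: laM LA _ _ hf (hA i j).
by apply/funext => w; rewrite mxE.
Qed.

Lemma la_mxN m n (A : C -> 'M[C]_(m, n)) : la_mx A -> la_mx (fun w => - A w).
Proof.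
move=> hA; rewrite (_ : (fun w => _) = fun w => (-1) *: A w).
  exact: la_mxZ (la_cst LA _) hA.
by apply/funext => w; rewrite scaleN1r.
Qed.

Lemma la_mxB m n (A B : C -> 'M[C]_(m, n)) :
  la_mx A -> la_mx B -> la_mx (fun w => A w - B w).
Proof. by move=> hA hB; exact/la_mxD/la_mxN. Qed.

Lemma la_mxM m n p (A : C -> 'M[C]_(m, n)) (B : C -> 'M[C]_(n, p)) :
  la_mx A -> la_mx B -> la_mx (fun w => A w *m B w).
Proof.
move=> hA hB i j; rewrite (_ : (fun w => _) = fun w => \sum_k A w i k * B w k j).
  by apply: la_sum => k; exact: laM LA _ _ (hA i k) (hB k j).
by apply/funext => w; rewrite mxE.
Qed.

Lemma la_det n (A : C -> 'M[C]_n) : la_mx A -> P (fun w => \det (A w)).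
Proof.
move=> hA; apply: la_sum => s; apply: (laM LA (la_cst LA _)).
by apply: la_prod => i; exact: hA.
Qed.

(** The cofactor formula expresses the inverse by determinants, so closure under the field
    operations suffices. *)
Lemma la_invmx n (A : C -> 'M[C]_n) : la_mx A ->
  (\forall w \near z, A w \in unitmx) -> la_mx (fun w => invmx (A w)).
Proof.
move=> hA uA i j.
have Az : \det (A z) != 0 by rewrite -unitfE; exact: nbhs_singleton uA.
have h : P (fun w => (\det (A w))^-1 * cofactor (A w) j i).
  apply: (laM LA); first exact: laV LA _ (la_det hA) Az.
  apply: (laM LA (la_cst LA _)); apply: la_det => k l.
  rewrite (_ : (fun w => _) = fun w => A w (lift j k) (lift i l)); first exact: hA.
  by apply/funext => w; rewrite !mxE.
apply: (la_near LA h); near=> w.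
have uw : A w \in unitmx by near: w.
by rewrite /invmx uw !mxE.
Unshelve. all: by end_near. Qed.

End Matrices.
End LocalAlgebra.

Section ComplexTopology.
Variable R : realType.
Local Notation "x %:C" := (real_complex R x).
Let C : numFieldType := R[i].

Lemma near_nonreal (z : C) : nonreal z -> \forall w \near z, @nonreal R w.
Proof.
move=> /nonrealE z0.
have r0 : 0 < `|complex.Im z|%:C :> C by rewrite ltcR normr_gt0.
apply/nbhs_ballP; exists `|complex.Im z|%:C => //= w.
rewrite -ball_normE/= -rnormE ltcR => h; apply/nonrealE; apply/eqP => w0.
have := rnormIm (z - w); rewrite leNgt => /negP; apply.
apply: lt_le_trans h _; rewrite (_ : complex.Im (z - w) = complex.Im z)//.
by move: w0; case: (z) => a b; case: (w) => c e /= ->; rewrite subr0.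
Qed.

Lemma cvg_rnormP (f : C -> C) (z l : C) :
  (forall e : R, 0 < e -> exists2 r : R, 0 < r & forall w, rnorm (w - z) < r ->
     rnorm (f w - l) < e) -> f w @[w --> z] --> l.
Proof.
move=> h; apply: cvg_distP => e e0.
have e0' : 0 < complex.Re e by move: e0; rewrite ltcE => /andP[].
have [r r0 hr] := h _ e0'.
exists r%:C; first by rewrite ltcR.
move=> w; rewrite -rnormE ltcR => /hr hw.
by rewrite -rnormE -[e]RRe_real ?gtr0_real// ltcR.
Qed.

End ComplexTopology.

(** * The identity theorem in the upper half-plane *)

Section Identity.
Variable R : realType.
Local Notation C := R[i].
Local Notation "x %:C" := (real_complex R x).

(* Taylor expansion at every point of the open upper half-plane, with a
   geometric remainder on the largest disc avoiding the real line. *)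
Definition taylor_upper (f : C -> C) : Prop :=
  forall z0, upper z0 -> exists (a : nat -> C) (M : R), forall n z,
    rnorm (z - z0) < complex.Im z0 ->
    (complex.Im z0 - rnorm (z - z0)) *
      rnorm (f z - \sum_(k < n) a k * (z - z0) ^+ k) <=
    M * (rnorm (z - z0) / complex.Im z0) ^+ n.

(** Near z0 the estimate of order k + 1 bounds |a k| s^k by a multiple of s^(k+1), so the
    coefficients vanish by induction; the remainder estimate for growing n then forces f z = 0 in
    the whole disc. *)
Lemma taylor_upper_disc f z0 (r : R) : taylor_upper f -> upper z0 -> 0 < r ->
  (forall z, rnorm (z - z0) < r -> f z = 0) ->
  forall z, rnorm (z - z0) < complex.Im z0 -> f z = 0.
Proof.
move=> tf uz r0 fz0; have y0 : 0 < complex.Im z0 by apply/upperE.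
have [a [M tay]] := tf _ uz; set y := complex.Im z0 in y0 tay *.
have a0 k : a k = 0.
  have [m] := ubnP k; elim: m k => // m IH k /ltnSE km.
  apply: rnorm0_eq0; apply/eqP; rewrite eq_le rnorm_ge0 andbT leNgt.
  apply/negP => ak0.
  have bound (s : R) : 0 < s -> s < r -> s < y / 2 ->
      y / 2 * rnorm (a k) * y ^+ k.+1 <= M * s.
    move=> s0 sr sy; have zs : rnorm (z0 + s%:C - z0) = s.
      by rewrite addrC addKr rnorm_real gtr0_norm.
    have := tay k.+1 (z0 + s%:C); rewrite zs => /(_ _)/wrap[].
      by apply: lt_trans sy _; rewrite ltr_pdivrMr// ltr_pMr// ltr1n.
    rewrite fz0 ?zs// big_ord_recr/= big1 ?add0r; last first.
      by move=> i _; rewrite IH ?mul0r// (leq_trans _ km).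
    rewrite ?sub0r rnormN rnormM rnormX zs => h.
    have sk : 0 < s ^+ k by rewrite exprn_gt0.
    rewrite expr_div_n (mulrA M) ler_pdivlMr ?exprn_gt0// in h.
    rewrite -(ler_pM2r sk).
    apply: le_trans (_ : _ <= (y - s) * (rnorm (a k) * s ^+ k) * y ^+ k.+1) _;
      last first.
      by apply: le_trans h _; rewrite exprS mulrA.
    rewrite (_ : y / 2 * _ * _ * _ = y / 2 * (rnorm (a k) * s ^+ k * y ^+ k.+1)); last by ring.
    rewrite (_ : (y - s) * _ * _ = (y - s) * (rnorm (a k) * s ^+ k * y ^+ k.+1)); last by ring.
    rewrite ler_wpM2r ?mulr_ge0 ?exprn_ge0 ?rnorm_ge0 ?(ltW y0) ?(ltW s0)//.
    by move: sy; rewrite ltr_pdivlMr// ler_pdivrMr//; lra.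
  set c := y / 2 * rnorm (a k) * y ^+ k.+1 in bound.
  have c0 : 0 < c by rewrite !mulr_gt0 ?exprn_gt0 ?invr_gt0.
  have M1 : 0 < `|M| + 1 by apply: ltr_wpDl.
  (* Small enough for the disc of vanishing, for y - s >= y / 2, and for M s < c, which contradicts
     [bound]. *)
  pose s := Num.min (Num.min (r / 2) (y / 3)) (c / (`|M| + 1) / 2).
  have s0 : 0 < s by rewrite !lt_min !divr_gt0.
  have sr : s < r.
    apply: le_lt_trans (_ : _ <= r / 2) _; first by rewrite !ge_min lexx.
    by rewrite ltr_pdivrMr//; lra.
  have sy : s < y / 2.
    apply: le_lt_trans (_ : _ <= y / 3) _; first by rewrite !ge_min lexx ?orbT.
    by rewrite ltr_pdivrMr//; lra.
  have sc : s * (`|M| + 1) <= c / 2.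
    rewrite -ler_pdivlMr// (le_trans (_ : _ <= c / (`|M| + 1) / 2))//.
      by rewrite ge_min lexx orbT.
    by rewrite mulrAC.
  have := bound s s0 sr sy; have := ler_norm M; nra.
move=> z zy; apply: rnorm0_eq0; apply/eqP; rewrite eq_le rnorm_ge0 andbT.
rewrite leNgt; apply/negP => fz.
have q0 : 0 <= rnorm (z - z0) / y by rewrite divr_ge0 ?rnorm_ge0// ltW.
have q1 : rnorm (z - z0) / y < 1 by rewrite ltr_pdivrMr// mul1r.
have e0 : 0 < (y - rnorm (z - z0)) * rnorm (f z).
  by rewrite mulr_gt0// subr_gt0.
have [N HN] := geometric_small M q0 q1 e0.
have := tay N z zy; rewrite big1 ?subr0 => [h|i _]; last by rewrite a0 mul0r.
by have := HN N (leqnn N); rewrite ltNge h.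
Qed.

(** The discs about z0 + i n y / 2 that touch the real line exhaust the half-plane as n grows, and
    each next centre is interior to the previous disc. *)
Lemma taylor_upper_eq0 f z0 (r : R) : taylor_upper f -> upper z0 -> 0 < r ->
  (forall z, rnorm (z - z0) < r -> f z = 0) -> forall z, upper z -> f z = 0.
Proof.
move=> tf uz r0 fz0 z uz1.
have y0 : 0 < complex.Im z0 by apply/upperE.
have y1 : 0 < complex.Im z by apply/upperE.
set y := complex.Im z0 in y0.
pose w n : C := z0 + (n%:R * (y / 2))%:C * 'i%C.
have Imw n : complex.Im (w n) = y + n%:R * (y / 2).
  by rewrite /w /y; case: (z0) => a b /=; rewrite mulr1 mul0r addr0.
have Rew n : complex.Re (w n) = complex.Re z0.
  by rewrite /w; case: (z0) => a b /=; rewrite mulr0 mul0r subr0 addr0.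
have ny n : 0 <= n%:R * (y / 2) by rewrite mulr_ge0// divr_ge0// ltW.
have uw n : upper (w n) by apply/upperE; rewrite Imw ltr_wpDr.
have fw n : forall v, rnorm (v - w n) < complex.Im (w n) -> f v = 0.
  elim: n => [|n IH].
    rewrite Imw mul0r addr0 /w mul0r mul0r addr0.
    exact: (taylor_upper_disc tf uz r0 fz0).
  apply: (@taylor_upper_disc _ _ (y / 2) tf (uw _)); first by rewrite divr_gt0.
  move=> v vw; apply: IH; apply: le_lt_trans (rdistD (w n.+1) _ _) _.
  have -> : rnorm (w n.+1 - w n) = y / 2.
    rewrite (_ : w n.+1 - w n = (y / 2)%:C * 'i%C).
      by rewrite rnormM rnorm_i mulr1 rnorm_real ger0_norm// divr_ge0// ltW.
    rewrite /w opprD addrACA subrr add0r -mulrBl -rcN -rcD -mulrBl -natr1.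
    by rewrite addrAC subrr add0r mul1r.
  have := ny n; rewrite Imw; move: vw; lra.
(* |z - w n| < Im (w n) amounts to c < 2 Im z Im (w n), so n is chosen to make the right side
   large. *)
pose c := (complex.Re z - complex.Re z0) ^+ 2 + complex.Im z ^+ 2.
have [n hn] : exists n : nat, c < y / 2 * 2 * complex.Im z * n%:R.
  have p : 0 < y / 2 * 2 * complex.Im z by rewrite !mulr_gt0// invr_gt0.
  exists (Num.truncn (c / (y / 2 * 2 * complex.Im z))).+1.
  by rewrite mulrC -ltr_pdivrMr// truncnS_gt.
apply: (fw n); rewrite -(@ltr_pXn2r _ 2)// ?nnegrE ?rnorm_ge0 ?Imw ?addr_ge0 ?(ltW y0)//.
rewrite rnorm_sqr ReD ReN Rew (_ : complex.Im (z - w n) = complex.Im z - complex.Im (w n)).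
  by rewrite Imw; move: hn; rewrite /c; have := ny n; nra.
by case: (z); case: (w n).
Qed.

End Identity.

(** * Compressed resolvents: continuity, Taylor expansion and kernels *)

Section ModelProperties.
Variable R : realType.
Local Notation C := R[i].
Local Open Scope sesquilinear_scope.
Variable d : nat.

Lemma sum_delta (u : 'cV[C]_d) : u = \sum_j u j 0 *: delta_mx j 0.
Proof.
by rewrite [LHS]matrix_sum_delta; apply: eq_bigr => j _; rewrite big_ord1.
Qed.

Lemma sesquilinear_mxE (b : 'cV[C]_d -> 'cV[C]_d -> C) :
  (forall a u u' v, b (a *: u + u') v = a * b u v + b u' v) ->
  (forall a u v v', b u (a *: v + v') = a^* * b u v + b u v') ->
  forall u v,
  cdot ((\matrix_(i, j) b (delta_mx j 0) (delta_mx i 0)) *m u) v = b u v.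
Proof.
move=> bl br u v.
have b0l w : b 0 w = 0.
  by have := bl (-1) 0 0 w; rewrite scaleN1r oppr0 addr0 mulN1r addNr.
have b0r w : b w 0 = 0.
  have := br (-1) w 0 0.
  by rewrite scaleN1r oppr0 addr0 rmorphN1 mulN1r addNr.
have bsl w : b u w = \sum_j u j 0 * b (delta_mx j 0) w.
  rewrite {1}(sum_delta u); elim: (index_enum _) => [|j r IH].
    by rewrite !big_nil.
  by rewrite !big_cons bl IH.
have -> : b u v = \sum_i (v i 0)^* * b u (delta_mx i 0).
  rewrite {1}(sum_delta v); elim: (index_enum _) => [|j r IH].
    by rewrite !big_nil.
  by rewrite !big_cons br IH.
apply: eq_bigr => i _; rewrite mxE mulrC; congr (_ * _); rewrite bsl.
by apply: eq_bigr => j _; rewrite mxE mulrC.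
Qed.

Section Family.
Variables (H : completeNormedModType C) (ip : {dot H for conjC}).
Variable G : C -> {linear H -> H}.
Hypotheses (ipn : norm_of_dot ip) (GP : resolvent_family ip G).

Let Gr z w x : nonreal z -> nonreal w ->
  G z x - G w x = (z - w) *: G z (G w x).
Proof. exact: (proj1 GP). Qed.

Let Ga z x y : nonreal z -> ip (G z x) y = ip x (G z^* y).
Proof. exact: (proj2 GP). Qed.

Lemma family_cvg z x y : nonreal z ->
  ip (G w x) y @[w --> (z : (C : numFieldType))] --> ip (G z x) y.
Proof.
move=> nz; apply: cvg_rnormP => e e0.
have y0 : 0 < `|complex.Im z| by rewrite normr_gt0; apply/nonrealE.
set b := `|_| in y0.
(* Where |Im w| > b / 2, the vector G w (G z x) has norm at most 2 / b^2 |x|; the summand 1 keeps K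
   positive. *)
pose K := 2 / b ^+ 2 * (rnorm x * rnorm y) + 1.
have K0 : 0 < K.
  by rewrite ltr_wpDl// !mulr_ge0 ?rnorm_ge0// invr_ge0 exprn_ge0// ltW.
exists (Num.min (b / 2) (e / K)); first by rewrite lt_min !divr_gt0.
move=> w; rewrite lt_min => /andP[w1 w2].
have bw : b / 2 < `|complex.Im w|.
  have h := rnormIm (w - z); have h2 := ler_normD (complex.Im w) (- complex.Im (w - z)).
  have E : complex.Im w - complex.Im (w - z) = complex.Im z.
    by case: (w) => ? ?; case: (z) => ? ? /=; lra.
  rewrite E normrN -/b in h2; have : b / 2 + b / 2 = b by rewrite -splitr.
  by move: h w1 h2; lra.
have nw : nonreal w.
  by apply/nonrealE; rewrite -normr_gt0 (lt_trans _ bw)// divr_gt0.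
rewrite -ipBl Gr// ipZl rnormM.
have h1 := resolvent_family_le ipn (G z x) GP nw.
have h2 := resolvent_family_le ipn x GP nz; rewrite -/b in h2.
have h3 := cauchy_schwarz ipn (G w (G z x)) y.
have h4 : rnorm (G w (G z x)) <= 2 / b ^+ 2 * rnorm x.
  rewrite -ler_pdivrMl ?divr_gt0 ?exprn_gt0// invf_div.
  apply: le_trans h2; rewrite expr2 -2!mulrA ler_pM2l// mulrA.
  by apply: le_trans h1; rewrite ler_wpM2r ?rnorm_ge0// ltW.
have h5 : rnorm (ip (G w (G z x)) y) <= K.
  apply: le_trans h3 _; apply: ler_wpDr => //; rewrite mulrA.
  by rewrite ler_wpM2r ?rnorm_ge0.
have : rnorm (w - z) * K < e by rewrite -ltr_pdivlMr.
apply: le_lt_trans; rewrite ler_wpM2l ?rnorm_ge0//.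
Qed.

(** Iterating the resolvent identity gives the coefficients (G z0)^(k+1) and the remainder (z -
    z0)^n G z (G z0)^n. The bound 1 / Im z on G z, with Im z >= Im z0 - |z - z0|, is the source of
    the left factor in [taylor_upper]. *)
Lemma family_taylor x y : taylor_upper (fun z => ip (G z x) y).
Proof.
move=> z0 u0; have n0 := upper_nonreal u0.
have y0 : 0 < complex.Im z0 by apply/upperE.
pose a k := ip (iter k.+1 (G z0) x) y.
exists a, (rnorm x * rnorm y) => n z zz0.
have Imz : complex.Im z0 - rnorm (z - z0) <= complex.Im z.
  have := rnormIm (z0 - z); rewrite rdistC.
  rewrite (_ : complex.Im (z0 - z) = complex.Im z0 - complex.Im z); last first.
    by case: (z0); case: (z).
  by have := ler_norm (complex.Im z0 - complex.Im z); lra.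
have z1 : 0 < complex.Im z by apply: lt_le_trans Imz; rewrite subr_gt0.
have nz : nonreal z by apply/upper_nonreal/upperE.
have E : ip (G z x) y - \sum_(k < n) a k * (z - z0) ^+ k =
    (z - z0) ^+ n * ip (G z (iter n (G z0) x)) y.
  elim: n => [|n IH]; first by rewrite big_ord0 subr0 mul1r.
  rewrite big_ord_recr/= opprD addrA IH exprSr -mulrA -[(z - z0) * _]ipZl -Gr// ipBl /a/=.
  by rewrite mulrBr; congr (_ - _); rewrite mulrC.
have itn m : complex.Im z0 ^+ m * rnorm (iter m (G z0) x) <= rnorm x.
  elim: m => [|m IH]; first by rewrite mul1r.
  apply: le_trans IH; rewrite exprSr -mulrA ler_wpM2l ?exprn_ge0 ?(ltW y0)//.
  have := resolvent_family_le ipn (iter m (G z0) x) GP n0.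
  by rewrite gtr0_norm.
rewrite E rnormM rnormX.
have h1 := resolvent_family_le ipn (iter n (G z0) x) GP nz.
rewrite gtr0_norm// in h1.
have h2 := cauchy_schwarz ipn (G z (iter n (G z0) x)) y.
rewrite expr_div_n mulrCA [leRHS]mulrCA ler_wpM2l ?exprn_ge0 ?rnorm_ge0//.
rewrite ler_pdivlMr ?exprn_gt0//.
apply: (@le_trans _ _ (rnorm (iter n (G z0) x) * rnorm y * complex.Im z0 ^+ n)).
  rewrite ler_wpM2r ?exprn_ge0 ?(ltW y0)//.
  apply: (@le_trans _ _ (complex.Im z * (rnorm (G z (iter n (G z0) x)) * rnorm y))).
    by apply: ler_pM => //; rewrite ?subr_ge0 ?(ltW zz0) ?rnorm_ge0.
  by rewrite mulrA ler_wpM2r ?rnorm_ge0.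
by rewrite mulrAC ler_wpM2r ?rnorm_ge0// mulrC.
Qed.

Section Compression.
Variable J : {linear 'cV[C]_d -> H}.
Hypothesis JJ : forall u v, ip (J u) (J v) = cdot u v.

Definition compression (z : C) : 'M[C]_d :=
  \matrix_(i, j) ip (G z (J (delta_mx j 0))) (J (delta_mx i 0)).

Lemma compressionE z u v : cdot (compression z *m u) v = ip (G z (J u)) (J v).
Proof.
by apply: (sesquilinear_mxE (b := fun u v => ip (G z (J u)) (J v))) => *;
  rewrite !linearP ?ipDl ?ipZl ?ipDr ?ipZr.
Qed.

(** J^+ G z (1 - J J^+) G w J. With w in place of its conjugate the formula also covers z = w, where
    it yields the derivative. *)
Definition gap_kernel (z w : C) : 'M[C]_d :=
  (\matrix_(i, j) ip (G z (G w (J (delta_mx j 0)))) (J (delta_mx i 0))) -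
  compression z *m compression w.

Lemma gap_kernelE z w u v : cdot (gap_kernel z w *m u) v =
  ip (G z (G w (J u))) (J v) - cdot (compression z *m (compression w *m u)) v.
Proof.
rewrite /gap_kernel mulmxBl cdotBl mulmxA; congr (_ - _).
by apply: (sesquilinear_mxE (b := fun u v => ip (G z (G w (J u))) (J v))) => *;
  rewrite !linearP ?ipDl ?ipZl ?ipDr ?ipZr.
Qed.

Lemma compression_adj z : nonreal z -> compression z^* = (compression z) ^t*.
Proof.
move=> nz; apply: mx_cdot_ext => u v; rewrite compressionE.
rewrite Ga ?conjCK; last exact: nonrealJ.
by rewrite [RHS]cdotC -cdot_adjmx compressionE -ipC.
Qed.

Lemma gap_kernel_eq z w : nonreal z -> nonreal w ->
  compression z - compression w =
  (z - w) *: (gap_kernel z w + compression z *m compression w).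
Proof.
move=> nz nw; apply: mx_cdot_ext => u v.
rewrite mulmxBl cdotBl !compressionE -ipBl Gr// ipZl -scalemxAl cdotZl.
by rewrite mulmxDl cdotDl gap_kernelE -mulmxA subrK.
Qed.

Lemma gap_kernel_ge0 :
  nonneg_kernel (@nonreal R) (fun w z => gap_kernel z w^*).
Proof.
move=> n z u nz.
pose g := \sum_i G (z i)^* (J (u i)); pose q := \sum_i compression (z i)^* *m u i.
have qg v : cdot q v = ip g (J v).
  by rewrite cdot_suml ip_suml; apply: eq_bigr => i _; rewrite compressionE.
have -> : \sum_i \sum_j cdot (gap_kernel (z i) (z j)^* *m u j) (u i) =
    ip g g - cdot q q.
  under eq_bigr do under eq_bigr do rewrite gap_kernelE.
  under eq_bigr do rewrite big_split/=.
  rewrite big_split/= ip_sumr cdot_sumr; congr (_ + _).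
    apply: eq_bigr => i _; rewrite ip_suml; apply: eq_bigr => j _.
    by rewrite Ga.
  rewrite -sumrN; apply: eq_bigr => i _; rewrite cdot_suml -sumrN.
  apply: eq_bigr => j _; congr (- _).
  by rewrite cdot_adjmx -compression_adj.
(* J q is the projection of g onto the range of J, so the form is the squared norm of the orthogonal
   component. *)
have -> : ip g g - cdot q q = ip (g - J q) (g - J q).
  rewrite ipBl !ipBr JJ -qg (ipC ip (J q)) -qg -cdotC; ring.
exact: ip_ge0.
Qed.

Lemma compression_cvg z i j : nonreal z ->
  compression w i j @[w --> (z : (C : numFieldType))] -->
    (compression z i j : (C : numFieldType)).
Proof.
move=> nz; rewrite mxE.
rewrite (_ : (fun w => _) = fun w => ip (G w (J (delta_mx j 0))) (J (delta_mx i 0))).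
  exact: family_cvg.
by apply/funext => w; rewrite mxE.
Qed.

Lemma gap_kernel_cvg z w i j : nonreal z ->
  gap_kernel v w i j @[v --> (z : (C : numFieldType))] -->
    (gap_kernel z w i j : (C : numFieldType)).
Proof.
move=> nz; pose LA := continuous_local_algebra (z : (C : numFieldType)).
apply: (la_mxB LA); last first.
  by apply: (la_mxM LA) => [k l|k l]; [exact: compression_cvg|exact: la_cst LA _].
move=> k l; rewrite mxE.
rewrite (_ : (fun v => _) = fun v => ip (G v (G w (J (delta_mx l 0)))) (J (delta_mx k 0))).
  exact: family_cvg.
by apply/funext => v; rewrite mxE.
Qed.

Lemma compression_taylor u v : taylor_upper (fun z => cdot (compression z *m u) v).
Proof.
rewrite (_ : (fun z => _) = fun z => ip (G z (J u)) (J v)).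
  exact: family_taylor.
by apply/funext => z; rewrite compressionE.
Qed.

End Compression.
End Family.

Lemma has_model_compression (Om : set C) (Q : C -> 'M[C]_d) : has_model Om Q ->
  exists (H : completeNormedModType C) (ip : {dot H for conjC})
    (J : {linear 'cV[C]_d -> H}) (G : C -> {linear H -> H}),
  [/\ norm_of_dot ip, resolvent_family ip G,
      forall u v, ip (J u) (J v) = cdot u v
    & forall z, Om z -> Q z = compression ip G J z].
Proof.
move=> [H [ip [J [G [ipn GP JJ QE]]]]]; exists H, ip, J, G; split=> // z Oz.
by apply: mx_cdot_ext => u v; rewrite compressionE QE.
Qed.

Lemma taylor_upperB f g : taylor_upper f -> taylor_upper g ->
  taylor_upper (fun z : C => f z - g z).
Proof.
move=> tf tg z0 u0; have [a [M ha]] := tf _ u0; have [b [N hb]] := tg _ u0.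
exists (fun k => a k - b k), (M + N) => n z zz.
have h1 := ha n z zz; have h2 := hb n z zz.
have -> : f z - g z - \sum_(k < n) (a k - b k) * (z - z0) ^+ k =
  (f z - \sum_(k < n) a k * (z - z0) ^+ k) -
  (g z - \sum_(k < n) b k * (z - z0) ^+ k).
  under eq_bigr do rewrite mulrBl.
  by rewrite sumrB; ring.
have h3 := lerD h1 h2; rewrite [leRHS]mulrDl.
apply: le_trans _ h3.
by rewrite -mulrDr ler_wpM2l ?rnormB// subr_ge0 ltW.
Qed.

(** The Taylor argument gives the upper half-plane; the lower one follows from Q(conj z) = Q(z)^+,
    which every model satisfies. *)
Lemma model_identity (Q Q' : C -> 'M[C]_d) z0 (r : R) :
  has_model (@nonreal R) Q -> has_model (@nonreal R) Q' -> upper z0 -> 0 < r ->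
  (forall z, upper z -> rnorm (z - z0) < r -> Q z = Q' z) -> eq_nonreal Q Q'.
Proof.
move=> /has_model_compression[H [ip [J [G [ipn GP JJ QE]]]]].
move=> /has_model_compression[H' [ip' [J' [G' [ipn' GP' JJ' QE']]]]] u0 r0 h.
have up z : upper z -> Q z = Q' z.
  move=> uz; have nz := upper_nonreal uz; rewrite QE// QE'//.
  apply: mx_cdot_ext => u v; apply/subr0_eq.
  pose f z := cdot (compression ip G J z *m u) v -
              cdot (compression ip' G' J' z *m u) v.
  have y0 : 0 < complex.Im z0 by apply/upperE.
  apply: (@taylor_upper_eq0 _ f z0 (Num.min r (complex.Im z0))) => //.
  - by apply: taylor_upperB; exact: compression_taylor.
  - by rewrite lt_min r0.
  - move=> w; rewrite lt_min => /andP[w1 w2].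
    have uw : upper w.
      apply/upperE; have := rnormIm (z0 - w); rewrite rdistC.
      rewrite (_ : complex.Im (z0 - w) = complex.Im z0 - complex.Im w); last first.
        by case: (z0); case: (w).
      by have := ler_norm (complex.Im z0 - complex.Im w); move: w2; lra.
    have := h w uw w1; rewrite QE ?QE'//; try exact: upper_nonreal.
    by rewrite /f => ->; rewrite subrr.
move=> z nz; have [uz|uz] := nonreal_upper nz; first exact: up.
have nJ := nonrealJ nz; have := up _ uz; rewrite !QE// !QE'// -[z]conjCK.
rewrite (compression_adj GP J nJ) (compression_adj GP' J' nJ).
by rewrite conjCK => ->.
Qed.

End ModelProperties.

(** * Nevanlinna pairs *)

(* Matrix ring identities are proved over an abstract field: on concrete entries
   in R[i] the same normalization unfolds the complex numbers. *)
Ltac mx_ring :=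
  do 2! (rewrite ?(mulmxDl, mulmxDr, mulmxBl, mulmxBr, mul1mx, mulmx1, mulNmx,
    mulmxN, mulmxA); rewrite -?(scalemxAl, scalemxAr));
  rewrite ?mulmxA;
  repeat match goal with |- context [@mulmx ?R ?m ?n ?p ?A ?B] =>
    let t := fresh in set t := (A *m B); clearbody t end;
  apply/matrixP => ? ?; rewrite ?mxE; ring.

Section FractionGap.
Variables (K : fieldType) (d : nat) (z w : K).
Implicit Types A B P Q : 'M[K]_d.

(** For pairs normalised by p - z q = 1 the left side is the numerator of the pair kernel; the right
    side, divided by z - w, has the form of the resolvent kernel. *)
Lemma fraction_gap P Q :
  P *m (1%:M + w *: Q) - (1%:M + z *: P) *m Q = P - Q - (z - w) *: (P *m Q).
Proof. by mx_ring. Qed.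

Lemma fraction_gap_congr A B P Q :
  A *m P *m ((1%:M + w *: Q) *m B) - A *m (1%:M + z *: P) *m (Q *m B) =
  A *m (P - Q - (z - w) *: (P *m Q)) *m B.
Proof. by rewrite -fraction_gap mulmxBr mulmxBl !mulmxA. Qed.

End FractionGap.

Section Models.
Variable R : realType.
Local Notation C := R[i].
Local Notation CF := (R[i] : numFieldType).
Local Open Scope sesquilinear_scope.
Variable d : nat.

Lemma model_extension (Om : set C) (Q : C -> 'M[C]_d) : has_model Om Q ->
  exists Q', has_model (@nonreal R) Q' /\ forall z, Om z -> Q' z = Q z.
Proof.
move=> /has_model_compression[H [ip [J [G [ipn GP JJ QE]]]]].
exists (compression ip G J); split; last by move=> z /QE.
by exists H, ip, J, G; split=> // z _ u v; rewrite compressionE.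
Qed.

(** The divided difference of Q in a form free of the Hilbert space: the product Q z Q w is split
    off so that the remainder P is nonnegative. *)
Lemma model_gap (Q : C -> 'M[C]_d) : has_model (@nonreal R) Q ->
  exists P : C -> C -> 'M[C]_d,
  [/\ forall z w, nonreal z -> nonreal w ->
        Q z - Q w = (z - w) *: (P z w + Q z *m Q w),
      nonneg_kernel (@nonreal R) (fun w z => P z w^*)
    & forall z w i j, nonreal z -> nonreal w ->
        P v w i j @[v --> (z : CF)] --> (P z w i j : CF)].
Proof.
move=> /has_model_compression[H [ip [J [G [ipn GP JJ QE]]]]].
exists (gap_kernel ip G J); split.
- by move=> z w nz nw; rewrite !QE// -gap_kernel_eq.
- exact: gap_kernel_ge0.
- by move=> z w i j nz nw; exact: gap_kernel_cvg.
Qed.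

Lemma model_adj (Q : C -> 'M[C]_d) : has_model (@nonreal R) Q ->
  forall z, nonreal z -> Q z^* = (Q z) ^t*.
Proof.
move=> /has_model_compression[H [ip [J [G [ipn GP JJ QE]]]]] z nz.
by rewrite !QE//; [exact: compression_adj|exact: nonrealJ].
Qed.

Lemma model_cvg (Q : C -> 'M[C]_d) : has_model (@nonreal R) Q ->
  forall (z : C) i j, nonreal z -> Q v i j @[v --> (z : CF)] --> (Q z i j : CF).
Proof.
move=> /has_model_compression[H [ip [J [G [ipn GP JJ QE]]]]] z i j nz.
rewrite (QE z nz); have h := compression_cvg (J := J) (i := i) (j := j) ipn GP nz.
have E : \forall w \near (z : CF), compression ip G J w i j = Q w i j.
  by apply: filterS (near_nonreal nz) => w nw; rewrite QE.
exact: cvg_trans (near_eq_cvg E) h.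
Qed.

Lemma model_holomorphic (Q : C -> 'M[C]_d) : has_model (@nonreal R) Q ->
  holomorphic_mx Q.
Proof.
move=> mQ i j z nz; have [P [PE _ Pc]] := model_gap mQ.
pose T w : C := (P w z + Q w *m Q z) i j.
apply: (proj1 (@difference_quotient CF (fun w => Q w i j) T z _ _)).
  apply: filterS (near_nonreal nz) => w nw; rewrite /T.
  by have /matrixP/(_ i j) := PE w z nw nz; rewrite !mxE.
pose LA := continuous_local_algebra (z : CF).
apply: (la_mxD LA) => [k l|]; first exact: Pc.
by apply: (la_mxM LA) => [k l|k l]; [exact: model_cvg|exact: la_cst LA _].
Qed.

Lemma nonneg_kernel_congr (Om : set C) (k : C -> C -> 'M[C]_d) (A : C -> 'M[C]_d) :
  nonneg_kernel Om k ->
  nonneg_kernel Om (fun w z => A z *m k w z *m (A w) ^t*).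
Proof.
move=> k0 n z u Oz; have := k0 n z (fun i => (A (z i)) ^t* *m u i) Oz.
congr (_ <= _); apply: eq_bigr => i _; apply: eq_bigr => j _.
by rewrite -cdot_adjmx !mulmxA.
Qed.

Lemma nonneg_kernel_eq (Om : set C) (k k' : C -> C -> 'M[C]_d) :
  (forall w z, Om w -> Om z -> k w z = k' w z) ->
  nonneg_kernel Om k -> nonneg_kernel Om k'.
Proof.
move=> kk k0 n z u Oz; have := k0 n z u Oz; congr (_ <= _).
by apply: eq_bigr => i _; apply: eq_bigr => j _; rewrite kk.
Qed.

Definition pair_fraction (pq : mxpair R d) (z : C) : 'M[C]_d :=
  pq.2 z *m invmx (pq.1 z - z *: pq.2 z).

Lemma pair_fractionE pq z : nevanlinna_pair pq -> nonreal z ->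
  let chi := pq.1 z - z *: pq.2 z in
  pq.1 z = (1%:M + z *: pair_fraction pq z) *m chi /\
  pq.2 z = pair_fraction pq z *m chi.
Proof.
case: pq => p q [_ _ _ u] nz /=; rewrite /pair_fraction/=.
have e : q z *m invmx (p z - z *: q z) *m (p z - z *: q z) = q z by rewrite mulmxKV ?u.
by rewrite e; split=> //; rewrite mulmxDl mul1mx -scalemxAl e subrK.
Qed.

Lemma pair_fraction_adj pq z : nevanlinna_pair pq -> nonreal z ->
  pair_fraction pq z^* = (pair_fraction pq z) ^t*.
Proof.
move=> npq nz; have nzJ := nonrealJ nz.
have [p1 q1] := pair_fractionE npq nz; have [p2 q2] := pair_fractionE npq nzJ.
case: pq npq p1 q1 p2 q2 => p q npq /= p1 q1 p2 q2; have [_ _ sym u] := npq.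
have u1 := u z nz; have u2 := u _ nzJ.
move: (p z - z *: q z) (p z^* - z^* *: q z^*) u1 u2 p1 q1 p2 q2 => c c' u1 u2.
move: (pair_fraction (p, q) z) (pair_fraction (p, q) z^*) => Q Q' p1 q1 p2 q2.
have := sym z nz; rewrite p1 q1 p2 q2 !adjmxM adjmxD adjmx1 adjmxZ conjCK.
rewrite fraction_gap_congr subrr scale0r subr0 => h0.
have u1' : c' ^t* \in unitmx by rewrite adjmx_unit.
suff : Q' ^t* - Q = 0 by move=> /subr0_eq <-; rewrite adjmxK.
by rewrite -[LHS](mulKmx u1') -[X in _ *m X](mulmxK u1) h0 mul0mx mulmx0.
Qed.

(** Congruence by the inverse of p - z q carries the pair kernel into the resolvent kernel of Q.
    Nonnegativity is given on the upper half-plane, so the dilation starts there, and the symmetry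
    of the pair settles the lower half-plane. *)
Lemma pair_fraction_model pq : nevanlinna_pair pq ->
  has_model (@nonreal R) (pair_fraction pq).
Proof.
move=> npq; pose Q := pair_fraction pq.
have /resolvent_model M : nonneg_kernel (@upper R) (resolvent_kernel Q).
  pose A z := (invmx (pq.1 z^* - z^* *: pq.2 z^*)) ^t*.
  have h : nonneg_kernel (@upper R) (pair_kernel pq) by case: (pq) npq => p q [].
  apply: nonneg_kernel_eq (nonneg_kernel_congr A h) => w z uw uz.
  have nz := upper_nonreal uz; have nw := upper_nonreal uw.
  have nzJ := nonrealJ nz; have nwJ := nonrealJ nw.
  have [p1 q1] := pair_fractionE npq nwJ; have [p2 q2] := pair_fractionE npq nzJ.
  have Qz : (pair_fraction pq z^*) ^t* = Q z by rewrite -pair_fraction_adj ?conjCK.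
  have Qw : pair_fraction pq w^* = (Q w) ^t* by rewrite pair_fraction_adj.
  have uz' : pq.1 z^* - z^* *: pq.2 z^* \in unitmx by case: (pq) npq => p q [_ _ _]; exact.
  have uw' : pq.1 w^* - w^* *: pq.2 w^* \in unitmx by case: (pq) npq => p q [_ _ _]; exact.
  have -> : pair_kernel pq w z = (z - w^*)^-1 *:
      ((pq.2 z^*) ^t* *m pq.1 w^* - (pq.1 z^*) ^t* *m pq.2 w^*) by case: (pq).
  rewrite /A adjmxK; move: (pq.1 z^* - _) (pq.1 w^* - _) uz' uw' p1 q1 p2 q2 => c c'.
  rewrite Qw /resolvent_kernel; move: (pair_fraction pq z^*) (Q z) (Q w) Qz.
  move=> Q1 Q2 Q3 Qz uc uc' -> -> -> ->.
  rewrite !adjmxM Qz adjmxD adjmx1 adjmxZ conjCK Qz.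
  rewrite fraction_gap_congr.
  set K := Q2 - _ - _; rewrite adjmx_inv -scalemxAr -scalemxAl -(mulmxA _ K).
  rewrite mulKmx ?adjmx_unit// mulmxK// scalerBr scalerA mulVf ?scale1r//.
  exact: upper_subJ.
have i0 : @upper R !=set0 by exists 'i%C; apply/upperE; rewrite /= ltr01.
have [Q' [mQ' Q'E]] := model_extension (M (fun z uz => uz) i0).
have QQ z : nonreal z -> Q z = Q' z.
  move=> nz; have [uz|uz] := nonreal_upper nz; first by rewrite Q'E.
  rewrite -[z]conjCK (model_adj mQ')// ?Q'E//; last exact: nonrealJ.
  by rewrite /Q pair_fraction_adj//; exact: nonrealJ.
have [H [ip [J [G [ipn GP JJ QE]]]]] := mQ'.
by exists H, ip, J, G; split=> // z nz u v; rewrite QE// -QQ.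
Qed.

Lemma model_pair (Q : C -> 'M[C]_d) : has_model (@nonreal R) Q ->
  let pq := (fun z => 1%:M + z *: Q z, Q) in
  nevanlinna_pair pq /\ forall z, pair_fraction pq z = Q z.
Proof.
move=> mQ pq; have Qadj := model_adj mQ.
have chi1 z : pq.1 z - z *: pq.2 z = 1%:M by rewrite /= addrK.
split; last by move=> z; rewrite /pair_fraction chi1 invmx1 mulmx1.
have [P [PE P0 _]] := model_gap mQ.
split=> //.
- split; last exact: model_holomorphic.
  move=> i j z nz; pose LA := derivable_local_algebra (z : CF).
  apply: (la_mxD LA) => [k l|]; first exact: la_cst LA _.
  by apply: (la_mxZ LA) => [|k l]; [exact: la_id LA|exact: model_holomorphic].
- have h : nonneg_kernel (@upper R) (fun w z => P z w^*).
    by move=> n z u uz; apply: P0 => i; exact: upper_nonreal.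
  apply: nonneg_kernel_eq h => w z uw uz; rewrite /pair_kernel /=.
  have nz := upper_nonreal uz; have nw := upper_nonreal uw.
  have nwJ := nonrealJ nw.
  rewrite (Qadj z nz) adjmxK adjmxD adjmx1 adjmxZ conjCK Qadj// adjmxK -Qadj//.
  rewrite fraction_gap.
  rewrite PE// (scalerDr _ (P _ _)) addrK scalerA mulVf ?scale1r//.
  exact: upper_subJ.
- move=> z nz; rewrite adjmxD adjmx1 adjmxZ conjCK Qadj// adjmxK.
  by rewrite fraction_gap !subrr scale0r subr0.
- by move=> z nz; rewrite chi1 unitmx1.
Qed.

End Models.

(** * The linear fractional transformation *)

Section SelfAdjoint.
Variable R : realType.
Local Notation C := R[i].
Local Notation "x %:C" := (real_complex R x).
Local Open Scope sesquilinear_scope.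
Variables (H : completeNormedModType C) (ip : {dot H for conjC}).
Hypothesis ipn : norm_of_dot ip.
Variables (A : {linear H -> H}) (M : R).
Hypotheses (AM : forall x, rnorm (A x) <= M * rnorm x).
Hypothesis Asa : forall x y, ip (A x) y = ip x (A y).

Lemma selfadjoint_resolvent : exists G : C -> {linear H -> H},
  resolvent_family ip G /\
  forall z x, nonreal z ->
    A (G z x) - z *: G z x = x /\ G z (A x - z *: x) = x.
Proof.
have /choice[G GE] z : exists S : {linear H -> H}, nonreal z ->
    forall x, A (S x) - z *: S x = x /\ S (A x - z *: x) = x.
  have [nz|nz] := pselect (nonreal z); last first.
    by exists (to_linear (fun a x y => erefl : idfun _ = _)).
  (* Multiplied by i Im z, the operator A - z becomes coercive: A is symmetric, so the real part of
     the form is (Im z)^2 |x|^2. *)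
  pose b := complex.Im z; pose c : C := 'i%C * b%:C.
  have b0 : b != 0 by apply/nonrealE.
  have c0 : c != 0.
    by rewrite mulf_eq0 !eq_complex/= (negPf b0) oner_eq0 andbF.
  have Tl : linear (fun x => c *: (A x - z *: x)).
    move=> a x y; rewrite (linearP A) (scalerDr z) opprD addrACA [LHS]scalerDr.
    congr (_ + _).
    by rewrite (scalerA z a x) (mulrC z) -(scalerA a z) -scalerBr !scalerA mulrC.
  pose T := to_linear Tl.
  have Tc x : b ^+ 2 * rnorm x ^+ 2 <= complex.Re (ip (T x) x).
    rewrite ipZl ipBl ipZl (ipxx ipn).
    have : complex.Im (ip (A x) x) = 0.
      have := congr1 (@complex.Im R) (ipC ip (A x) x); rewrite Asa ImJ; lra.
    rewrite /c /b; case: (ip (A x) x) => r s /= ->; case: (z) => a e /=.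
    by rewrite le_eqVlt; apply/orP; left; apply/eqP; ring.
  have TM x : rnorm (T x) <= rnorm c * (M + rnorm z) * rnorm x.
    rewrite rnormZ -mulrA ler_wpM2l ?rnorm_ge0// mulrDl.
    by apply: le_trans (rnormB _ _) _; rewrite rnormZ lerD2r.
  have b2 : 0 < b ^+ 2 by rewrite lt_neqAle eq_sym sqrf_eq0 b0 sqr_ge0.
  have [S [ST TS]] := linear_inverse (coercive_surj ipn b2 TM Tc) (coercive_inj b2 Tc).
  have Sl : linear (fun x => S (c *: x)).
    by move=> a x y; rewrite scalerDr !scalerA mulrC -scalerA linearP.
  exists (to_linear Sl) => _ x; split => /=.
    by apply: (scalerI c0); exact: ST.
  exact: TS.
exists G; split; last by move=> z x nz; exact: GE.
split=> [z w x nz nw|z x y nz].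
  have h1 := (GE w nw x).1; set g := G w x in h1 *.
  have e1 : G z x - g = G z ((A g - w *: g) - (A g - z *: g)).
    by rewrite (linearB (G z)) h1 (GE z nz g).2.
  have e2 : (A g - w *: g) - (A g - z *: g) = (z - w) *: g.
    by rewrite opprB addrC addrA subrK -scalerBl.
  by rewrite e1 e2 linearZ.
have nzJ := nonrealJ nz.
rewrite -{1}[y](GE _ nzJ y).1 -{2}[x](GE z nz x).1.
by rewrite ipBr ipBl ipZr ipZl conjCK Asa.
Qed.

End SelfAdjoint.

(** * Resolvents in the form (1 - z A)^-1 and their transfer matrices *)

Section Transfer.
Variable R : realType.
Local Notation C := R[i].
Local Notation CF := (R[i] : numFieldType).
Local Open Scope sesquilinear_scope.
Variables (H : completeNormedModType C) (ip : {dot H for conjC}).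
Hypothesis ipn : norm_of_dot ip.

(* The resolvents [S z] of a selfadjoint operator [A] in the normalisation
   [(1 - z A)^-1]. *)
Definition selfadjoint_inverses (A : H -> H) (S : C -> {linear H -> H}) : Prop :=
  forall z, nonreal z -> [/\ forall x, S z x - z *: A (S z x) = x,
    forall x, S z (x - z *: A x) = x,
    forall w x, nonreal w -> z *: S z x - w *: S w x = (z - w) *: S z (S w x),
    forall x y, ip (S z x) y = ip x (S z^* y) &
    forall x y, ip (S w x) y @[w --> (z : CF)] --> (ip (S z x) y : CF)].

Lemma nonrealV (z : C) : nonreal z -> nonreal z^-1.
Proof.
by rewrite /nonreal/= realV.
Qed.

Lemma selfadjoint_inversesP (A : {linear H -> H}) (M : R) :
  (forall x, rnorm (A x) <= M * rnorm x) ->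
  (forall x y, ip (A x) y = ip x (A y)) ->
  exists S, selfadjoint_inverses A S.
Proof.
move=> AM Asa; have [G [Gres GE]] := selfadjoint_resolvent ipn AM Asa.
(* (1 - z A)^-1 = - z^-1 (A - z^-1)^-1. *)
have Sl z : linear (fun x => - z^-1 *: G z^-1 x).
  by move=> a x y; rewrite linearP scalerDr !scalerA mulrC.
have AZ c x : A (c *: x) = c *: A x by exact: linearZ.
have GZ z c x : G z (c *: x) = c *: G z x by exact: linearZ.
exists (fun z => to_linear (Sl z)) => z nz; have nzV := nonrealV nz.
have z0 := nonreal_neq0 nz; split=> /=.
- move=> x; rewrite AZ scalerA mulrN divff// scaleN1r opprK addrC.
  by rewrite scaleNr; exact: (GE _ x nzV).1.
- move=> x; rewrite -GZ scalerBr scalerA mulNr mulVf// scaleN1r opprK.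
  by rewrite addrC scaleNr; exact: (GE _ x nzV).2.
- move=> w x nw; have w0 := nonreal_neq0 nw; have nwV := nonrealV nw.
  rewrite GZ !scalerA !mulrN !divff// !scaleN1r opprK addrC.
  rewrite -[LHS]opprB (proj1 Gres _ _ x nzV nwV) -scaleNr; congr (_ *: _).
  by field; rewrite z0 w0.
- move=> x y; have zV : (z^*)^-1 = (z^-1)^* by rewrite fmorphV.
  by rewrite ipZl ipZr (proj2 Gres _ _ _ nzV) zV rmorphN/= conjCK.
- move=> x y; pose LA := continuous_local_algebra (z : CF).
  have Vc := laV LA (la_id LA) z0.
  have Gc : ip (G w^-1 x) y @[w --> (z : CF)] --> (ip (G z^-1 x) y : CF).
    exact: cvg_comp Vc (family_cvg (x := x) (y := y) ipn Gres nzV).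
  have h := laM LA (laM LA (la_cst LA (-1)) Vc) Gc.
  rewrite ipZl -[- z^-1]mulN1r.
  rewrite (_ : (fun w => _) = fun w => (-1 * w^-1) * ip (G w^-1 x) y)//.
  by apply/funext => w; rewrite ipZl mulN1r.
Qed.

Variables (S : C -> {linear H -> H}) (A : H -> H).
Hypothesis SP : selfadjoint_inverses A S.
Variable d : nat.
Implicit Types a b : {linear 'cV[C]_d -> H}.

(* The matrices of a^+ S(z) b and a^+ S(z) S(w) b. *)
Definition transfer a b z : 'M[C]_d :=
  \matrix_(i, j) ip (S z (b (delta_mx j 0))) (a (delta_mx i 0)).

Definition transfer2 a b z w : 'M[C]_d :=
  \matrix_(i, j) ip (S z (S w (b (delta_mx j 0)))) (a (delta_mx i 0)).

Lemma transferE a b z u v : cdot (transfer a b z *m u) v = ip (S z (b u)) (a v).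
Proof.
by apply: (sesquilinear_mxE (b := fun u v => ip (S z (b u)) (a v))) => *;
  rewrite !linearP ?ipDl ?ipZl ?ipDr ?ipZr.
Qed.

Lemma transfer2E a b z w u v :
  cdot (transfer2 a b z w *m u) v = ip (S z (S w (b u))) (a v).
Proof.
by apply: (sesquilinear_mxE (b := fun u v => ip (S z (S w (b u))) (a v))) => *;
  rewrite !linearP ?ipDl ?ipZl ?ipDr ?ipZr.
Qed.

Lemma transfer_adj a b z : nonreal z -> (transfer a b z) ^t* = transfer b a z^*.
Proof.
move=> nz; have [_ _ _ Sa _] := SP nz; apply: mx_cdot_ext => u v.
by rewrite cdotC -cdot_adjmx transferE Sa transferE -ipC.
Qed.

Lemma transfer_sub a b z w : nonreal z -> nonreal w ->
  z *: transfer a b z - w *: transfer a b w = (z - w) *: transfer2 a b z w.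
Proof.
move=> nz nw; have [_ _ Sr _ _] := SP nz; apply: mx_cdot_ext => u v.
rewrite mulmxBl cdotBl -!scalemxAl !cdotZl !transferE transfer2E.
by rewrite -!ipZl -ipBl Sr.
Qed.

Lemma transfer_cvg a b z i j : nonreal z ->
  transfer a b w i j @[w --> (z : CF)] --> (transfer a b z i j : CF).
Proof.
move=> nz; have [_ _ _ _ Sc] := SP nz; rewrite mxE.
rewrite (_ : (fun w => _) = fun w => ip (S w (b (delta_mx j 0))) (a (delta_mx i 0))).
  exact: Sc.
by apply/funext => w; rewrite mxE.
Qed.

Lemma transfer2_cvg a b z v i j : nonreal z ->
  transfer2 a b w v i j @[w --> (z : CF)] --> (transfer2 a b z v i j : CF).
Proof.
move=> nz; have [_ _ _ _ Sc] := SP nz; rewrite mxE.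
rewrite (_ : (fun w => _) = fun w => ip (S w (S v (b (delta_mx j 0)))) (a (delta_mx i 0))).
  exact: Sc.
by apply/funext => w; rewrite mxE.
Qed.

End Transfer.

(** * Matrix identities behind the kernel decompositions *)

Section MatrixIdentities.
Variables (K : fieldType) (d : nat) (z w : K).
Implicit Types A B F G P Q a b e f r : 'M[K]_d.

Lemma lft_sub_identity (a1 a2 b1 b2 c1 c2 : 'M[K]_d) F G :
  z *: a1 + (1%:M - z *: b1) *m F *m (1%:M - z *: c1) -
    (w *: a2 + (1%:M - w *: b2) *m G *m (1%:M - w *: c2)) =
  (z *: a1 - w *: a2) - (1%:M - z *: b1) *m F *m (z *: c1 - w *: c2) -
    (z *: b1 - w *: b2) *m G *m (1%:M - w *: c2) +
    (1%:M - z *: b1) *m (F - G) *m (1%:M - w *: c2).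
Proof. by mx_ring. Qed.

Lemma state_kernel_identity (c : K) e f (r11 r12 r21 r22 : 'M[K]_d) F G P :
  c *: r11 - e *m F *m (c *: r21) - c *: r12 *m G *m f +
    e *m (c *: P) *m f =
  c *: (r11 - e *m F *m r21 - r12 *m G *m f + e *m F *m r22 *m G *m f +
    e *m (P - F *m r22 *m G) *m f).
Proof. by mx_ring. Qed.

Lemma lft_gap_identity (c : K) (a1 a2 b1 b2 c1 c2 r11 r12 r21 r22 : 'M[K]_d)
    F G P :
  z *: a1 - w *: a2 = c *: r11 -> z *: b1 - w *: b2 = c *: r12 ->
  z *: c1 - w *: c2 = c *: r21 -> F - G = c *: P ->
  z *: a1 + (1%:M - z *: b1) *m F *m (1%:M - z *: c1) -
    (w *: a2 + (1%:M - w *: b2) *m G *m (1%:M - w *: c2)) =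
  c *: (r11 - (1%:M - z *: b1) *m F *m r21 - r12 *m G *m (1%:M - w *: c2) +
    (1%:M - z *: b1) *m F *m r22 *m G *m (1%:M - w *: c2) +
    (1%:M - z *: b1) *m (P - F *m r22 *m G) *m (1%:M - w *: c2)).
Proof.
move=> h1 h2 h3 h; rewrite lft_sub_identity h1 h2 h3 h.
exact: state_kernel_identity.
Qed.

Lemma pencil_com_identity Q A :
  (1%:M + z *: Q - z *: (Q *m A)) *m Q = Q *m (1%:M + z *: Q - z *: (A *m Q)).
Proof. by mx_ring. Qed.

Lemma pencil_sub_identity P Q A B :
  P *m (1%:M + w *: Q - w *: (B *m Q)) - (1%:M + z *: P - z *: (P *m A)) *m Q =
  (P - Q) - (z - w) *: (P *m Q) + P *m (z *: A - w *: B) *m Q.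
Proof. by mx_ring. Qed.

Lemma gap_identity (c : K) P Q F A :
  c *: (A + P *m Q) - c *: (P *m Q) + P *m (c *: F) *m Q =
  c *: (A + P *m F *m Q).
Proof. by mx_ring. Qed.

Lemma invmx_gap U V P Q : U \in unitmx -> V \in unitmx ->
  invmx U *m P - Q *m invmx V = invmx U *m (P *m V - U *m Q) *m invmx V
    :> 'M[K]_d.
Proof.
move=> uU uV.
by rewrite mulmxBr mulmxBl (mulmxA (invmx U) P) mulmxK// (mulKmx uU).
Qed.

Lemma copencil_identity F A :
  1%:M - z *: F + z *: (F *m A) + (z *: F - z *: (F *m A)) = 1%:M.
Proof. by rewrite addrACA subrK subrr addr0. Qed.

End MatrixIdentities.

(** * Null vectors of the denominators *)

Section PencilKernel.
Variables (R : realType) (d : nat).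
Local Notation C := R[i].
Local Open Scope sesquilinear_scope.
Implicit Types K M N P Q : 'M[C]_d.
Implicit Types (z : C) (x y : 'cV[C]_d).

Lemma pencil_adj z Q M :
  (1%:M + z *: Q - z *: (Q *m M)) ^t* =
  1%:M + z^* *: Q ^t* - z^* *: (M ^t* *m Q ^t*).
Proof. by rewrite adjmxD adjmxD adjmxN 2!adjmxZ adjmx1 adjmxM. Qed.

Lemma copencil_adj z Q M :
  (1%:M - z *: Q + z *: (Q *m M)) ^t* =
  1%:M - z^* *: Q ^t* + z^* *: (M ^t* *m Q ^t*).
Proof. by rewrite adjmxD adjmxD adjmxN 2!adjmxZ adjmx1 adjmxM. Qed.

Lemma pencil_scalar (k : fieldType) (z w a b n p s : k) : z - w != 0 ->
  z * a - w * b = (z - w) * n -> w * (b - s) - z * (a - s) = (z - w) * (p + s) ->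
  p = - n.
Proof.
move=> zw h1 h2; apply: (mulfI zw); rewrite mulrN -h1.
by rewrite -[LHS](addrK ((z - w) * s)) -mulrDr -h2; ring.
Qed.

Lemma copencil_scalar (k : fieldType) (z w a b n p s : k) : z - w != 0 ->
  z * a - w * b = (z - w) * n -> (z - w) * p = w * (s - b) - z * (s - a) ->
  p = n - s.
Proof. by move=> zw h1 h2; apply: (mulfI zw); rewrite h2 [RHS]mulrBr -h1; ring. Qed.

Variables (z : C) (M N : 'M[C]_d).
Hypotheses (zz : z - z^* != 0)
  (MN : z *: M - z^* *: M ^t* = (z - z^*) *: N).

Lemma quadratic_gap y :
  z * cdot (M *m y) y - z^* * cdot y (M *m y) = (z - z^*) * cdot (N *m y) y.
Proof.
have := congr1 (fun A => cdot (A *m y) y) MN.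
by rewrite mulmxBl cdotBl -3!scalemxAl 3!cdotZl (cdot_adjmx (M ^t*)) adjmxK.
Qed.

Lemma quadratic_im P x : cdot ((P - P ^t*) *m x) x =
  cdot x (P ^t* *m x) - cdot (P ^t* *m x) x.
Proof. by rewrite mulmxBl cdotBl cdot_adjmx. Qed.

(** The imaginary part of (Q^+ x, x) is computed twice, from the gap formula for Q and from x
    expressed by y. The comparison yields forms of opposite sign, so nonnegativity of P and N will
    force both to vanish. *)
Lemma pencil_ker Q P x :
  Q - Q ^t* = (z - z^*) *: (P + Q *m Q ^t*) ->
  (1%:M + z^* *: Q ^t* - z^* *: (M ^t* *m Q ^t*)) *m x = 0 ->
  let y := Q ^t* *m x in
  x = z^* *: (M ^t* *m y - y) /\ cdot (P *m x) x = - cdot (N *m y) y.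
Proof.
move=> QP; rewrite mulmxBl mulmxDl mul1mx -2!scalemxAl -mulmxA => hx y.
have xE : x = z^* *: (M ^t* *m y - y).
  by apply/subr0_eq; rewrite -hx scalerBr opprB addrA.
split=> //; have := quadratic_im Q x.
rewrite QP -scalemxAl cdotZl mulmxDl cdotDl -mulmxA (cdot_adjmx Q) -/y.
rewrite {3 4}xE cdotZl cdotZr conjCK cdotBl cdotBr.
rewrite -(cdot_adjmx M) (cdot_adjmx (M ^t*)) adjmxK => h.
exact: (pencil_scalar zz (quadratic_gap y) (esym h)).
Qed.

(** The same comparison for the inverse relation between Q and S; here |y|^2 comes with a negative
    sign, so nonnegativity of the reduced kernel will force y = 0 directly. *)
Lemma copencil_ker Q K x :
  Q - Q ^t* = (z - z^*) *: K ->
  (1%:M - z^* *: Q ^t* + z^* *: (M ^t* *m Q ^t*)) *m x = 0 ->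
  let y := Q ^t* *m x in
  x = z^* *: (y - M ^t* *m y) /\ cdot ((K - Q *m N *m Q ^t*) *m x) x = - cdot y y.
Proof.
move=> QP hx y; rewrite mulmxDl mulmxBl mul1mx -2!scalemxAl -mulmxA in hx.
have xE : x = z^* *: (y - M ^t* *m y).
  by apply/subr0_eq; rewrite -hx scalerBr opprB addrA addrAC.
split=> //; have := quadratic_im Q x.
rewrite QP -scalemxAl cdotZl -/y.
rewrite {3 4}xE cdotZl cdotZr conjCK cdotBl cdotBr.
rewrite -(cdot_adjmx M) (cdot_adjmx (M ^t*)) adjmxK => h.
rewrite mulmxBl cdotBl -3!mulmxA (cdot_adjmx Q) -/y.
by rewrite (copencil_scalar zz (quadratic_gap y) h) addrAC subrr add0r.
Qed.

End PencilKernel.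

Lemma state_kernel_cdot (R : realType) (d : nat)
    (e f r11 r12 r21 r22 F G : 'M[R[i]]_d) u v :
  cdot ((r11 - e *m F *m r21 - r12 *m G *m f + e *m F *m r22 *m G *m f) *m u) v =
  cdot (r11 *m u) v - cdot (r12 *m (G *m (f *m u))) v -
    (cdot (e *m F *m (r21 *m u)) v - cdot (e *m F *m (r22 *m (G *m (f *m u)))) v).
Proof.
rewrite !mulmxDl !mulNmx !cdotDl !cdotNl -!mulmxA.
by do 4! [move: (cdot _ _) => ?]; ring.
Qed.

Lemma adjointr (R : realType) (d : nat) (H : completeNormedModType R[i])
    (ip : {dot H for conjC}) (T : H -> 'cV[R[i]]_d) (Tp : 'cV[R[i]]_d -> H) v x :
  is_adjoint ip (@cdot R d) T Tp -> ip x (Tp v) = cdot (T x) v.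
Proof. by move=> Ta; rewrite ipC Ta -cdotC. Qed.


(** * The transform in terms of S, and its state vectors *)

Section Coupling.
Variable R : realType.
Local Notation C := R[i].
Local Open Scope sesquilinear_scope.
Variables (d : nat) (H : completeNormedModType C) (ip : {dot H for conjC}).
Hypothesis ipn : norm_of_dot ip.
Variables (B : {linear H -> H}) (C1 C2 : {linear H -> 'cV[C]_d}).
Variables (C1p C2p : {linear 'cV[C]_d -> H}).
Hypotheses (C1a : is_adjoint ip (@cdot R d) C1 C1p)
  (C2a : is_adjoint ip (@cdot R d) C2 C2p).

(* The main operator of the colligation; by the Lagrange identity (A1) it is
   selfadjoint. *)
Definition main_op (x : H) : H := B x - C1p (C2 x).

Variable S0 : C -> {linear H -> H}.
Hypothesis S0P : selfadjoint_inverses ip main_op S0.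

Local Notation M11 := (transfer ip S0 C1p C1p).
Local Notation M12 := (transfer ip S0 C1p C2p).
Local Notation M21 := (transfer ip S0 C2p C1p).
Local Notation M22 := (transfer ip S0 C2p C2p).
Local Notation r11 := (transfer2 ip S0 C1p C1p).
Local Notation r12 := (transfer2 ip S0 C1p C2p).
Local Notation r21 := (transfer2 ip S0 C2p C1p).
Local Notation r22 := (transfer2 ip S0 C2p C2p).

Definition eL z : 'M[C]_d := 1%:M - z *: M12 z.
Definition eR z : 'M[C]_d := 1%:M - z *: M21 z.

Lemma eL_adj z : nonreal z -> (eL z) ^t* = eR z^*.
Proof. by move=> nz; rewrite adjmxD adjmxN adjmxZ adjmx1 (transfer_adj S0P). Qed.

Lemma eR_adj z : nonreal z -> (eR z) ^t* = eL z^*.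
Proof. by move=> nz; rewrite adjmxD adjmxN adjmxZ adjmx1 (transfer_adj S0P). Qed.

(* Theta acts on S = q (p - z M22 q)^-1 by this formula, which is free of the
   singularities of (1 - z B)^-1. *)
Definition lft (F : C -> 'M[C]_d) (z : C) : 'M[C]_d :=
  z *: M11 z + eL z *m F z *m eR z.

Definition state_kernel (F : C -> 'M[C]_d) (z w : C) : 'M[C]_d :=
  r11 z w - eL z *m F z *m r21 z w - r12 z w *m F w *m eR w +
  eL z *m F z *m r22 z w *m F w *m eR w.

(** Adding and subtracting F r22 F completes the mixed terms to the Gram kernel of the state
    vectors; what is left of K appears between eL and eR. *)
Lemma lft_gap F (K : 'M[C]_d) z w : nonreal z -> nonreal w ->
  F z - F w = (z - w) *: K ->
  lft F z - lft F w = (z - w) *: (state_kernel F z w +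
    eL z *m (K - F z *m r22 z w *m F w) *m eR w).
Proof.
move=> nz nw FK.
have t (a b : {linear 'cV[C]_d -> H}) := transfer_sub S0P a b nz nw.
exact: lft_gap_identity (t _ _) (t _ _) (t _ _) FK.
Qed.

Lemma lft_adj F z : nonreal z -> (F z) ^t* = F z^* -> (lft F z) ^t* = lft F z^*.
Proof.
move=> nz Fz; rewrite /lft adjmxD adjmxZ (transfer_adj S0P _ _ nz) !adjmxM Fz.
by rewrite (eL_adj nz) (eR_adj nz) mulmxA.
Qed.

Definition state_vector (F : C -> 'M[C]_d) (z : C) (u : 'cV[C]_d) : H :=
  S0 z^* (C1p u - C2p (F z^* *m (eR z^* *m u))).

Lemma state_kernelE F z w u v : nonreal z -> nonreal w ->
  (F z) ^t* = F z^* ->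
  cdot (state_kernel F z w^* *m u) v = ip (state_vector F w u) (state_vector F z v).
Proof.
move=> nz nw Fz; have [_ _ _ Sa _] := S0P nz.
rewrite /state_vector -Sa !linearB/= !ipBl -!transfer2E.
set sv := F z^* *m _; have svE x : cdot x sv = cdot (eL z *m F z *m x) v.
  by rewrite cdot_adjmx adjmxM (eL_adj nz) Fz -mulmxA.
rewrite !svE; exact: state_kernel_cdot.
Qed.

(** Since 1 - z B = (1 - z A) - z C1^+ C2, the resolvent in the state vector cancels. For a
    symmetric transform the result is the right side of (C1) tested against u; both directions of
    the correspondence rest on this identity. *)
Lemma state_vectorE F z u x : nonreal z ->
  ip (x - z *: B x) (state_vector F z u) =
  cdot (C1 x) u - cdot (C2 x) (lft F z^* *m u).
Proof.
move=> nz; have nzJ := nonrealJ nz; have [_ S0l _ Sa _] := S0P nz.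
set s := F z^* *m (eR z^* *m u).
have E : x - z *: B x = (x - z *: main_op x) - z *: C1p (C2 x).
  by rewrite /main_op scalerBr opprB addrA addrAC addrK.
rewrite E ipBl /state_vector -/s -Sa S0l ipZl C1a ipBr (adjointr _ _ C1a) (adjointr _ _ C2a).
rewrite -addrA -opprD; congr (_ - _).
have Sw : forall w : 'cV[C]_d, cdot w (C1 (S0 z^* (C1p u - C2p s))) =
    cdot w (M11 z^* *m u - M12 z^* *m s).
  move=> w; rewrite cdotC [RHS]cdotC; congr (_^*).
  by rewrite -(adjointr _ _ C1a) linearB/= ipBl cdotBl !transferE.
rewrite Sw -[z in z * _]conjCK -cdotZr -cdotDr; congr (cdot _ _).
rewrite /lft /eL !mulmxDl mul1mx -/s -!mulmxA -/s mulNmx -!scalemxAl scalerBr.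
by rewrite addrCA.
Qed.

Section Unit.
Hypothesis C2p_inj : forall u, C2p u = 0 -> u = 0.

Lemma state_inj z u : nonreal z -> S0 z (C2p u) = 0 -> u = 0.
Proof.
move=> nz h; have [S0r _ _ _ _] := S0P nz; apply: C2p_inj.
have A0 : main_op 0 = 0 by rewrite /main_op (linear0 B) (linear0 C2) (linear0 C1p) subr0.
by rewrite -(S0r (C2p u)) h A0 scaler0 subr0.
Qed.

Definition pencilL (Q : C -> 'M[C]_d) z : 'M[C]_d :=
  1%:M + z *: Q z - z *: (Q z *m M22 z).
Definition pencilR (Q : C -> 'M[C]_d) z : 'M[C]_d :=
  1%:M + z *: Q z - z *: (M22 z *m Q z).

Lemma pencilL_adj Q z : nonreal z -> (Q z) ^t* = Q z^* ->
  (pencilL Q z) ^t* = pencilR Q z^*.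
Proof. by move=> nz Qz; rewrite /pencilL pencil_adj (transfer_adj S0P _ _ nz) Qz. Qed.

Lemma r22_norm z y : nonreal z -> cdot (r22 z z^* *m y) y =
  ip (S0 z^* (C2p y)) (S0 z^* (C2p y)).
Proof. by move=> nz; have [_ _ _ Sa _] := S0P nz; rewrite transfer2E Sa. Qed.

Lemma M22_gap z : nonreal z ->
  z *: M22 z - z^* *: (M22 z) ^t* = (z - z^*) *: r22 z z^*.
Proof.
move=> nz; rewrite (transfer_adj S0P _ _ nz).
exact: (transfer_sub S0P _ _ nz (nonrealJ nz)).
Qed.

(** A null vector gives the nonnegative form P a nonpositive value, so S0 C2^+ y = 0; injectivity of
    C2^+ then kills y and with it x. *)
Lemma pencilL_unit Q P z : nonreal z -> (Q z) ^t* = Q z^* ->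
  Q z - Q z^* = (z - z^*) *: (P + Q z *m Q z^*) ->
  (forall x, 0 <= cdot (P *m x) x) -> pencilL Q z \in unitmx.
Proof.
move=> nz Qz; rewrite -Qz => QP P0; apply: unitmx_adj_ker => x.
rewrite /pencilL pencil_adj => hx.
have [xE Py] := pencil_ker (nonreal_subJ nz) (M22_gap nz) QP hx.
suff y0 : Q z ^t* *m x = 0 by rewrite xE y0 mulmx0 subr0 scaler0.
apply: (state_inj (nonrealJ nz)); apply: (ip_eq0 (ip := ip)); apply/eqP.
by rewrite eq_le ip_ge0 andbT -r22_norm// -oppr_ge0 -Py P0.
Qed.

Definition copencilL (F : C -> 'M[C]_d) z : 'M[C]_d :=
  1%:M - z *: F z + z *: (F z *m M22 z).

Lemma copencilL_unit F K z : nonreal z -> (F z) ^t* = F z^* ->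
  F z - F z^* = (z - z^*) *: K ->
  (forall x, 0 <= cdot ((K - F z *m r22 z z^* *m F z^*) *m x) x) ->
  copencilL F z \in unitmx.
Proof.
move=> nz Fz; rewrite -Fz => FK K0; apply: unitmx_adj_ker => x.
rewrite /copencilL copencil_adj => hx.
have [xE Ky] := copencil_ker (nonreal_subJ nz) (M22_gap nz) FK hx.
suff y0 : F z ^t* *m x = 0 by rewrite xE y0 mulmx0 subr0 scaler0.
apply/cdot_le0; have := K0 x.
by rewrite Ky oppr_ge0.
Qed.

End Unit.

Lemma pencil_com Q z : pencilL Q z *m Q z = Q z *m pencilR Q z.
Proof. exact: pencil_com_identity. Qed.

(* For the pair p = 1 + z Q, q = Q this is q (p - z M22 q)^-1. *)
Definition sigma (Q : C -> 'M[C]_d) z : 'M[C]_d := invmx (pencilL Q z) *m Q z.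

Lemma sigmaR Q z : pencilL Q z \in unitmx -> pencilR Q z \in unitmx ->
  sigma Q z = Q z *m invmx (pencilR Q z).
Proof.
move=> uL uR; rewrite /sigma; apply: (canLR (mulKmx uL)).
by rewrite mulmxA pencil_com (mulmxK uR).
Qed.

Lemma sigma_gap Q P z w : nonreal z -> nonreal w ->
  pencilL Q z \in unitmx -> pencilL Q w \in unitmx -> pencilR Q w \in unitmx ->
  Q z - Q w = (z - w) *: (P + Q z *m Q w) ->
  sigma Q z - sigma Q w = (z - w) *:
    (invmx (pencilL Q z) *m P *m invmx (pencilR Q w) +
     sigma Q z *m r22 z w *m sigma Q w).
Proof.
move=> nz nw uz uw uwR QP; have t := transfer_sub S0P C2p C2p nz nw.
have E : Q z *m pencilR Q w - pencilL Q z *m Q w =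
    (z - w) *: (P + Q z *m r22 z w *m Q w).
  by rewrite pencil_sub_identity QP t gap_identity.
rewrite (sigmaR uw uwR) /sigma (invmx_gap _ _ uz uwR).
rewrite E -scalemxAr -scalemxAl; congr (_ *: _).
by rewrite mulmxDr mulmxDl !mulmxA.
Qed.

Lemma copencil_sigma F z : copencilL F z \in unitmx ->
  let Q w := invmx (copencilL F w) *m F w in
  pencilL Q z = invmx (copencilL F z) /\ sigma Q z = F z.
Proof.
move=> u Q; have E : pencilL Q z = invmx (copencilL F z).
  have -> : pencilL Q z = invmx (copencilL F z) *m (copencilL F z +
     (z *: F z - z *: (F z *m M22 z))).
    rewrite mulmxDr mulVmx// mulmxBr /pencilL /Q -!scalemxAr mulmxA addrA.
    by [].
  have -> : copencilL F z + (z *: F z - z *: (F z *m M22 z)) = 1%:M.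
    exact: copencil_identity.
  by rewrite mulmx1.
by split=> //; rewrite /sigma E invmxK /Q mulKVmx.
Qed.

End Coupling.

(** * The reproducing kernel space of a matrix kernel and contractions into it *)

Section KernelSpace.
Variable R : realType.
Local Notation C := R[i].
Local Open Scope sesquilinear_scope.
Variables (d : nat) (Om : set C) (k : C -> C -> 'M[C]_d).
Hypothesis k_ge0 : nonneg_kernel Om k.

(** A C^d-valued function f is coded by the scalar function (z, u) |-> (f z, u), so the scalar
    theory applies. *)
Let T := ({z | Om z} * 'cV[C]_d)%type.
Let pt (t : T) : C := projT1 t.1.
Let kT (s t : T) : C := cdot (k (pt s) (pt t) *m s.2) t.2.

Let Om_pt t : Om (pt t). Proof. by rewrite /pt; case: t => [[z Oz] u]. Qed.

Fact kernel_space_ge0 (v : seq (C * T)) :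
  0 <= \sum_(x <- v) \sum_(y <- v) x.1 * y.1^* * kT x.2 y.2.
Proof.
have := nonneg_kernel_seq v (fun x => x.1 *: x.2.2) k_ge0 (fun x => Om_pt x.2).
rewrite exchange_big; congr (_ <= _); apply: eq_bigr => x _.
by apply: eq_bigr => y _; rewrite -scalemxAr cdotZl cdotZr mulrA.
Qed.

(** Symmetry comes from the reality of the quadratic form, tested on the coefficients (1, 1) and (1,
    i). *)
Fact kernel_spaceC s t : kT s t = (kT t s)^*.
Proof.
have real_ge0 z : 0 <= z -> complex.Im z = 0 :> R by move/ger0_Im.
have q x y v : (v : seq (C * T)) = [:: (x, s); (y, t)] ->
    complex.Im (x * x^* * kT s s + x * y^* * kT s t +
      (y * x^* * kT t s + y * y^* * kT t t)) = 0.
  move=> vE; have := real_ge0 _ (kernel_space_ge0 v); rewrite vE.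
  by rewrite !big_cons !big_nil /= !addr0.
have ss : complex.Im (kT s s) = 0.
  have := real_ge0 _ (kernel_space_ge0 [:: (1, s)]).
  by rewrite !big_cons !big_nil /= !addr0 rmorph1 !mul1r.
have tt : complex.Im (kT t t) = 0.
  have := real_ge0 _ (kernel_space_ge0 [:: (1, t)]).
  by rewrite !big_cons !big_nil /= !addr0 rmorph1 !mul1r.
have h1 := q 1 1 _ erefl; have h2 := q 1 'i%C _ erefl.
rewrite rmorph1 !mul1r in h1; rewrite rmorph1 conj_i !mul1r !mulr1 in h2.
move: ss tt h1 h2; move: (kT s s) (kT t t) (kT s t) (kT t s).
move=> [a1 b1] [a2 b2] [a3 b3] [a4 b4] /= -> -> h1 h2.
by apply/eqP; rewrite eq_complex/=; apply/andP; split; apply/eqP; lra.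
Qed.

Let K := PdKernel kernel_spaceC kernel_space_ge0.

Let kv z (Oz : Om z) u : rkhs K := kvec K (exist _ z Oz, u).

Let kv_linear z (Oz : Om z) : linear (kv Oz).
Proof.
move=> a u v; apply: rkhs_ext => t.
rewrite (_ : (a *: kv Oz u + kv Oz v) t = a * kv Oz u t + kv Oz v t)//.
by rewrite /kv !kvecE /= /kT /= mulmxDr -scalemxAr cdotDl cdotZl.
Qed.

Definition kernel_eval_fun (z : C) (f : rkhs K) : 'cV[C]_d :=
  match pselect (Om z) with
  | left Oz => \col_i f (exist _ z Oz, delta_mx i 0)
  | right _ => 0
  end.

Fact kernel_eval_linear z : linear (kernel_eval_fun z).
Proof.
move=> a f g; rewrite /kernel_eval_fun; case: pselect => [Oz|_].
  by apply/colP => i; rewrite !mxE.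
by rewrite scaler0 addr0.
Qed.

Definition kernel_eval z : {linear rkhs K -> 'cV[C]_d} :=
  to_linear (kernel_eval_linear z).

(** Elements of the scalar space are a priori arbitrary in u; the reproducing property makes them
    antilinear there, because the kernel vectors are linear in u. *)
Lemma kernel_evalE z (Oz : Om z) f u :
  cdot (kernel_eval z f) u = f (exist _ z Oz, u).
Proof.
rewrite /= /kernel_eval_fun; case: pselect => // Oz'.
rewrite (Prop_irrelevance Oz' Oz) -rkhs_ip_kvec -/(kv Oz u) {2}(sum_delta u).
have -> : kv Oz (\sum_j u j 0 *: delta_mx j 0) =
    \sum_j u j 0 *: kv Oz (delta_mx j 0).
  rewrite -[kv Oz]/(to_linear (@kv_linear z Oz) : _ -> _) linear_sum.
  by apply: eq_bigr => j _; rewrite linearZ.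
rewrite ip_sumr /cdot; apply: eq_bigr => j _.
by rewrite ipZr rkhs_ip_kvec mxE mulrC.
Qed.

Theorem kernel_space_rkhs : is_rkhs Om k rkhs_ip kernel_eval.
Proof.
split; first exact: rkhs_ipn.
  move=> f g h; apply: rkhs_ext => -[[z Oz] u].
  by rewrite -!kernel_evalE h.
move=> w u Ow; exists (kv Ow u); split=> [z Oz|f].
  by apply: cdot_extl => v; rewrite kernel_evalE.
by rewrite rkhs_ip_kvec kernel_evalE.
Qed.

(** Nonnegativity of k - L bounds the norm of a combination of the vectors g z u by that of the
    corresponding kernel combination; this is the criterion for (z, u) |-> (x, g z u) to lie in the
    space with norm at most |x|. *)
Theorem kernel_space_contraction (H : normedModType C) (ip : {dot H for conjC})
  (g : C -> {linear 'cV[C]_d -> H}) (L : C -> C -> 'M[C]_d) :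
  (forall x : H, `|x| ^+ 2 = ip x x) ->
  (forall w z u v, Om w -> Om z -> cdot (L w z *m u) v = ip (g w u) (g z v)) ->
  nonneg_kernel Om (fun w z => k w z - L w z) ->
  exists F : {linear H -> rkhs K},
    (forall x z u, Om z -> cdot (kernel_eval z (F x)) u = ip x (g z u)) /\
    (forall x, rnorm (F x) <= rnorm x).
Proof.
move=> ipn LE kL; pose gT (t : T) := g (pt t) t.2.
have dom v : rnorm (\sum_(x <- v) x.1 *: gT x.2) ^+ 2 <= knorm2 K v.
  have := nonneg_kernel_seq v (fun x => x.1 *: x.2.2) kL (fun x => Om_pt x.2).
  have -> : \sum_(i <- v) \sum_(j <- v) cdot ((k (pt j.2) (pt i.2) -
      L (pt j.2) (pt i.2)) *m (j.1 *: j.2.2)) (i.1 *: i.2.2) =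
      fpair (kcomb K v) v -
      ip (\sum_(x <- v) x.1 *: gT x.2) (\sum_(x <- v) x.1 *: gT x.2).
    rewrite ip_sumr /fpair -sumrB; apply: eq_bigr => x _.
    rewrite ip_suml /kcomb mulr_sumr -sumrB; apply: eq_bigr => y _.
    rewrite mulmxBl cdotBl -!scalemxAr !cdotZl !cdotZr LE ?Om_pt//.
    by rewrite /gT ipZl ipZr /= /kT mulrCA.
  rewrite lecE => /andP[_]; rewrite ReD ReN (Re_ipxx ipn) -/(knorm2 K v).
  by rewrite subr_ge0.
have crit x v : rnorm (fpair (fun t => ip x (gT t)) v) <=
    rnorm x * Num.sqrt (knorm2 K v).
  have -> : fpair (fun t => ip x (gT t)) v = ip x (\sum_(y <- v) y.1 *: gT y.2).
    by rewrite ip_sumr; apply: eq_bigr => y _; rewrite ipZr.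
  apply: le_trans (cauchy_schwarz ipn _ _) _; rewrite ler_wpM2l ?rnorm_ge0//.
  rewrite -(@ler_pXn2r _ 2)// ?nnegrE ?rnorm_ge0 ?sqrtr_ge0//.
  by rewrite sqr_sqrtr ?knorm2_ge0.
pose F x : rkhs K := to_rkhs (fbounded_crit (rnorm_ge0 x) (crit x)).1.
have Fl : linear F.
  move=> a x y; apply: rkhs_ext => t.
  rewrite (_ : (a *: F x + F y) t = a * F x t + F y t)//=.
  by rewrite ipDl ipZl.
exists (to_linear Fl); split=> [x z u Oz|x]; first by rewrite (kernel_evalE Oz).
rewrite -(@ler_pXn2r _ 2)// ?nnegrE ?rnorm_ge0// rkhs_rnorm2.
exact: (fbounded_crit (rnorm_ge0 x) (crit x)).2.
Qed.

End KernelSpace.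

(** * Theta at regular points *)

Section Regular.
Variable R : realType.
Local Notation C := R[i].
Local Open Scope sesquilinear_scope.
Variables (d : nat) (H : completeNormedModType C) (ip : {dot H for conjC}).
Hypothesis ipn : norm_of_dot ip.
Variables (B : {linear H -> H}) (C1 C2 : {linear H -> 'cV[C]_d}).
Variables (C1p C2p : {linear 'cV[C]_d -> H}).
Hypotheses (C1a : is_adjoint ip (@cdot R d) C1 C1p)
  (C2a : is_adjoint ip (@cdot R d) C2 C2p).
Variable S0 : C -> {linear H -> H}.
Hypothesis S0P : selfadjoint_inverses ip (main_op B C2 C1p) S0.

Local Notation M11 := (transfer ip S0 C1p C1p).
Local Notation M12 := (transfer ip S0 C1p C2p).
Local Notation M21 := (transfer ip S0 C2p C1p).
Local Notation M22 := (transfer ip S0 C2p C2p).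
Local Notation eL := (eL ip C1p C2p S0).
Local Notation eR := (eR ip C1p C2p S0).

Lemma resolventP z : regular_point ip B z ->
  is_resolvent ip B z (resolvent ip B z).
Proof. by move=> [S hS]; rewrite /resolvent; case: xgetP => [S' -> //|/(_ S)]. Qed.

Lemma resolvent_linear z : regular_point ip B z -> linear (resolvent ip B z).
Proof.
move=> /resolventP[_ Sl Sr] a x y; set S := resolvent ip B z in Sl Sr *.
rewrite -[RHS]Sl; congr (S _); rewrite -{1}[x]Sr -{1}[y]Sr linearP scalerBr.
by rewrite scalerDr opprD addrACA !scalerA (mulrC z a).
Qed.

Lemma mulmx_ext n p (X Y : 'M[C]_(n, p)) :
  (forall u : 'cV[C]_p, X *m u = Y *m u) -> X = Y.
Proof. by move=> h; apply: mx_cdot_ext => u v; rewrite h. Qed.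

(** Moving the term with C1^+ C2 h to the left turns B into A, after which h is given by S0. *)
Lemma transfer_solve z h a y : nonreal z ->
  h - z *: B h = C2p a - C1p (y + z *: C2 h) ->
  C2 h = M22 z *m a - M21 z *m y /\ C1 h = M12 z *m a - M11 z *m y.
Proof.
move=> nz.
have -> : C1p (y + z *: C2 h) = C1p y + z *: C1p (C2 h) by rewrite linearD linearZ.
move=> hE; have [_ S0l _ _ _] := S0P nz.
have h2 : h = S0 z (C2p a - C1p y).
  rewrite -[LHS]S0l; congr (S0 z _).
  by rewrite /main_op scalerBr opprB addrA addrAC hE opprD addrA subrK.
split; apply: cdot_extl => v; rewrite cdotBl !transferE -ipBl.
  by rewrite -(linearB (S0 z)) -h2 (adjointr _ _ C2a).
by rewrite -(linearB (S0 z)) -h2 (adjointr _ _ C1a).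
Qed.

Lemma Theta_col z (a b : 'cV[C]_d) : regular_point ip B z ->
  let h := resolvent ip B z (C2p a - C1p b) in
  Theta ip B C1 C2 C1p C2p z *m col_mx a b =
  col_mx (a - z *: C1 h) (b - z *: C2 h).
Proof.
move=> rz h; have Sl := resolvent_linear rz.
rewrite /Theta mulmxBl mul1mx -scalemxAl mx_of_funE; last first.
  move=> c u v /=; rewrite (linearP usubmx) (linearP dsubmx) (linearP C2p) (linearP C1p).
  rewrite opprD addrACA -scalerBr Sl (linearP C1) (linearP C2).
  by rewrite scale_col_mx add_col_mx.
by rewrite col_mxKu col_mxKd -/h scale_col_mx opp_col_mx add_col_mx.
Qed.

Lemma lft_col (Th : 'M[C]_(d + d)) p q (u : 'cV[C]_d) :
  Th *m col_mx (q *m u) (p *m u) = col_mx (lft_num Th p q *m u) (lft_den Th p q *m u).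
Proof.
by rewrite -{1}[Th]submxK mul_block_col /lft_num /lft_den !mulmxDl !mulmxA.
Qed.

(** With h the resolvent vector in Theta, the denominator applied to u is p u - z C2 h, and h solves
    an equation fed by this same vector. Solving it by S0 eliminates the resolvent of B. *)
Lemma regular_lft z (p q : 'M[C]_d) : nonreal z -> regular_point ip B z ->
  let Th := Theta ip B C1 C2 C1p C2p z in
  eR z *m lft_den Th p q = p - z *: (M22 z *m q) /\
  lft_num Th p q = eL z *m q + z *: (M11 z *m lft_den Th p q).
Proof.
move=> nz rz Th; have [_ _ Sr] := resolventP rz.
suff key (u : 'cV[C]_d) : eR z *m (lft_den Th p q *m u) = p *m u - z *: (M22 z *m (q *m u)) /\
    lft_num Th p q *m u = eL z *m (q *m u) + z *: (M11 z *m (lft_den Th p q *m u)).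
  split; apply: mulmx_ext => u; have [k1 k2] := key u.
    by rewrite -mulmxA k1 mulmxBl -scalemxAl !mulmxA.
  by rewrite k2 mulmxDl -scalemxAl !mulmxA.
have := lft_col Th p q u; rewrite Theta_col//.
set h := resolvent ip B z _ => /eq_col_mx[nE dE].
have hE : h - z *: B h = C2p (q *m u) - C1p (lft_den Th p q *m u + z *: C2 h).
  by rewrite -dE subrK Sr.
have [C2h C1h] := transfer_solve nz hE.
move: dE nE C2h C1h; rewrite /eR /eL; move: (lft_den Th p q *m u) => y dE <- C2h C1h.
split.
  rewrite mulmxBl mul1mx -scalemxAl -[p *m u](subrK (z *: C2 h)) dE C2h.
  by rewrite scalerBr -addrA; congr (_ + _); rewrite addrAC subrr add0r.
rewrite mulmxBl mul1mx -scalemxAl C1h scalerBr opprB -addrA.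
by congr (_ + _); rewrite addrC.
Qed.

End Regular.

Section Bounds.
Variable R : realType.
Local Notation C := R[i].
Local Notation "x %:C" := (real_complex R x).
Local Open Scope sesquilinear_scope.
Variables (d : nat) (H : completeNormedModType C) (ip : {dot H for conjC}).
Hypothesis ipn : norm_of_dot ip.

(** [bounded_op] is a squared bound; 1 + |c| dominates the square root of c. *)
Lemma sqr_le_bound (a c s : R) : 0 <= a -> 0 <= s -> a ^+ 2 <= c * s ^+ 2 ->
  a <= (1 + `|c|) * s.
Proof.
move=> a0 s0 h; rewrite -(@ler_pXn2r _ 2)// ?nnegrE ?mulr_ge0 ?addr_ge0//.
apply: (le_trans h); rewrite exprMn ler_wpM2r ?exprn_ge0//.
by have := ler_norm c; have := normr_ge0 c; nra.
Qed.

Lemma bounded_op_rnorm (T : H -> H) : bounded_op ip ip T ->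
  exists b, forall x, rnorm (T x) <= b * rnorm x.
Proof.
move=> [M TM]; exists (1 + `|complex.Re M|) => x.
apply: sqr_le_bound; rewrite ?rnorm_ge0//.
have := TM x; rewrite (ipxx ipn x) lecE => /andP[_].
by rewrite (Re_ipxx ipn) mulrC ReMr mulrC.
Qed.

Lemma rnorm_coord (v : 'cV[C]_d) i : rnorm (v i 0) ^+ 2 <= complex.Re (cdot v v).
Proof.
rewrite /cdot (bigD1 i)//= ReD Re_conjM lerDl.
have : 0 <= \sum_(j | j != i) v j 0 * (v j 0)^*.
  by apply: sumr_ge0 => j _; exact: mul_conjC_ge0.
by rewrite lecE => /andP[].
Qed.

Lemma bounded_op_coord (T : H -> 'cV[C]_d) : bounded_op ip (@cdot R d) T ->
  exists b, forall x i, rnorm (T x i 0) <= b * rnorm x.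
Proof.
move=> [M TM]; exists (1 + `|complex.Re M|) => x i.
apply: sqr_le_bound; rewrite ?rnorm_ge0//.
apply: le_trans (rnorm_coord _ _) _.
have := TM x; rewrite (ipxx ipn x) lecE => /andP[_].
by rewrite [_ * _%:C]mulrC ReMr mulrC.
Qed.

Lemma rnorm_finite_rank (L : {linear 'cV[C]_d -> H})
    (v : 'cV[C]_d) (c : R) :
  (forall i, rnorm (v i 0) <= c) ->
  rnorm (L v) <= (\sum_i rnorm (L (delta_mx i 0))) * c.
Proof.
move=> vc; rewrite {1}(sum_delta v) linear_sum mulr_suml.
apply: (@le_trans _ _ (\sum_i rnorm (L (v i 0 *: delta_mx i 0)))).
  elim/big_rec2: _ => [|i y x _ h]; first by rewrite rnorm0.
  by apply: le_trans (rnormD _ _) _; rewrite lerD2l.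
apply: ler_sum => i _; rewrite linearZ rnormZ mulrC.
by rewrite ler_wpM2l ?rnorm_ge0.
Qed.

Lemma main_op_bounded (B : {linear H -> H}) (C2 : {linear H -> 'cV[C]_d})
    (C1p : {linear 'cV[C]_d -> H}) :
  bounded_op ip ip B -> bounded_op ip (@cdot R d) C2 ->
  exists b, forall x, rnorm (main_op B C2 C1p x) <= b * rnorm x.
Proof.
move=> /bounded_op_rnorm[b Bb] /bounded_op_coord[c C2c].
exists (b + (\sum_i rnorm (C1p (delta_mx i 0))) * c) => x.
apply: le_trans (rnormB _ _) _; rewrite mulrDl lerD//.
by rewrite -mulrA; exact: rnorm_finite_rank.
Qed.

Lemma dense_vanish (X : Type) (f : X -> H) (phi : H -> C) (c : R) :
  dense (range f) -> (forall x y, phi (x - y) = phi x - phi y) ->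
  (forall x, rnorm (phi x) <= c * rnorm x) -> (forall h, phi (f h) = 0) ->
  forall x, phi x = 0.
Proof.
move=> df phiB phic phi0 x; apply/eqP/negP => /negP nz.
have p0 := rnorm_gt0 nz.
have c1 : 0 < 1 + `|c| by rewrite ltr_pwDl.
have [y hy] := denseP df x (divr_gt0 p0 c1).
suff : rnorm (phi x) < rnorm (phi x) by rewrite ltxx.
have {1}-> : phi x = phi (x - f y) by rewrite phiB phi0 subr0.
apply: le_lt_trans (phic _) _; move: hy; rewrite ltr_pdivlMr// => hy.
apply: le_lt_trans _ hy; rewrite mulrC ler_wpM2l ?rnorm_ge0//.
by have := ler_norm c; lra.
Qed.

Lemma dense_symmetric (X : Type) (f : X -> H) (A : {linear H -> H}) (b : R) :
  dense (range f) -> (forall x, rnorm (A x) <= b * rnorm x) ->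
  (forall h g, ip (A (f h)) (f g) = ip (f h) (A (f g))) ->
  forall x y, ip (A x) y = ip x (A y).
Proof.
move=> df Ab sym.
have s h y : ip (A (f h)) y = ip (f h) (A y).
  apply/subr0_eq; move: y.
  apply: (dense_vanish (f := f) (c := rnorm (A (f h)) + rnorm (f h) * b)) => //.
  - by move=> x y; rewrite (linearB A) !ipBr; ring.
  - move=> x; apply: le_trans (rnormB _ _) _; rewrite mulrDl lerD//.
      exact: cauchy_schwarz.
    apply: le_trans (cauchy_schwarz ipn _ _) _.
    by rewrite -mulrA ler_wpM2l ?rnorm_ge0.
  - by move=> g; rewrite sym subrr.
move=> x y; apply/subr0_eq; move: x.
apply: (dense_vanish (f := f) (c := b * rnorm y + rnorm (A y))) => //.
- by move=> x x'; rewrite (linearB A) !ipBl; ring.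
- move=> x; apply: le_trans (rnormB _ _) _; rewrite mulrDl lerD//.
    apply: le_trans (cauchy_schwarz ipn _ _) _.
    by rewrite mulrAC ler_wpM2r ?rnorm_ge0.
  by rewrite mulrC; exact: cauchy_schwarz.
- by move=> h; rewrite s subrr.
Qed.

End Bounds.

(** * Regular points near 0 *)

Section SmallPoints.
Variable R : realType.
Local Notation C := R[i].
Local Notation "x %:C" := (real_complex R x).
Local Open Scope sesquilinear_scope.
Variables (d : nat) (H : completeNormedModType C) (ip : {dot H for conjC}).
Hypothesis ipn : norm_of_dot ip.
Variables (B : {linear H -> H}).

Lemma small_regular : bounded_op ip ip B ->
  exists2 r : R, 0 < r & forall z : C, rnorm z < r -> regular_point ip B z.
Proof.
move=> /(bounded_op_rnorm ipn)[b Bb].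
have b0 : 0 < 2 * (1 + `|b|) by rewrite mulr_gt0// ltr_pwDl.
(* Within this radius z B has norm at most 1/2, which makes 1 - z B coercive with constant 1/2. *)
exists (2 * (1 + `|b|))^-1; first by rewrite invr_gt0.
move=> z; rewrite -[_^-1]mul1r ltr_pdivlMr// => hz.
have zB x : rnorm (z *: B x) <= 2^-1 * rnorm x.
  rewrite rnormZ; apply: le_trans (ler_wpM2l (rnorm_ge0 _) (Bb x)) _.
  rewrite mulrA ler_wpM2r ?rnorm_ge0//.
  have := rnorm_ge0 z; have := ler_norm b; have := normr_ge0 b; nra.
have Tl : linear (fun x => x - z *: B x).
  move=> a x y; rewrite linearP scalerDr opprD addrACA; congr (_ + _).
  by rewrite scalerBr !scalerA mulrC.
pose T := to_linear Tl; have TE x : T x = x - z *: B x by [].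
have Tc x : 2^-1 * rnorm x ^+ 2 <= complex.Re (ip (T x) x).
  rewrite TE ipBl ReD ReN (Re_ipxx ipn).
  have h1 := le_trans (real_ler_norm (num_real _)) (rnormRe (ip (z *: B x) x)).
  have h2 := cauchy_schwarz ipn (z *: B x) x.
  have h3 := zB x; have := rnorm_ge0 x; nra.
have TM x : rnorm (T x) <= 2 * rnorm x.
  rewrite TE; apply: le_trans (rnormB _ _) _.
  by have := zB x; have := rnorm_ge0 x; lra.
have h0 : 0 < 2^-1 :> R by rewrite invr_gt0.
have [S [TS ST]] := linear_inverse (coercive_surj ipn h0 TM Tc) (coercive_inj h0 Tc).
exists S; split=> [|x|y]; [|exact: ST|exact: TS].
(* Coercivity gives |S y|^2 / 2 <= |y| |S y|, so |S y|^2 <= 4 |y|^2. *)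
exists (4 : R)%:C => y; rewrite !(ipxx ipn) -rcM lecR.
have := Tc (S y); rewrite TS => h1.
have h2 := le_trans (real_ler_norm (num_real _)) (rnormRe (ip y (S y))).
have h3 := cauchy_schwarz ipn y (S y).
have := sqr_ge0 (2 * rnorm y - rnorm (S y)); nra.
Qed.

(** The disc with centre i r / 2 that touches 0 stays inside |z| < r. Regularity of conj z is
    included because invertibility of eL at z is deduced from it, that of eR from regularity of z
    itself. *)
Lemma regular_disc : bounded_op ip ip B ->
  exists (z0 : C) (r : R), [/\ upper z0, 0 < r & forall z, rnorm (z - z0) < r ->
    regular_point ip B z /\ regular_point ip B z^*].
Proof.
move=> /small_regular[r r0 rreg]; have r20 : 0 < r / 2 by rewrite divr_gt0.
exists (Complex 0 (r / 2)), (r / 2); split=> //; first exact/upperE.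
move=> z hz; suff zr : rnorm z < r by split; apply: rreg; rewrite ?rnormJ.
rewrite -[z](subrK (Complex 0 (r / 2))).
apply: le_lt_trans (rnormD _ _) _.
have := rnorm_leReIm (Complex 0 (r / 2) : C).
by rewrite /= normr0 add0r ger0_norm ?(ltW r20)//; lra.
Qed.

Variables (C1 C2 : {linear H -> 'cV[C]_d}) (C1p C2p : {linear 'cV[C]_d -> H}).
Hypothesis C2a : is_adjoint ip (@cdot R d) C2 C2p.
Variable S0 : C -> {linear H -> H}.
Hypothesis S0P : selfadjoint_inverses ip (main_op B C2 C1p) S0.

(** If u = z C2 S0 C1^+ u, then h = S0 C1^+ u satisfies (1 - z B) h = 0, so regularity gives h = 0
    and hence u = 0. *)
Lemma eR_unit z : nonreal z -> regular_point ip B z ->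
  eR ip C1p C2p S0 z \in unitmx.
Proof.
move=> nz [S [_ Sl _]]; have [S0r _ _ _ _] := S0P nz.
apply: unitmx_ker => u; rewrite /eR mulmxBl mul1mx -scalemxAl => /subr0_eq uE.
pose h := S0 z (C1p u).
have C2h : transfer ip S0 C2p C1p z *m u = C2 h.
  by apply: cdot_extl => v; rewrite transferE (adjointr _ _ C2a).
have hE : h - z *: B h = 0.
  have := S0r (C1p u); rewrite -/h /main_op scalerBr opprB addrA addrAC => hh.
  apply: (addIr (z *: C1p (C2 h))); rewrite add0r hh {1}uE C2h.
  by rewrite linearZ.
have S00 : S 0 = 0 by rewrite -[RHS](Sl 0) (linear0 B) scaler0 subr0.
have h0 : h = 0 by rewrite -[h]Sl hE.
by rewrite uE C2h h0 (linear0 C2) scaler0.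
Qed.

Lemma eL_unit z : nonreal z -> regular_point ip B z^* ->
  eL ip C1p C2p S0 z \in unitmx.
Proof.
move=> nz rz; rewrite -adjmx_unit (eL_adj C2p S0P nz).
exact: eR_unit (nonrealJ nz) rz.
Qed.

End SmallPoints.

(** * From pairs to solutions *)

Section LocalPencils.
Variables (K : numFieldType) (z : K) (Pr : (K -> K) -> Prop).
Hypothesis LA : local_algebra z Pr.
Variable d : nat.
Implicit Types X Y : K -> 'M[K]_d.

Lemma la_pencil X Y : la_mx Pr X -> la_mx Pr Y ->
  la_mx Pr (fun v => 1%:M + v *: X v - v *: (X v *m Y v)).
Proof.
move=> Xc Yc; have id := la_id LA.
apply: (la_mxB LA); last exact: (la_mxZ LA id (la_mxM LA Xc Yc)).
exact: (la_mxD LA (la_mx_cst LA _) (la_mxZ LA id Xc)).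
Qed.

Lemma la_copencil X : la_mx Pr X -> la_mx Pr (fun v => 1%:M - v *: X v).
Proof. by move=> Xc; exact: (la_mxB LA (la_mx_cst LA _) (la_mxZ LA (la_id LA) Xc)). Qed.

Lemma la_gap (G f j : 'M[K]_d) (r11 e F r21 r12 r22 i P : K -> 'M[K]_d) :
  la_mx Pr r11 -> la_mx Pr e -> la_mx Pr F -> la_mx Pr r21 -> la_mx Pr r12 ->
  la_mx Pr r22 -> la_mx Pr i -> la_mx Pr P ->
  la_mx Pr (fun v => r11 v - e v *m F v *m r21 v - r12 v *m G *m f +
    e v *m F v *m r22 v *m G *m f + e v *m i v *m P v *m (j *m f)).
Proof.
move=> r11c ec Fc r21c r12c r22c ic Pc.
have M X Y := @la_mxM _ _ _ LA d d d X Y.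
have c (X : 'M[K]_d) := la_mx_cst LA X.
have eF := M _ _ ec Fc.
apply: (la_mxD LA); last exact: (M _ _ (M _ _ (M _ _ ec ic) Pc) (c _)).
apply: (la_mxD LA); last exact: (M _ _ (M _ _ (M _ _ eF r22c) (c G)) (c f)).
apply: (la_mxB LA); last exact: (M _ _ (M _ _ r12c (c G)) (c f)).
exact: (la_mxB LA r11c (M _ _ eF r21c)).
Qed.

End LocalPencils.

Section GapKernels.
Variable R : realType.
Local Notation C := R[i].
Local Notation CF := (R[i] : numFieldType).
Local Open Scope sesquilinear_scope.
Variable d : nat.
Implicit Types (Om : set C) (k L : C -> C -> 'M[C]_d).

Lemma nonneg_kernelD Om k L : nonneg_kernel Om k -> nonneg_kernel Om L ->
  nonneg_kernel Om (fun w z => k w z + L w z).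
Proof.
move=> k0 L0 n z u Oz; have := addr_ge0 (k0 n z u Oz) (L0 n z u Oz).
rewrite -big_split; congr (_ <= _); apply: eq_bigr => i _.
by rewrite -big_split; apply: eq_bigr => j _; rewrite mulmxDl cdotDl.
Qed.

Lemma nonneg_kernel_gram Om L (H : normedModType C) (ip : {dot H for conjC})
    (g : C -> 'cV[C]_d -> H) :
  (forall w z u v, Om w -> Om z -> cdot (L w z *m u) v = ip (g w u) (g z v)) ->
  nonneg_kernel Om L.
Proof.
move=> LE n z u Oz.
suff -> : \sum_i \sum_j cdot (L (z j) (z i) *m u j) (u i) =
    ip (\sum_j g (z j) (u j)) (\sum_i g (z i) (u i)) by exact: ip_ge0.
rewrite ip_sumr; apply: eq_bigr => i _; rewrite ip_suml.
by apply: eq_bigr => j _; rewrite LE.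
Qed.

Lemma nonneg_kernel_diag Om k z u : nonneg_kernel Om k -> Om z ->
  0 <= cdot (k z z *m u) u.
Proof.
move=> k0 Oz; have := k0 1 (fun=> z) (fun=> u) (fun=> Oz).
by rewrite !big_ord1.
Qed.

(** T z z is the derivative of m, the value that [nev_kernel] takes at z = conj w; hence one formula
    covers all pairs of nonreal points, and its nonnegativity is that of N^m. *)
Lemma gap_nevanlinna (m : C -> 'M[C]_d) (T : C -> C -> 'M[C]_d) :
  (forall z, nonreal z -> (m z) ^t* = m z^*) ->
  (forall z w, nonreal z -> nonreal w -> m z - m w = (z - w) *: T z w) ->
  (forall z w i j, nonreal z -> nonreal w ->
     T v w i j @[v --> (z : CF)] --> (T z w i j : CF)) ->
  nonneg_kernel (@nonreal R) (fun w z => T z w^*) ->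
  nevanlinna m /\
  forall w z, nonreal w -> nonreal z -> nev_kernel m w z = T z w^*.
Proof.
move=> madj gap Tc T0.
have dq z i j : nonreal z -> derivable ((fun w => m w i j) : C^o -> C^o) z 1 /\
    (derive1 ((fun w => m w i j) : C^o -> C^o) z : C) = T z z i j.
  move=> nz; apply: (@difference_quotient CF (fun w => m w i j) (fun w => T w z i j)).
    apply: filterS (near_nonreal nz) => w nw.
    by have /matrixP/(_ i j) := gap w z nw nz; rewrite !mxE.
  exact: Tc.
have nevE w z : nonreal w -> nonreal z -> nev_kernel m w z = T z w^*.
  move=> nw nz; have nwJ := nonrealJ nw; rewrite /nev_kernel; case: eqVneq => [zE|zw].
    by apply/matrixP => i j; rewrite mxE (dq z i j nz).2 -zE.
  by rewrite madj// gap// scalerA mulVf ?subr_eq0// scale1r.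
split=> //; split.
- by move=> i j z nz; exact: (dq z i j nz).1.
- by move=> z nz; rewrite madj.
- move=> n z u uz; have nz i := upper_nonreal (uz i).
  have := T0 n z u nz; congr (_ <= _).
  by apply: eq_bigr => i _; apply: eq_bigr => j _; rewrite nevE.
Qed.

End GapKernels.

(** * The transform of a compressed resolvent solves the problem *)

Section Forward.
Variable R : realType.
Local Notation C := R[i].
Local Notation CF := (R[i] : numFieldType).
Local Open Scope sesquilinear_scope.
Variables (d : nat) (H : completeNormedModType C) (ip : {dot H for conjC}).
Hypothesis ipn : norm_of_dot ip.
Variables (B : {linear H -> H}) (C1 C2 : {linear H -> 'cV[C]_d}).
Variables (C1p C2p : {linear 'cV[C]_d -> H}).
Hypotheses (C1a : is_adjoint ip (@cdot R d) C1 C1p)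
  (C2a : is_adjoint ip (@cdot R d) C2 C2p).
Hypothesis C2p_inj : forall u, C2p u = 0 -> u = 0.
Variable S0 : C -> {linear H -> H}.
Hypothesis S0P : selfadjoint_inverses ip (main_op B C2 C1p) S0.

Local Notation eL := (eL ip C1p C2p S0).
Local Notation eR := (eR ip C1p C2p S0).
Local Notation pencilL := (pencilL ip C2p S0).
Local Notation pencilR := (pencilR ip C2p S0).
Local Notation sigma := (sigma ip C2p S0).
Local Notation lft := (lft ip C1p C2p S0).
Local Notation state_kernel := (state_kernel ip C1p C2p S0).
Local Notation state_vector := (state_vector ip C1p C2p S0).

Lemma state_vector_linear F z : linear (state_vector F z).
Proof.
move=> a u v; rewrite /state_vector (linearP (mulmx (eR z^*))).
rewrite (linearP (mulmx (F z^*))) (linearP C1p) (linearP C2p).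
by rewrite opprD addrACA -scalerBr (linearP (S0 z^*)).
Qed.

Variable Q : C -> 'M[C]_d.
Hypothesis mQ : has_model (@nonreal R) Q.

Let Qadj z : nonreal z -> (Q z) ^t* = Q z^*.
Proof. by move=> nz; rewrite (model_adj mQ). Qed.

Lemma model_pencilL_unit z : nonreal z -> pencilL Q z \in unitmx.
Proof.
move=> nz; have [P [PE P0 _]] := model_gap mQ.
have nzJ := nonrealJ nz.
apply: (pencilL_unit S0P C2p_inj nz (Qadj nz) (PE _ _ nz nzJ)) => x.
exact: (nonneg_kernel_diag x P0 nz).
Qed.

Lemma model_pencilR_unit z : nonreal z -> pencilR Q z \in unitmx.
Proof.
move=> nz; have nzJ := nonrealJ nz; rewrite -[z]conjCK.
rewrite -(pencilL_adj C2p S0P nzJ (Qadj nzJ)) adjmx_unit.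
exact: model_pencilL_unit.
Qed.

Lemma model_sigma_adj z : nonreal z -> (sigma Q z) ^t* = sigma Q z^*.
Proof.
move=> nz; have nzJ := nonrealJ nz.
rewrite (sigmaR (model_pencilL_unit nzJ) (model_pencilR_unit nzJ)) /sigma.
by rewrite adjmxM adjmx_inv (pencilL_adj C2p S0P nz (Qadj nz)) (Qadj nz).
Qed.

Let A z : 'M[C]_d := eL z *m invmx (pencilL Q z).

Let A_adj z : nonreal z -> (A z) ^t* = invmx (pencilR Q z^*) *m eR z^*.
Proof.
move=> nz; rewrite /A adjmxM adjmx_inv (pencilL_adj C2p S0P nz (Qadj nz)).
by rewrite (eL_adj C2p S0P nz).
Qed.

Theorem model_solution :
  let m := lft (sigma Q) in
  nevanlinna m /\
  exists (Hm : completeNormedModType C) (ipm : {dot Hm for conjC})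
    (ev : C -> {linear Hm -> 'cV[C]_d}),
    is_rkhs (@nonreal R) (nev_kernel m) ipm ev /\
    exists F : {linear H -> Hm},
      (forall x z, nonreal z ->
         ev z (F x) - z *: ev z (F (B x)) = C1 x - m z *m C2 x) /\
      (forall x, ipm (F x) (F x) <= ip x x).
Proof.
move=> m; have [P [PE P0 Pc]] := model_gap mQ; pose F := sigma Q.
have Fadj z : nonreal z -> (F z) ^t* = F z^* by exact: model_sigma_adj.
(* The part of N^m contributed by Q, a congruence of its gap kernel P. It is the excess of N^m over
   the Gram kernel, and its nonnegativity makes the map into H(m) a contraction. *)
pose D z w := A z *m P z w *m (invmx (pencilR Q w) *m eR w).
pose T z w := state_kernel F z w + D z w.
have madj z : nonreal z -> (m z) ^t* = m z^*.
  by move=> nz; rewrite /m (lft_adj C2p S0P nz (Fadj z nz)).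
have gap z w : nonreal z -> nonreal w -> m z - m w = (z - w) *: T z w.
  move=> nz nw.
  have := sigma_gap S0P nz nw (model_pencilL_unit nz) (model_pencilL_unit nw)
    (model_pencilR_unit nw) (PE _ _ nz nw).
  move=> /(lft_gap C2p S0P nz nw); rewrite /m => ->; congr (_ *: (_ + _)).
  by rewrite addrK /D /A !mulmxA.
have Tc z w i j : nonreal z -> nonreal w ->
    T v w i j @[v --> (z : CF)] --> (T z w i j : CF).
  move=> nz nw; have LA := continuous_local_algebra (z : CF).
  have Qc : la_mx (fun f => f v @[v --> (z : CF)] --> f z) Q.
    by move=> k l; exact: (model_cvg mQ).
  have Mc (a b : {linear 'cV[C]_d -> H}) :
      la_mx (fun f => f v @[v --> (z : CF)] --> f z) (transfer ip S0 a b).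
    by move=> k l; exact: (transfer_cvg S0P).
  have M2c (a b : {linear 'cV[C]_d -> H}) : la_mx (fun f => f v @[v --> (z : CF)] --> f z)
      (transfer2 ip S0 a b ^~ w).
    by move=> k l; exact: (transfer2_cvg S0P).
  have ic : la_mx (fun f => f v @[v --> (z : CF)] --> f z)
      (fun v => invmx (pencilL Q v)).
    apply: (la_invmx LA (la_pencil LA Qc (Mc C2p C2p))).
    by apply: filterS (near_nonreal nz) => v nv; exact: model_pencilL_unit.
  have Pcw : la_mx (fun f => f v @[v --> (z : CF)] --> f z) (P ^~ w).
    by move=> k l; exact: Pc.
  exact: (la_gap LA (sigma Q w) (eR w) (invmx (pencilR Q w)) (M2c C1p C1p)
    (la_copencil LA (Mc C1p C2p)) (la_mxM LA ic Qc) (M2c C2p C1p) (M2c C1p C2p)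
    (M2c C2p C2p) ic Pcw).
have DE w z : nonreal w -> D z w^* = A z *m P z w^* *m (A w) ^t*.
  by move=> nw; rewrite A_adj.
have D0 : nonneg_kernel (@nonreal R) (fun w z => D z w^*).
  apply: nonneg_kernel_eq (nonneg_kernel_congr A P0) => w z nw nz.
  by rewrite DE.
have SE w z u v : nonreal w -> nonreal z ->
    cdot (state_kernel F z w^* *m u) v =
    ip (state_vector F w u) (state_vector F z v).
  by move=> nw nz; exact: (state_kernelE C2p S0P u v nz nw (Fadj z nz)).
have T0 := nonneg_kernelD (nonneg_kernel_gram SE) D0.
have [nm nevE] := gap_nevanlinna madj gap Tc T0.
split=> //.
have k0 : nonneg_kernel (@nonreal R) (nev_kernel m).
  by apply: nonneg_kernel_eq T0 => w z nw nz; rewrite nevE.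
eexists _, rkhs_ip, (kernel_eval k0); split; first exact: (kernel_space_rkhs k0).
pose g z := to_linear (state_vector_linear F z).
have [|f [fE fc]] := @kernel_space_contraction _ _ _ _ k0 _ ip g
    (fun w z => state_kernel F z w^*) ipn SE.
  by apply: nonneg_kernel_eq D0 => w z nw nz; rewrite nevE// addrC addKr.
exists f; split=> [x z nz|x]; last first.
  rewrite (ipxx (@rkhs_ipn _ _ _)) (ipxx ipn) lecR.
  by rewrite ler_pXn2r ?nnegrE ?rnorm_ge0.
have -> : kernel_eval k0 z (f x) - z *: kernel_eval k0 z (f (B x)) =
    kernel_eval k0 z (f (x - z *: B x)).
  rewrite (linearB f) (linearB (kernel_eval k0 z)); congr (_ - _).
  by rewrite linearZ linearZ.
apply: cdot_extl => u; rewrite fE// /g /=.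
rewrite (state_vectorE C1a C2a S0P F u x nz) cdotBl (cdot_adjmx (m z)).
by rewrite madj.
Qed.

End Forward.

Lemma pencil_mulmx (K : fieldType) (d : nat) (z : K) (Q M A : 'M[K]_d) :
  (1%:M + z *: Q) *m A - z *: (M *m (Q *m A)) =
  (1%:M + z *: Q - z *: (M *m Q)) *m A.
Proof. by rewrite [RHS]mulmxBl -scalemxAl mulmxA. Qed.

Section PairTransform.
Variable R : realType.
Local Notation C := R[i].
Local Open Scope sesquilinear_scope.
Variables (d : nat) (H : completeNormedModType C) (ip : {dot H for conjC}).
Variables (B : {linear H -> H}) (C1 C2 : {linear H -> 'cV[C]_d}).
Variables (C1p C2p : {linear 'cV[C]_d -> H}).
Hypotheses (C1a : is_adjoint ip (@cdot R d) C1 C1p)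
  (C2a : is_adjoint ip (@cdot R d) C2 C2p).
Hypothesis C2p_inj : forall u, C2p u = 0 -> u = 0.
Variable S0 : C -> {linear H -> H}.
Hypothesis S0P : selfadjoint_inverses ip (main_op B C2 C1p) S0.

(** By [regular_lft], eR times the denominator is [pencilR] times p - z q, a product of invertible
    matrices, so the denominator is invertible and can be cancelled. *)
Lemma pair_lft (pq : mxpair R d) z : nevanlinna_pair pq -> nonreal z ->
  regular_point ip B z ->
  let Th := Theta ip B C1 C2 C1p C2p z in
  lft_den Th (pq.1 z) (pq.2 z) \in unitmx /\
  lft_num Th (pq.1 z) (pq.2 z) *m invmx (lft_den Th (pq.1 z) (pq.2 z)) =
  lft ip C1p C2p S0 (sigma ip C2p S0 (pair_fraction pq)) z.
Proof.
move=> npq nz rz Th.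
have [e1 e2] := regular_lft C1a C2a S0P (pq.1 z) (pq.2 z) nz rz.
have chiu : pq.1 z - z *: pq.2 z \in unitmx by case: (pq) npq => p q [_ _ _]; exact.
have mQ := pair_fraction_model npq.
have uL := model_pencilL_unit C2p_inj S0P mQ nz.
have uR := model_pencilR_unit C2p_inj S0P mQ nz.
have [p1 q1] := pair_fractionE npq nz.
have eD : eR ip C1p C2p S0 z *m lft_den Th (pq.1 z) (pq.2 z) =
    pencilR ip C2p S0 (pair_fraction pq) z *m (pq.1 z - z *: pq.2 z).
  by rewrite e1 {1}q1 {1}p1 pencil_mulmx.
move: e2 q1; move: (pq.1 z - z *: pq.2 z) chiu eD => chi chiu eD e2 q1.
have uD : lft_den Th (pq.1 z) (pq.2 z) \in unitmx.
  by apply: (@unitmxMr _ _ (eR ip C1p C2p S0 z)); rewrite eD unitmx_mul uR.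
move: (lft_den Th _ _) (lft_num Th _ _) eD e2 uD => D N eD e2 uD.
split=> //; rewrite e2 q1 /lft (sigmaR uL uR) addrC mulmxDl.
congr (_ + _).
  by rewrite -scalemxAl (mulmxK uD).
rewrite -!mulmxA; congr (_ *m (_ *m _)).
have chiE : chi = invmx (pencilR ip C2p S0 (pair_fraction pq) z) *m
    (eR ip C1p C2p S0 z *m D) by rewrite eD (mulKmx uR).
by rewrite chiE; congr (_ *m _); rewrite mulmxA (mulmxK uD).
Qed.

End PairTransform.

(** * The identity theorem for Nevanlinna functions *)

Section NevanlinnaIdentity.
Variable R : realType.
Local Notation C := R[i].
Local Notation CF := (R[i] : numFieldType).
Local Open Scope sesquilinear_scope.
Variable d : nat.
Implicit Type m : C -> 'M[C]_d.

Lemma nev_kernel_upper m w z : upper w -> upper z ->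
  nev_kernel m w z = (z - w^*)^-1 *: (m z - (m w) ^t*).
Proof.
by move=> uw uz; rewrite /nev_kernel -subr_eq0 (negbTE (upper_subJ uz uw)).
Qed.

(** If m(z) u = - z u with z in the upper half-plane, the kernel at (z, z) takes the value -|u|^2 at
    u; the lower half-plane follows by taking adjoints. *)
Lemma nevanlinna_pencil_unit m z : nevanlinna m -> nonreal z ->
  m z + z%:M \in unitmx.
Proof.
move=> [_ madj m0].
have up z' : upper z' -> m z' + z'%:M \in unitmx.
  move=> uz; apply: unitmx_ker => u; rewrite mulmxDl => /eqP.
  rewrite addr_eq0 mul_scalar_mx => /eqP mu; apply: cdot_le0.
  have := nonneg_kernel_diag u m0 uz; rewrite nev_kernel_upper//.
  rewrite -scalemxAl cdotZl mulmxBl cdotBl (cdot_adjmx (_ ^t*)) adjmxK mu.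
  rewrite cdotNl cdotNr cdotZl cdotZr; move: (upper_subJ uz uz).
  move: (z'^*) (cdot u u) => c s zc.
  have -> : - (z' * s) - - (c * s) = - ((z' - c) * s) by ring.
  by rewrite mulrN (mulKf zc) oppr_ge0.
move=> nz; have [//|uz] := nonreal_upper nz; first exact: up.
rewrite -adjmx_unit adjmxD -madj// (_ : _%:M ^t* = z^*%:M) ?up//.
by rewrite tr_scalar_mx map_scalar_mx.
Qed.

(** The fraction of this pair is -(m + z)^-1, so m is recovered from a compressed resolvent. The
    sign of the second entry fits the order of p and q in the pair kernel. *)
Lemma nevanlinna_pair_of m : nevanlinna m ->
  nevanlinna_pair (m, fun=> - 1%:M : 'M[C]_d).
Proof.
move=> nm; have [mh madj m0] := nm; split.
- split=> [|i j z nz]; first exact: mh.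
  exact: (la_cst (derivable_local_algebra (z : CF)) ((- 1%:M : 'M[C]_d) i j)).
- apply: nonneg_kernel_eq m0 => w z uw uz.
  have [nw nz] := (upper_nonreal uw, upper_nonreal uz).
  rewrite nev_kernel_upper// /pair_kernel; congr (_ *: _).
  rewrite adjmxN adjmx1 mulNmx mul1mx mulmxN mulmx1 opprK (madj _ nz) adjmxK.
  by rewrite (madj _ nw) addrC.
- move=> z nz; rewrite adjmxN adjmx1 mulNmx mul1mx mulmxN mulmx1 opprK.
  by rewrite (madj _ nz) adjmxK addNr.
- move=> z nz; rewrite scalerN opprK scalemx1.
  exact: nevanlinna_pencil_unit.
Qed.

Lemma nevanlinna_identity m m' (z0 : C) (r : R) : nevanlinna m ->
  nevanlinna m' -> upper z0 -> 0 < r ->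
  (forall z, upper z -> rnorm (z - z0) < r -> m z = m' z) -> eq_nonreal m m'.
Proof.
move=> nm nm' uz0 r0 mm'.
have M := pair_fraction_model (nevanlinna_pair_of nm).
have M' := pair_fraction_model (nevanlinna_pair_of nm').
have := model_identity M M' uz0 r0 _.
have h z : upper z -> rnorm (z - z0) < r ->
    pair_fraction (m, fun=> - 1%:M) z = pair_fraction (m', fun=> - 1%:M) z.
  by move=> uz hz; rewrite /pair_fraction /= mm'.
move=> /(_ h) E z nz; have := E z nz.
rewrite /pair_fraction /= !mulNmx !mul1mx => /oppr_inj /(congr1 invmx).
by rewrite !invmxK => /addIr.
Qed.

End NevanlinnaIdentity.

(** * From solutions to pairs *)

Section InverseTransform.
Variables (K : fieldType) (d : nat) (z w : K).

Lemma copencil_sub_identity (S S' M M' : 'M[K]_d) :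
  S *m (1%:M - w *: S' + w *: (M' *m S')) -
    (1%:M - z *: S + z *: (S *m M)) *m S' =
  (S - S') + (z - w) *: (S *m S') - S *m (z *: M - w *: M') *m S'.
Proof. by mx_ring. Qed.

Lemma copencil_gap_identity (c : K) (S S' P r : 'M[K]_d) :
  c *: P + c *: (S *m S') - S *m (c *: r) *m S' =
  c *: (P - S *m r *m S' + S *m S').
Proof. by mx_ring. Qed.

Lemma pencil_complement (Q M : 'M[K]_d) :
  (1%:M + z *: Q - z *: (Q *m M)) - z *: Q + z *: (Q *m M) = 1%:M.
Proof. by rewrite addrAC subrK addrK. Qed.

(* With E and E' the copencils of S and S', the resolvent kernel of E^-1 S is
   congruent to that of S reduced by the state space part. *)
Lemma copencil_resolvent (S S' M M' P r : 'M[K]_d) (E E' : 'M[K]_d) :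
  E = 1%:M - z *: S + z *: (S *m M) -> E' = 1%:M - w *: S' + w *: (M' *m S') ->
  E \in unitmx -> E' \in unitmx -> z - w != 0 ->
  S - S' = (z - w) *: P -> z *: M - w *: M' = (z - w) *: r ->
  (z - w)^-1 *: (invmx E *m S - S' *m invmx E') -
    (invmx E *m S) *m (S' *m invmx E') =
  invmx E *m (P - S *m r *m S') *m invmx E'.
Proof.
move=> EE EE' uE uE' zw SP Mr; rewrite (invmx_gap _ _ uE uE').
have -> : S *m E' - E *m S' = (z - w) *: (P - S *m r *m S' + S *m S').
  by rewrite EE EE' copencil_sub_identity SP Mr copencil_gap_identity.
rewrite -scalemxAr -scalemxAl (scalerK zw) mulmxDr mulmxDl !mulmxA.
by rewrite addrK.
Qed.

End InverseTransform.

Section Contraction.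
Variable R : realType.
Local Notation C := R[i].
Local Open Scope sesquilinear_scope.
Variables (H : completeNormedModType C) (ip : {dot H for conjC}).
Hypothesis ipn : norm_of_dot ip.
Variables (X : Type) (f : X -> H).
Hypothesis df : dense (range f).

Lemma dense_dual_le (g : H) (c : R) : 0 <= c ->
  (forall h, rnorm (ip (f h) g) <= rnorm (f h) * c) -> rnorm g <= c.
Proof.
move=> c0 hc; rewrite leNgt; apply/negP => cg.
have g0 : 0 < rnorm g by exact: le_lt_trans cg.
(* Approximating g within e gives |g|^2 <= c |g| + e (|g| + c); this e is half of what that
   inequality requires. *)
pose e := rnorm g * (rnorm g - c) / (2 * (rnorm g + c)).
have gc : 0 < 2 * (rnorm g + c) by lra.
have e0 : 0 < e by rewrite divr_gt0// mulr_gt0// subr_gt0.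
have [h hh] := denseP df g e0.
have h1 : rnorm g ^+ 2 <= rnorm (g - f h) * rnorm g + rnorm (f h) * c.
  rewrite -(Re_ipxx ipn); apply: le_trans (real_ler_norm (num_real _)) _.
  apply: le_trans (rnormRe _) _.
  have -> : ip g g = ip (g - f h) g + ip (f h) g by rewrite ipBl subrK.
  apply: le_trans (rnormD _ _) _.
  by rewrite lerD//; exact: cauchy_schwarz.
have h2 : rnorm (f h) <= rnorm g + rnorm (g - f h).
  have {1}-> : f h = g - (g - f h) by rewrite opprB addrC subrK.
  exact: rnormB.
have h3 : e * (2 * (rnorm g + c)) = rnorm g * (rnorm g - c).
  by rewrite /e divfK// gt_eqF.
have := rnorm_ge0 (g - f h); nra.
Qed.

End Contraction.

Section Adjoints.
Variables (R : realType) (d : nat).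
Local Open Scope sesquilinear_scope.
Implicit Types A U V : 'M[R[i]]_d.

Lemma adjmx_sandwich U A V U' A' V' : U ^t* = U' -> A ^t* = A' -> V ^t* = V' ->
  (invmx U *m A *m invmx V) ^t* = invmx V' *m A' *m invmx U'.
Proof. by move=> <- <- <-; rewrite adjmxM adjmxM !adjmx_inv mulmxA. Qed.

Lemma adjmx_subZ A U (z : R[i]) : (A - z *: U) ^t* = A ^t* - z^* *: U ^t*.
Proof. by rewrite adjmxD adjmxN adjmxZ. Qed.

End Adjoints.

(** * A solution is the transform of a compressed resolvent *)

Section Backward.
Variable R : realType.
Local Notation C := R[i].
Local Open Scope sesquilinear_scope.
Variables (d : nat) (H : completeNormedModType C) (ip : {dot H for conjC}).
Hypothesis ipn : norm_of_dot ip.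
Variables (B : {linear H -> H}) (C1 C2 : {linear H -> 'cV[C]_d}).
Variables (C1p C2p : {linear 'cV[C]_d -> H}).
Hypotheses (C1a : is_adjoint ip (@cdot R d) C1 C1p)
  (C2a : is_adjoint ip (@cdot R d) C2 C2p).
Hypothesis C2p_inj : forall u, C2p u = 0 -> u = 0.
Variable S0 : C -> {linear H -> H}.
Hypothesis S0P : selfadjoint_inverses ip (main_op B C2 C1p) S0.

Local Notation eL := (eL ip C1p C2p S0).
Local Notation eR := (eR ip C1p C2p S0).
Local Notation copencilL := (copencilL ip C2p S0).
Local Notation sigma := (sigma ip C2p S0).
Local Notation lft := (lft ip C1p C2p S0).
Local Notation state_kernel := (state_kernel ip C1p C2p S0).
Local Notation state_vector := (state_vector ip C1p C2p S0).
Local Notation M11 := (transfer ip S0 C1p C1p).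
Local Notation M22 := (transfer ip S0 C2p C2p).
Local Notation r22 := (transfer2 ip S0 C2p C2p).

Definition unlft (m : C -> 'M[C]_d) (z : C) : 'M[C]_d :=
  invmx (eL z) *m (m z - z *: M11 z) *m invmx (eR z).

Lemma unlftK m z : eL z \in unitmx -> eR z \in unitmx -> lft (unlft m) z = m z.
Proof.
move=> uL uR; rewrite /lft /unlft -(mulmxA (invmx _)) (mulKVmx uL) (mulmxKV uR).
by rewrite addrC subrK.
Qed.

Lemma lftK F z : eL z \in unitmx -> eR z \in unitmx -> unlft (lft F) z = F z.
Proof.
move=> uL uR; rewrite /unlft /lft addrAC subrr add0r -(mulmxA (eL z)).
by rewrite (mulKmx uL) (mulmxK uR).
Qed.

Lemma unlft_adj m z : nonreal z -> (m z) ^t* = m z^* ->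
  (unlft m z) ^t* = unlft m z^*.
Proof.
move=> nz mz; apply: (adjmx_sandwich (eL_adj C2p S0P nz) _ (eR_adj C2p S0P nz)).
by rewrite adjmx_subZ (transfer_adj S0P _ _ nz) mz.
Qed.

Lemma lft_congr F G z : F z = G z -> lft F z = lft G z.
Proof. by move=> FG; rewrite /lft FG. Qed.

Variables (X : lmodType C) (iota : {linear X -> H}) (B1 : {linear X -> X}).
Hypotheses (iota_dense : dense (range iota))
  (B1E : forall h, B (iota h) = iota (B1 h)).
Hypothesis Bb : bounded_op ip ip B.
Variables (m : C -> 'M[C]_d) (Hm : completeNormedModType C)
  (ipm : {dot Hm for conjC}) (ev : C -> {linear Hm -> 'cV[C]_d}).
Hypotheses (nm : nevanlinna m)
  (Hm_rkhs : is_rkhs (@nonreal R) (nev_kernel m) ipm ev).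
Variable F : {linear X -> Hm}.
Hypotheses
  (FE : forall h z, nonreal z ->
    ev z (F h) - z *: ev z (F (B1 h)) = C1 (iota h) - m z *m C2 (iota h))
  (F_le : forall h, ipm (F h) (F h) <= ip (iota h) (iota h)).

Let ipmn : norm_of_dot ipm. Proof. by case: Hm_rkhs. Qed.

Lemma solution_le h : rnorm (F h) <= rnorm (iota h).
Proof.
have := F_le h; rewrite (ipxx ipmn) (ipxx ipn) lecR.
by rewrite ler_pXn2r ?nnegrE ?rnorm_ge0.
Qed.

Definition regular_pair : set C :=
  [set z | [/\ nonreal z, regular_point ip B z & regular_point ip B z^*]].

Lemma regular_pairJ z : regular_pair z -> regular_pair z^*.
Proof. by move=> [nz rz rzJ]; split; rewrite ?conjCK//; exact: nonrealJ. Qed.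

Let uL z : regular_pair z -> eL z \in unitmx.
Proof. by move=> [nz rz rzJ]; exact: (eL_unit C2a S0P nz rzJ). Qed.
Let uR z : regular_pair z -> eR z \in unitmx.
Proof. by move=> [nz rz rzJ]; exact: (eR_unit C2a S0P nz rz). Qed.

Let S := unlft m.

Let madj z : nonreal z -> (m z) ^t* = m z^*.
Proof. by move=> nz; have [_ /(_ z nz) ->] := nm. Qed.

Let Sadj z : nonreal z -> (S z) ^t* = S z^*.
Proof. by move=> nz; exact: (unlft_adj nz (madj nz)). Qed.

(* The functions in the range of F are determined by their values because
   (I - z B) X is dense in H. *)
Lemma solution_dual z u k : regular_pair z ->
  (forall g, ipm g k = cdot (ev z g) u) ->
  forall h, ipm (F h) k = ip (iota h) (state_vector S z u).
Proof.
move=> rz kE h; have [nz rpz rzJ] := rz; have [b Bbx] := bounded_op_rnorm ipn Bb.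
set s := state_vector S z u.
pose T (g : X) := g - z *: B1 g.
have TE g : iota (T g) = iota g - z *: B (iota g).
  by rewrite /T B1E linearB linearZ.
have key g : ipm (F (T g)) k = ip (iota (T g)) s.
  rewrite TE (state_vectorE C1a C2a S0P S u (iota g) nz) kE.
  rewrite (unlftK _ (uL (regular_pairJ rz)) (uR (regular_pairJ rz))).
  rewrite -(madj nz) -cdot_adjmx -cdotBl -FE//; congr (cdot _ u).
  by rewrite /T (linearB F) (linearB (ev z)); congr (_ - _); rewrite !linearZ.
apply/subr0_eq/eqP/negP => /negP nz0; have p0 := rnorm_gt0 nz0.
set c := ipm (F h) k - _ in nz0 p0.
pose K := (1 + rnorm z * `|b|) * (rnorm k + rnorm s) + 1.
have K0 : 0 < K by rewrite ltr_pwDr// mulr_ge0 ?addr_ge0 ?mulr_ge0 ?rnorm_ge0.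
have [Sz [_ _ SzE]] := rpz.
(* [iota g] approximates the preimage of [iota h] under 1 - z B, so [iota (T g)] approximates
   [iota h]; K collects the bounds of B and of both functionals. *)
have [g hg] := denseP iota_dense (Sz (iota h)) (divr_gt0 p0 K0).
have hT : rnorm (iota (h - T g)) <= (1 + rnorm z * `|b|) * rnorm (Sz (iota h) - iota g).
  set y := Sz (iota h) - iota g.
  have -> : iota (h - T g) = y - z *: B y.
    rewrite (linearB iota) TE -{1}[iota h]SzE /y (linearB B) scalerBr.
    by rewrite !opprD !opprK addrACA.
  apply: le_trans (rnormB _ _) _; rewrite mulrDl mul1r lerD// rnormZ -mulrA.
  rewrite ler_wpM2l ?rnorm_ge0//; apply: le_trans (Bbx y) _.
  by rewrite ler_wpM2r ?rnorm_ge0// ler_norm.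
have cE : c = ipm (F (h - T g)) k - ip (iota (h - T g)) s.
  rewrite /c (linearB F) (linearB iota) !ipBl key.
  by rewrite opprB addrA subrK.
have cle : rnorm c <= rnorm (iota (h - T g)) * (rnorm k + rnorm s).
  rewrite cE; apply: le_trans (rnormB _ _) _; rewrite mulrDr lerD//.
    apply: le_trans (cauchy_schwarz ipmn _ _) _.
    by rewrite ler_wpM2r ?rnorm_ge0// solution_le.
  exact: cauchy_schwarz.
move: hg; rewrite ltr_pdivlMr// => hg.
have := rnorm_ge0 k; have := rnorm_ge0 s => s0 k0.
have ks : 0 <= rnorm k + rnorm s by exact: addr_ge0.
have := le_lt_trans (le_trans cle (ler_wpM2r ks hT)) _.
have q0 := rnorm_ge0 (Sz (iota h) - iota g).
suff h1 : (1 + rnorm z * `|b|) * rnorm (Sz (iota h) - iota g) *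
    (rnorm k + rnorm s) < rnorm c by move=> /(_ _ h1); rewrite ltxx.
apply: le_lt_trans hg; rewrite mulrAC mulrC ler_wpM2l//.
by rewrite /K lerDl.
Qed.

Section RegularDisc.
Variable Om : set C.
Hypotheses (Om_upper : forall z, Om z -> upper z)
  (Om_regular : forall z, Om z -> regular_pair z).

(** The sum f of kernel vectors, through F, and the sum g of state vectors, through [iota], induce
    the same functional on X. F is contractive, so |g| <= |f|, and the difference of the squared
    norms is the quadratic form in question. *)
Lemma solution_gap : nonneg_kernel (Om)
  (fun w z => nev_kernel m w z - state_kernel S z w^*).
Proof.
move=> n z u Oz; have nz i := upper_nonreal (Om_upper (Oz i)).
have [_ _ kv] := Hm_rkhs.
have /choice[k kE] i := kv (z i) (u i) (nz i).
pose f := \sum_i k i; pose g := \sum_i state_vector S (z i) (u i).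
have dual h : ipm (F h) f = ip (iota h) g.
  rewrite !ip_sumr; apply: eq_bigr => i _.
  exact: (solution_dual (Om_regular (Oz i)) (kE i).2).
have gf : rnorm g <= rnorm f.
  apply: (dense_dual_le ipn iota_dense (rnorm_ge0 f)) => h; rewrite -dual.
  apply: le_trans (cauchy_schwarz ipmn _ _) _.
  by rewrite ler_wpM2r ?rnorm_ge0// solution_le.
have -> : \sum_i \sum_j cdot ((nev_kernel m (z j) (z i) -
    state_kernel S (z i) (z j)^*) *m u j) (u i) = ipm f f - ip g g.
  rewrite {2}/f {2}/g !ip_sumr -sumrB; apply: eq_bigr => i _.
  rewrite /f /g !ip_suml -sumrB; apply: eq_bigr => j _.
  rewrite mulmxBl cdotBl (kE i).2 (kE j).1//.
  by rewrite (state_kernelE C2p S0P _ _ (nz i) (nz j) (Sadj (nz i))).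
rewrite (ipxx ipmn) (ipxx ipn) subr_ge0 lecR.
by rewrite ler_pXn2r ?nnegrE ?rnorm_ge0.
Qed.

Let K w z := (z - w^*)^-1 *: (S z - S w^*).
(** By [lft_gap] this is, up to congruence by eL, what N^m has beyond the Gram kernel. *)
Let Y w z := K w z - S z *m r22 z w^* *m S w^*.

Let KE w z : upper w -> upper z -> S z - S w^* = (z - w^*) *: K w z.
Proof. by move=> uw uz; rewrite /K (scalerKV (upper_subJ uz uw)). Qed.

Lemma solution_gapE w z : Om w -> Om z ->
  nev_kernel m w z - state_kernel S z w^* = eL z *m Y w z *m (eL w) ^t*.
Proof.
move=> Ow Oz; have [uw uz] := ((Om_upper Ow), (Om_upper Oz)).
have [nw nz] := (upper_nonreal uw, upper_nonreal uz).
have [rw rz] := (Om_regular Ow, Om_regular Oz).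
have rwJ := regular_pairJ rw.
have := lft_gap C2p S0P nz (nonrealJ nw) (KE uw uz).
rewrite (unlftK _ (uL rz) (uR rz)) (unlftK _ (uL rwJ) (uR rwJ)) => mE.
rewrite (nev_kernel_upper _ uw uz) (madj nw) mE (scalerK (upper_subJ uz uw)).
by rewrite addrC addKr (eL_adj C2p S0P nw).
Qed.

Lemma reduced_kernel_ge0 : nonneg_kernel (Om) Y.
Proof.
apply: nonneg_kernel_eq
  (nonneg_kernel_congr (fun z => invmx (eL z)) solution_gap) => w z Ow Oz.
have uw : (eL w) ^t* \in unitmx by rewrite adjmx_unit (uL (Om_regular Ow)).
rewrite (solution_gapE Ow Oz) adjmx_inv -(mulmxA (eL z)).
by rewrite (mulKmx (uL (Om_regular Oz))) (mulmxK uw).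
Qed.

Lemma solution_copencil_unit z : Om z -> copencilL S z \in unitmx.
Proof.
move=> Oz; have uz := (Om_upper Oz); have nz := upper_nonreal uz.
apply: (copencilL_unit S0P nz (Sadj nz) (KE uz uz)) => x.
exact: (nonneg_kernel_diag x reduced_kernel_ge0 Oz).
Qed.

Lemma solution_resolvent_kernel :
  nonneg_kernel (Om) (resolvent_kernel (fun z => invmx (copencilL S z) *m S z)).
Proof.
apply: nonneg_kernel_eq (nonneg_kernel_congr
  (fun z => invmx (copencilL S z)) reduced_kernel_ge0) => w z Ow Oz.
have [nw nz] := (upper_nonreal (Om_upper Ow), upper_nonreal (Om_upper Oz)).
have uw : (copencilL S w) ^t* \in unitmx.
  by rewrite adjmx_unit (solution_copencil_unit Ow).
have E : (copencilL S w) ^t* =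
    1%:M - w^* *: S w^* + w^* *: (M22 w^* *m S w^*).
  by rewrite /copencilL copencil_adj (transfer_adj S0P _ _ nw) (Sadj nw).
rewrite /resolvent_kernel adjmxM adjmx_inv (Sadj nw).
exact/esym/(copencil_resolvent erefl E (solution_copencil_unit Oz) uw
  (upper_subJ (Om_upper Oz) (Om_upper Ow)) (KE (Om_upper Ow) (Om_upper Oz))
  (transfer_sub S0P C2p C2p nz (nonrealJ nw))).
Qed.

End RegularDisc.

Theorem solution_model :
  exists Q, has_model (@nonreal R) Q /\ eq_nonreal (lft (sigma Q)) m.
Proof.
have [z0 [r [uz0 r0 reg]]] := regular_disc ipn Bb.
pose Om : set C := [set z | upper z /\ rnorm (z - z0) < r].
have Ou z : Om z -> upper z by case.
have Or z : Om z -> regular_pair z.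
  by move=> [uz /reg[rz rzJ]]; split=> //; exact: upper_nonreal.
have Om0 : Om !=set0 by exists z0; split=> //; rewrite subrr rnorm0.
have := resolvent_model Ou Om0 (solution_resolvent_kernel Ou Or).
move=> /model_extension[Q [mQ QE]]; exists Q; split=> //.
(* The forward direction makes the transform of Q a Nevanlinna function, as the identity theorem
   requires. *)
have [nmQ _] := model_solution ipn C1a C2a C2p_inj S0P mQ.
apply: (nevanlinna_identity nmQ nm uz0 r0) => z uz hz.
have Oz : Om z by []; have rz := Or z Oz.
have [_ sS] := copencil_sigma (solution_copencil_unit Ou Or Oz).
rewrite -(unlftK m (uL rz) (uR rz)); apply: lft_congr.
by rewrite -[RHS]sS /sigma /pencilL (QE z Oz).
Qed.

End Backward.

(** * Equivalence of pairs and uniqueness *)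

Section Uniqueness.
Variable R : realType.
Local Notation C := R[i].
Local Notation CF := (R[i] : numFieldType).
Local Open Scope sesquilinear_scope.
Variables (d : nat).

Lemma pair_chi_unit (pq : mxpair R d) z : nevanlinna_pair pq -> nonreal z ->
  pq.1 z - z *: pq.2 z \in unitmx.
Proof. by case: pq => p q [_ _ _]; exact. Qed.

Lemma pair_holomorphic (pq : mxpair R d) : nevanlinna_pair pq ->
  holomorphic_mx pq.1 /\ holomorphic_mx pq.2.
Proof. by case: pq => p q []. Qed.

Lemma equiv_pairP (pq pq1 : mxpair R d) : nevanlinna_pair pq ->
  nevanlinna_pair pq1 ->
  equiv_pair pq pq1 <-> eq_nonreal (pair_fraction pq) (pair_fraction pq1).
Proof.
move=> npq npq1; split=> [[chi [_ uchi pE qE]] z nz|QE].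
  have u := pair_chi_unit npq nz; have u1 := pair_chi_unit npq1 nz.
  apply: (canRL (mulmxK u1)); rewrite pE// qE// /pair_fraction.
  by rewrite scalemxAl -mulmxBl mulmxA (mulmxKV u).
(* With p = (1 + z Q)(p - z q) and q = Q (p - z q), pairs with the same Q differ by the quotient of
   their factors p - z q. *)
exists (fun z => invmx (pq.1 z - z *: pq.2 z) *m (pq1.1 z - z *: pq1.2 z)).
have [h1 h2] := pair_holomorphic npq; have [k1 k2] := pair_holomorphic npq1.
split.
- move=> i j z nz; have LA := derivable_local_algebra (z : CF).
  have la (pr : mxpair R d) : holomorphic_mx pr.1 -> holomorphic_mx pr.2 ->
      la_mx (fun f => derivable (f : CF^o -> CF^o) (z : CF) 1)
        (fun w => pr.1 w - w *: pr.2 w).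
    move=> hp hq; apply: (la_mxB LA); first by move=> k l; exact: hp.
    by apply: (la_mxZ LA (la_id LA)) => k l; exact: hq.
  have lc := la pq h1 h2; have lc1 := la pq1 k1 k2.
  apply: (la_mxM LA _ lc1); apply: (la_invmx LA lc).
  by apply: filterS (near_nonreal nz) => w nw; exact: pair_chi_unit.
- by move=> z nz; rewrite unitmx_mul unitmx_inv !pair_chi_unit.
- move=> z nz; have [p1 _] := pair_fractionE npq1 nz.
  have [p0 _] := pair_fractionE npq nz.
  rewrite {1}p1 {1}p0 -(QE z nz) -mulmxA; congr (_ *m _).
  by rewrite mulmxA (mulmxV (pair_chi_unit npq nz)) mul1mx.
- move=> z nz; have [_ q1] := pair_fractionE npq1 nz.
  have [_ q0] := pair_fractionE npq nz.
  rewrite {1}q1 {1}q0 -(QE z nz) -mulmxA; congr (_ *m _).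
  by rewrite mulmxA (mulmxV (pair_chi_unit npq nz)) mul1mx.
Qed.

Variables (H : completeNormedModType C) (ip : {dot H for conjC}).
Hypothesis ipn : norm_of_dot ip.
Variables (B : {linear H -> H}) (C1 C2 : {linear H -> 'cV[C]_d}).
Variables (C1p C2p : {linear 'cV[C]_d -> H}).
Hypotheses (C1a : is_adjoint ip (@cdot R d) C1 C1p)
  (C2a : is_adjoint ip (@cdot R d) C2 C2p).
Hypothesis C2p_inj : forall u, C2p u = 0 -> u = 0.
Variable S0 : C -> {linear H -> H}.
Hypothesis S0P : selfadjoint_inverses ip (main_op B C2 C1p) S0.
Hypothesis Bb : bounded_op ip ip B.

Local Notation pencilL := (pencilL ip C2p S0).
Local Notation copencilL := (copencilL ip C2p S0).
Local Notation sigma := (sigma ip C2p S0).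
Local Notation lft := (lft ip C1p C2p S0).

Lemma sigma_congr Q Q' z : Q z = Q' z -> sigma Q z = sigma Q' z.
Proof. by move=> QQ; rewrite /sigma /pencilL QQ. Qed.

Lemma sigma_copencil Q z : pencilL Q z \in unitmx ->
  Q z = invmx (copencilL (sigma Q) z) *m sigma Q z.
Proof.
move=> u; have Ls : pencilL Q z *m sigma Q z = Q z by exact: mulKVmx.
have -> : copencilL (sigma Q) z = invmx (pencilL Q z).
  apply: (can_inj (mulKmx u)); rewrite (mulmxV u) /copencilL.
  rewrite mulmxDr mulmxBr mulmx1 -!scalemxAr (mulmxA _ (sigma Q z)) Ls.
  exact: pencil_complement.
by rewrite invmxK Ls.
Qed.

Lemma lft_sigma_inj Q Q' : has_model (@nonreal R) Q ->
  has_model (@nonreal R) Q' ->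
  eq_nonreal (lft (sigma Q)) (lft (sigma Q')) -> eq_nonreal Q Q'.
Proof.
move=> mQ mQ' E; have [z0 [r [uz0 r0 reg]]] := regular_disc ipn Bb.
apply: (model_identity mQ mQ' uz0 r0) => z uz /reg[rz rzJ].
have nz := upper_nonreal uz.
have uL := eL_unit C2a S0P nz rzJ; have uR := eR_unit C2a S0P nz rz.
have s : sigma Q z = sigma Q' z.
  rewrite -(lftK (sigma Q) uL uR) -(lftK (sigma Q') uL uR).
  by rewrite /unlft (E z nz).
have u := model_pencilL_unit C2p_inj S0P mQ nz.
have u' := model_pencilL_unit C2p_inj S0P mQ' nz.
rewrite (sigma_copencil u) (sigma_copencil u').
by rewrite /copencilL s.
Qed.

(** The formula constrains m at regular points only. They contain a disc, and m and the transform
    are both Nevanlinna functions, so the identity theorem extends the equality to every nonreal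
    z. *)
Lemma regular_lftP pq m : nevanlinna_pair pq -> nevanlinna m ->
  (forall z, nonreal z -> regular_point ip B z ->
     let Th := Theta ip B C1 C2 C1p C2p z in
     lft_den Th (pq.1 z) (pq.2 z) \in unitmx /\
     m z = lft_num Th (pq.1 z) (pq.2 z) *m
           invmx (lft_den Th (pq.1 z) (pq.2 z))) <->
  eq_nonreal m (lft (sigma (pair_fraction pq))).
Proof.
move=> npq nm; split=> [E|E z nz rz Th].
  have [z0 [r [uz0 r0 reg]]] := regular_disc ipn Bb.
  have [nmQ _] := model_solution ipn C1a C2a C2p_inj S0P (pair_fraction_model npq).
  apply: (nevanlinna_identity nm nmQ uz0 r0) => z uz /reg[rz _].
  have nz := upper_nonreal uz.
  have [_ e] := pair_lft C1a C2a C2p_inj S0P npq nz rz.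
  exact: (etrans (E z nz rz).2 e).
have [u e] := pair_lft C1a C2a C2p_inj S0P npq nz rz.
by split; [exact: u|exact: (etrans (E z nz) (esym e))].
Qed.

End Uniqueness.

Section Adjoint.
Variable R : realType.
Local Notation C := R[i].
Variables (d : nat) (H : completeNormedModType C) (ip : {dot H for conjC}).

Lemma adjoint_linear (T : H -> 'cV[C]_d) (T' : 'cV[C]_d -> H) :
  is_adjoint ip (@cdot R d) T T' -> linear T'.
Proof.
move=> Ta a u v; apply: (ip_extl (ip := ip)) => x.
by rewrite ipDl ipZl !Ta cdotDl cdotZl.
Qed.

Lemma adjoint_inj (T : H -> 'cV[C]_d) (T' : 'cV[C]_d -> H) :
  is_adjoint ip (@cdot R d) T T' -> (forall u, exists x, T x = u) ->
  forall u, T' u = 0 -> u = 0.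
Proof.
move=> Ta sT u u0; have [x xu] := sT u.
by apply: cdot_eq0; rewrite -{2}xu -Ta u0 ip0l.
Qed.

Lemma main_op_linear (B : {linear H -> H}) (C2 : {linear H -> 'cV[C]_d})
    (C1p : {linear 'cV[C]_d -> H}) : linear (main_op B C2 C1p).
Proof.
move=> a x y; rewrite /main_op (linearP B) (linearP C2) (linearP C1p).
by rewrite opprD addrACA scalerBr.
Qed.

End Adjoint.


Theorem theorem2 (R : realType) (d : nat) (X : lmodType R[i])
  (B1 B2 : {linear X -> X}) (C1 C2 : {linear X -> 'cV[R[i]]_d})
  (K : sesquilinear X)
  (K_ge0 : forall h, 0 <= K h h)
  (A1 : forall h g, K (B2 h) (B1 g) - K (B1 h) (B2 g) =
                    cdot (C1 h) (C2 g) - cdot (C2 h) (C1 g))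
  (A3_B2 : forall h, B2 h = h)
  (A3_B1 : bounded_op K K B1)
  (A3_C1 : bounded_op K (@cdot R d) C1)
  (A3_C2 : bounded_op K (@cdot R d) C2)
  (ker_K : forall h, K h h = 0 -> h = 0)
  (ran_C2 : range C2 = setT)
  (* the completion of X *)
  (H : completeNormedModType R[i]) (ip : {dot H for conjC})
  (iota : {linear X -> H}) (H_completion : is_completion K ip iota)
  (* the continuous extensions of B1, C1, C2 to H *)
  (B1t : {linear H -> H}) (C1t C2t : {linear H -> 'cV[R[i]]_d})
  (B1t_bounded : bounded_op ip ip B1t)
  (B1t_ext : forall x, B1t (iota x) = iota (B1 x))
  (C1t_bounded : bounded_op ip (@cdot R d) C1t)
  (C1t_ext : forall x, C1t (iota x) = C1 x)
  (C2t_bounded : bounded_op ip (@cdot R d) C2t)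
  (C2t_ext : forall x, C2t (iota x) = C2 x)
  (* the Hilbert space adjoints of C1t, C2t *)
  (C1p C2p : 'cV[R[i]]_d -> H)
  (C1p_adj : is_adjoint ip (@cdot R d) C1t C1p)
  (C2p_adj : is_adjoint ip (@cdot R d) C2t C2p) :
  one_to_one_mod
    (@nevanlinna_pair R d) (@equiv_pair R d)
    (AIP_solution B1 B2 C1 C2 K) (@eq_nonreal R d)
    (fun pq m => forall z, nonreal z -> regular_point ip B1t z ->
       let Th := Theta ip B1t C1t C2t C1p C2p z in
       lft_den Th (pq.1 z) (pq.2 z) \in unitmx /\
       m z = lft_num Th (pq.1 z) (pq.2 z) *m
             invmx (lft_den Th (pq.1 z) (pq.2 z))).
Proof.
have [ipn iK dn] := H_completion.
pose c1 := to_linear (adjoint_linear C1p_adj).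
pose c2 := to_linear (adjoint_linear C2p_adj).
have C1a : is_adjoint ip (@cdot R d) C1t c1 by exact: C1p_adj.
have C2a : is_adjoint ip (@cdot R d) C2t c2 by exact: C2p_adj.
have c2_inj : forall u, c2 u = 0 -> u = 0.
  apply: (adjoint_inj C2a) => u; have : range C2 u by rewrite ran_C2.
  by move=> [x _ <-]; exists (iota x).
pose A := to_linear (main_op_linear B1t C2t c1).
have [b Ab] := main_op_bounded ipn c1 B1t_bounded C2t_bounded.
(* With B2 = 1, (A1) reads K(h, B1 g) - K(B1 h, g) = (C1 h, C2 g) - (C2 h, C1 g), which is the
   symmetry of B1 - C1^+ C2 on X. *)
have Asym h g : ip (A (iota h)) (iota g) = ip (iota h) (A (iota g)).
  rewrite /A /= /main_op ipBl ipBr C1a (adjointr _ _ C1a).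
  rewrite !B1t_ext !iK !C1t_ext !C2t_ext.
  have := A1 h g; rewrite !A3_B2.
  move: (K h _) (K _ g) (cdot (C1 h) _) (cdot (C2 h) _) => p q r s e.
  have -> : p = r - s + q by rewrite -e subrK.
  by ring.
have [S0 S0P] := selfadjoint_inversesP ipn (A := A) Ab
  (dense_symmetric ipn dn (A := A) Ab Asym).
have lftP := regular_lftP ipn C1a C2a c2_inj S0P B1t_bounded.
pose lft := lft ip c1 c2 S0; pose sigma := sigma ip c2 S0.
have sol_lft m : AIP_solution B1 B2 C1 C2 K m ->
    exists2 Q, has_model (@nonreal R) Q & eq_nonreal (lft (sigma Q)) m.
  move=> [nm [Hm [ipm [ev [Hrk [F [FE F_le]]]]]]].
  have [|h|Q [mQ QE]] := @solution_model _ _ _ _ ipn _ _ _ _ _ C1a C2a c2_inj _ S0P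
    _ iota B1 dn (fun h => B1t_ext h) B1t_bounded m _ _ _ nm Hrk F.
  - by move=> h z nz; rewrite C1t_ext C2t_ext -FE// A3_B2.
  - by rewrite iK.
  by exists Q.
split.
- move=> pq npq; have mQ := pair_fraction_model npq.
  have [nm [Hm [ipm [ev [Hrk [F [FE F_le]]]]]]] :=
    model_solution ipn C1a C2a c2_inj S0P mQ.
  exists (lft (sigma (pair_fraction pq))); split; last exact/(lftP _ _ npq nm).
  split=> //; exists Hm, ipm, ev; split=> //; exists (F \o iota : {linear X -> Hm}).
  split=> [h z nz|h] /=; last by rewrite -iK.
  by rewrite A3_B2 -B1t_ext -C1t_ext -C2t_ext FE.
- move=> m sm; have [Q mQ QE] := sol_lft m sm; have [npq fQ] := model_pair mQ.
  (* The representative of the class normalised by p - z q = 1. *)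
  exists (fun z => 1%:M + z *: Q z, Q); split=> //.
  apply/(lftP _ _ npq sm.1) => z nz; rewrite -(QE z nz).
  by apply: lft_congr; apply: sigma_congr; rewrite fQ.
- move=> pq pq' m m' npq npq' [nm _] [nm' _].
  move=> /(lftP _ _ npq nm) E /(lftP _ _ npq' nm') E'.
  have mQ := pair_fraction_model npq; have mQ' := pair_fraction_model npq'.
  rewrite (equiv_pairP npq npq'); split=> [QQ z nz|mm].
    rewrite (E z nz) (E' z nz); apply: lft_congr; apply: sigma_congr.
    exact: QQ.
  apply: (lft_sigma_inj ipn C2a c2_inj S0P B1t_bounded mQ mQ') => z nz.
  exact: (etrans (esym (E z nz)) (etrans (mm z nz) (E' z nz))).
Qed.
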